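(* Let $(H,\sigma)$ be an odd Real primary Hopf surface. The quotient $H/\langle\sigma\rangle$ can be identified with (is homeomorphic to) $S^1\times S^3$, and the canonical projection $H\to H/\langle\sigma\rangle$ is a double cover whose non-trivial deck transformation is an anti-holomorphic involution.
   Context: $W=\mathbb{C}^2\setminus\{0\}$. A primary Hopf surface is a compact complex surface with universal cover biholomorphic to $W$ and fundamental group isomorphic to $\mathbb{Z}$; it is then a quotient $W/\langle f\rangle$ for some $f\in\mathrm{Aut}_h(W)$. A Real structure on $H$ is an anti-holomorphic involution $\sigma$, and a Real primary Hopf surface is a pair $(H,\sigma)$. It is odd if $\sigma$ has a lift $\hat\sigma:W\to W$ with $\hat\sigma^2=f$, where $H=W/\langle f\rangle$. *)

(* Defs.v *)
From HB Require Import structures.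
From mathcomp Require Import all_boot all_order all_algebra.
From mathcomp Require Import generic_quotient complex.
From mathcomp Require Import all_classical all_reals all_analysis.
From mathcomp Require Import lra.

Set Implicit Arguments.
Unset Strict Implicit.
Unset Printing Implicit Defensive.

Import Order.TTheory GRing.Theory Num.Theory.
Import numFieldNormedType.Exports.
Local Open Scope classical_set_scope.
Local Open Scope ring_scope.
Local Open Scope quotient_scope.

Definition homeomorphism (X Y : topologicalType) (f : X -> Y) : Prop :=
  continuous f /\
  exists g : Y -> X, [/\ continuous g, cancel f g & cancel g f].

Definition homeomorphic (X Y : topologicalType) : Prop :=
  exists f : X -> Y, homeomorphism f.

(* The sheets over the evenly covered neighbourhood U are the members of Vs;
   p restricts to a homeomorphism from V onto U, with inverse s. *)
Definition covering_map (E B : topologicalType) (p : E -> B) : Prop :=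
  [/\ continuous p, forall b, exists e, p e = b &
   forall b : B, exists (U : set B) (Vs : set (set E)),
    [/\ open U, U b, trivIset Vs id, p @^-1` U = \bigcup_(V in Vs) V &
      forall V, Vs V -> open V /\
        exists s : B -> E,
          [/\ {within U, continuous s}, forall y, U y -> V (s y),
              forall y, U y -> p (s y) = y & forall x, V x -> s (p x) = x]]].

Definition double_cover (E B : topologicalType) (p : E -> B) : Prop :=
  covering_map p /\
  forall b : B, exists x y : E, x <> y /\ p @^-1` [set b] = [set x; y].

Definition deck_transformation (E B : topologicalType) (p : E -> B)
  (t : E -> E) : Prop := homeomorphism t /\ p \o t = p.

(* For a bijective f, this says that x and y lie in the same orbit of the
   cyclic group <f>; in this form it is an equivalence relation for any f. *)
Definition same_orbit (T : Type) (f : T -> T) (x y : T) : Prop :=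
  exists m n : nat, iter m f x = iter n f y.

Section OrbitSpace.
Variables (T : topologicalType) (f : T -> T).

Definition orbit_rel : rel T := fun x y => `[< same_orbit f x y >].

Lemma orbit_rel_refl : reflexive orbit_rel.
Proof. by move=> x; apply/asboolP; exists 0%N, 0%N. Qed.

Lemma orbit_rel_sym : symmetric orbit_rel.
Proof.
by move=> x y; apply/asboolP/asboolP => -[m [n e]]; exists n, m.
Qed.

Lemma orbit_rel_trans : transitive orbit_rel.
Proof.
move=> y x z /asboolP[m [n e]] /asboolP[m' [n' e']]; apply/asboolP.
exists (m' + m)%N, (n + n')%N.
by rewrite iterD e -iterD addnC iterD e' -iterD.
Qed.

Definition orbit_equiv : equiv_rel T :=
  EquivRel orbit_rel orbit_rel_refl orbit_rel_sym orbit_rel_trans.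

Definition orbit_space : topologicalType :=
  quotient_topology {eq_quot orbit_equiv}.

Definition orbit_proj (x : T) : orbit_space :=
  \pi_{eq_quot orbit_equiv} x.

End OrbitSpace.

(* A path is encoded as a function on R of which only the restriction to [0, 1]
   matters. *)
Section Paths.
Variables (R : realType) (X : topologicalType).
Implicit Types (x y : X) (a b : R -> X).

Definition is_path x y a : Prop :=
  [/\ {within `[0, 1], continuous a}, a 0 = x & a 1 = y].

Definition path_connected : Prop := forall x y, exists a, is_path x y a.

Definition path_homotopic a b : Prop :=
  exists h : R * R -> X,
    [/\ {within `[0, 1] `*` `[0, 1], continuous h},
      forall t, t \in `[0, 1] -> h (0, t) = a t /\ h (1, t) = b t &
      forall s, s \in `[0, 1] -> h (s, 0) = a 0 /\ h (s, 1) = a 1].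

Definition path_concat a b : R -> X :=
  fun t => if t <= 2^-1 then a (2 * t) else b (2 * t - 1).

Definition simply_connected : Prop :=
  path_connected /\
  forall x a, is_path x x a -> path_homotopic a (fun=> x).

(* pi_1(X, x) is isomorphic to Z: phi is a function on loops which factors
   through a bijective group homomorphism from homotopy classes to Z. *)
Definition fundamental_group_isom_Z x : Prop :=
  exists phi : (R -> X) -> int,
    [/\ forall a b, is_path x x a -> is_path x x b ->
          phi (path_concat a b) = phi a + phi b,
        forall a b, is_path x x a -> is_path x x b ->
          (phi a = phi b <-> path_homotopic a b) &
        forall k : int, exists2 a, is_path x x a & phi a = k].

End Paths.

(* The Euclidean unit sphere S^n in R^(n+1); the library norm on row vectors is
   the sup norm, hence the explicit sum of squares. *)
Definition sphere (R : realType) (n : nat) : set 'rV[R]_n.+1 :=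
  [set v | \sum_i v ord0 i ^+ 2 = 1].
Arguments sphere : clear implicits.

Definition Cplx (R : realType) : numClosedFieldType := R[i].

Definition C2 (R : realType) : normedModType (Cplx R) := 'rV[Cplx R]_2.

Definition conjC2 (R : realType) (z : C2 R) : C2 R := map_mx Num.conj z.

(* chart_fun is only meaningful on chart_dom, and chart_inv on the image of
   chart_dom. *)
Record chart (R : realType) (X : topologicalType) := Chart {
  chart_dom : set X;
  chart_fun :> X -> C2 R;
  chart_inv : C2 R -> X;
  chart_dom_open : open chart_dom;
  chart_image_open : open (chart_fun @` chart_dom);
  chart_funK : forall x, chart_dom x -> chart_inv (chart_fun x) = x;
  chart_fun_continuous : {within chart_dom, continuous chart_fun};
  chart_inv_continuous : {within chart_fun @` chart_dom, continuous chart_inv}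
}.

(* [differentiable] is over the complex field Cplx R, since C2 R is a normed
   module over Cplx R. *)
Record complexSurface (R : realType) := ComplexSurface {
  csurf_space :> topologicalType;
  csurf_hausdorff : hausdorff_space csurf_space;
  csurf_second_countable : @second_countable csurf_space;
  atlas : set (chart R csurf_space);
  atlas_cover : forall x, exists2 c, atlas c & chart_dom c x;
  atlas_compatible : forall c d, atlas c -> atlas d -> forall x,
    chart_dom c x -> chart_dom d x ->
    differentiable (d \o chart_inv c) (c x)
}.

Section HolomorphicMaps.
Variables (R : realType) (X Y : complexSurface R).

(* Only meaningful for open D: differentiability in a chart is tested on a full
   neighbourhood. *)
Definition holomorphic_on (D : set X) (F : X -> Y) : Prop :=
  {within D, continuous F} /\
  forall c d, atlas c -> atlas d -> forall x,
    D x -> chart_dom c x -> chart_dom d (F x) ->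
    differentiable (d \o F \o chart_inv c) (c x).

Definition holomorphic (F : X -> Y) : Prop := holomorphic_on setT F.

Definition antiholomorphic (F : X -> Y) : Prop :=
  continuous F /\
  forall c d, atlas c -> atlas d -> forall x,
    chart_dom c x -> chart_dom d (F x) ->
    differentiable (@conjC2 R \o d \o F \o chart_inv c) (c x).

End HolomorphicMaps.

Section BiholomorphicMaps.
Variables (R : realType) (X Y : complexSurface R).

Definition biholomorphism (F : X -> Y) : Prop :=
  holomorphic F /\
  exists G : Y -> X, [/\ holomorphic G, cancel F G & cancel G F].

Definition biholomorphic : Prop := exists F : X -> Y, biholomorphism F.

Definition locally_biholomorphic (p : X -> Y) : Prop :=
  forall x : X, exists U : set X,
    [/\ open U, U x, open (p @` U), holomorphic_on U p &
      exists2 g : Y -> X, holomorphic_on (p @` U) g &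
        forall z, U z -> g (p z) = z].

(* The complex structure of X is the one pulled back from Y along p. *)
Definition holomorphic_covering (p : X -> Y) : Prop :=
  covering_map p /\ locally_biholomorphic p.

Definition holomorphic_universal_covering (p : X -> Y) : Prop :=
  holomorphic_covering p /\ simply_connected R X.

End BiholomorphicMaps.


Section PuncturedPlane.
Variable R : realType.
Local Notation C := (Cplx R).

Definition punctured_plane : set (C2 R) := [set z | z != 0].

Let Wt : topologicalType := punctured_plane.

Let W0_subproof : (const_mx 1 : C2 R) \in punctured_plane.
Proof.
apply/mem_set/eqP => /matrixP/(_ ord0 ord0); rewrite !mxE => /eqP.
by rewrite oner_eq0.
Qed.

Let W0 : Wt := exist _ (const_mx 1) W0_subproof.
Let Winv (z : C2 R) : Wt := insubd W0 z.

Let WinvK z : z != 0 -> set_val (Winv z) = z.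
Proof. by move=> z0; rewrite /Winv set_valE insubdK// inE. Qed.

Let Wval_neq0 (x : Wt) : set_val x != 0.
Proof. by have := set_valP x. Qed.

Let Wimage : set_val @` [set: Wt] = punctured_plane.
Proof.
apply/seteqP; split => [_ [x _ <-]|z z0]; first exact: Wval_neq0.
by exists (Winv z) => //; rewrite WinvK.
Qed.

Let open_punctured : open punctured_plane.
Proof.
rewrite (_ : punctured_plane = ~` [set 0]).
  apply/closed_openC/accessible_closed_set1/hausdorff_accessible.
  exact: norm_hausdorff.
by apply/seteqP; split => z /= /eqP.
Qed.

Let Wimage_open : open (set_val @` [set: Wt]).
Proof. by rewrite Wimage. Qed.

Let WvalK (x : Wt) : setT x -> Winv (set_val x) = x.
Proof. by move=> _; apply: val_inj; exact: WinvK. Qed.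

Let Wval_continuous : {within [set: Wt], continuous (set_val : Wt -> C2 R)}.
Proof.
apply: continuous_subspaceT; exact: initial_continuous.
Qed.


Let Winv_continuous :
  {within set_val @` [set: Wt], continuous Winv}.
Proof.
rewrite Wimage; apply/subspace_continuousP => z z0 V.
rewrite nbhsE => -[U [[A oA <-] /= AWz] AV].
have Az : nbhs z A by apply: open_nbhs_nbhs; split=> //; rewrite -(WinvK z0).
change (nbhs z [set y | punctured_plane y -> V (Winv y)]).
by apply: filterS Az => y Ay y0; apply: AV; rewrite /= WinvK.
Qed.

Let W_hausdorff : hausdorff_space Wt.
Proof.
move=> x y xy; apply: val_inj; apply: (@norm_hausdorff _ (C2 R)) => A B Ax By.
have [z [Az Bz]] := xy _ _ (@initial_continuous Wt _ set_val x _ Ax)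
  (@initial_continuous Wt _ set_val y _ By).
by exists (set_val z).
Qed.

Let rat_approx (x e : C) : 0 < e ->
  exists q : rat * rat, `|x - (ratr q.1 +i* ratr q.2)%C| < e.
Proof.
case: x e => a b [r s] /=; rewrite ltcE /= => /andP[/eqP -> r0].
have r2 : 0 < r / 2 by rewrite divr_gt0.
have [q] := @rat_in_itvoo R (a - r / 2) a ltac:(by rewrite ltrBlDr ltrDl).
have [q'] := @rat_in_itvoo R (b - r / 2) b ltac:(by rewrite ltrBlDr ltrDl).
rewrite !in_itv /= => /andP[h1 h2] /andP[h3 h4]; exists (q, q').
rewrite normc_def ltcR /= -(gtr0_norm r0) -sqrtr_sqr ltr_sqrt ?exprn_gt0//.
nra.
Qed.

Let box (k : 'rV[rat * rat]_2 * nat) : set (C2 R) :=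
  ball (map_mx (fun q => (ratr q.1 +i* ratr q.2)%C : C) k.1 : C2 R)
       ((k.2.+1%:R^-1)%:C%C : C).

Let box_basis (z : C2 R) (A : set (C2 R)) : nbhs z A ->
  exists k, box k z /\ box k `<=` A.
Proof.
move=> /nbhs_ballP[[r s] /=]; rewrite ltcE /= => /andP[/eqP -> r0] eA.
have [n en] : exists n : nat, (n.+1%:R^-1 : R) < r / 2.
  have r2 : 0 < r / 2 by rewrite divr_gt0.
  have [n _ hn] := near_infty_natSinv_lt (PosNum r2).
  by exists n; apply: hn => /=.
have n0 : (0 : C) < (n.+1%:R^-1)%:C%C by rewrite ltcR invr_gt0 ltr0n.
have hq' : forall i : 'I_2, exists q : rat * rat,
    `|z ord0 i - (ratr q.1 +i* ratr q.2)%C| < ((n.+1%:R^-1)%:C%C : C).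
  by move=> i; exact: rat_approx.
have [q hq] := choice hq'.
set k := (\row_i q i, n) : 'rV[rat * rat]_2 * nat.
have zk : ball z ((n.+1%:R^-1)%:C%C : C) (map_mx (fun q => (ratr q.1 +i* ratr q.2)%C : C) k.1 : C2 R).
  by split=> // i j; rewrite !mxE ord1; exact: hq.
exists k; split; first exact/ball_sym.
move=> y ky; apply: eA; apply: (@le_ball _ _ _ ((n.+1%:R^-1)%:C%C + (n.+1%:R^-1)%:C%C : C)).
  rewrite -rmorphD /= lecE /= eqxx /=. move: (ltW en) => {}en; rewrite [leRHS](splitr r) lerD//.
exact: ball_triangle zk ky.
Qed.

Let open_box k : open (box k).
Proof. exact: ball_open. Qed.

Let W_second_countable : @second_countable Wt.
Proof.
exists (range (fun k => set_val @^-1` (box k) : set Wt)).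
  by apply: (card_le_trans (card_image_le _ _)); exact: countableP.
split=> [_ [k _ <-]|x A]; first by exists (box k).
rewrite nbhsE => -[U [[B oB <-] /= Bx] BA].
have [k [kx kB]] := box_basis (open_nbhs_nbhs (conj oB Bx)).
exists (set_val @^-1` box k); first by split=> //; exists k.
by move=> y /= ky; apply: BA; apply: kB.
Qed.

Let Wchart : chart R Wt := @Chart R Wt setT set_val Winv
  openT Wimage_open WvalK Wval_continuous Winv_continuous.

Let near_id_differentiable (f : C2 R -> C2 R) (z : C2 R) :
  (\forall y \near z, f y = y) -> differentiable f z.
Proof.
move=> fid; have df : f \o shift z = cst (f z) + idfun +o_ 0 id.
  apply/eqaddoP => e e0.
  have := fid; rewrite (near_shift 0) subr0; apply: filterS => h /= fh.
  rewrite /GRing.add_fun /= !fctE /= (nbhs_singleton fid) fh.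
  by rewrite [h + z]addrC subrr normr0 mulr_ge0// ltW.
have idc : continuous (idfun : {linear C2 R -> C2 R}) by move=> ?.
apply/diff_locallyP; rewrite (diff_unique idc df).
by split.
Qed.

Let Wcompatible (c d : chart R Wt) : [set Wchart] c -> [set Wchart] d ->
  forall x, chart_dom c x -> chart_dom d x ->
  differentiable (d \o chart_inv c) (c x).
Proof.
move=> -> -> x _ _ /=; apply: near_id_differentiable.
have := open_nbhs_nbhs (conj open_punctured (Wval_neq0 x)).
by apply: filterS => y /= y0; rewrite WinvK.
Qed.

Let Wcover x : exists2 c, [set Wchart] c & chart_dom c x.
Proof. by exists Wchart. Qed.

Definition W : complexSurface R := @ComplexSurface R Wt W_hausdorff
  W_second_countable [set Wchart] Wcover Wcompatible.

End PuncturedPlane.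

Section HopfSurfaces.
Variables (R : realType) (H : complexSurface R).

(* As H is path-connected, the choice of base point is immaterial. *)
Definition primary_Hopf_surface : Prop :=
  [/\ compact [set: H], connected [set: H],
    exists (E : complexSurface R) (p : E -> H),
      holomorphic_universal_covering p /\ biholomorphic E (W R) &
    exists x : H, fundamental_group_isom_Z R x].

(* Via p, the surface H is the quotient W/<f>: the fibres of p are the orbits of
   <f>, and the topology and complex structure of H are induced through p. *)
Definition Hopf_presentation (f : W R -> W R) (p : W R -> H) : Prop :=
  [/\ biholomorphism f, holomorphic_covering p &
    forall x y, p x = p y <-> same_orbit f x y].

Definition real_structure (sigma : H -> H) : Prop :=
  antiholomorphic sigma /\ involutive sigma.

Definition odd_real_structure (sigma : H -> H) : Prop :=
  exists (f : W R -> W R) (p : W R -> H) (sigma_hat : W R -> W R),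
    [/\ Hopf_presentation f p, continuous sigma_hat,
      p \o sigma_hat = sigma \o p & sigma_hat \o sigma_hat = f].

End HopfSurfaces.

(* Main.v *)
Require Import Defs.
From mathcomp Require Import all_boot all_order all_algebra.
From mathcomp Require Import generic_quotient complex.
From mathcomp Require Import all_classical all_reals all_analysis.
From mathcomp Require Import ring lra.

Set Implicit Arguments.
Unset Strict Implicit.
Unset Printing Implicit Defensive.

Import Order.TTheory GRing.Theory Num.Theory.
Import numFieldNormedType.Exports.
Local Open Scope classical_set_scope.
Local Open Scope ring_scope.

(* Let g be the lift of sigma with g o g = f.  The map conj o g is holomorphic
   on C^2 minus the origin.  The maximum principle and Cauchy estimates on
   complex lines missing the origin show that g is strictly differentiable at 0,
   with invertible antilinear derivative M.  Compactness of W/<f> and proper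
   discontinuity force f or its inverse to attract every point to 0; say f.  Then
   some iterate of M is contracting, and cutting g off near 0 yields a conjugacy
   on C^2 minus 0 between g and M.  Since GL_2(C) is connected, M is conjugate to
   a multiple of the conjugation, and since a reflection of two real coordinates
   is connected to the identity, M is finally conjugate to z |-> c z with
   0 < c < 1.  Hence W/<g> is homeomorphic to S^1 x S^3 through
   z |-> (exp (2 pi i ln |z| / ln c), z / |z|), and W/<g> = H/<sigma>.  A fixed
   point of sigma would give a periodic point of f, so sigma acts freely. *)

(** * Norms and coordinates on C^2 *)

(** Resonances can obstruct a holomorphic linearisation, whereas a topological conjugacy only needs
    g to be Lipschitz-close to M near 0. This is why a strict derivative is established, and why
    conjugacies are only asked to be continuous off 0. They all have one origin: if two
    homeomorphisms g and G agree on an open set that they preserve and that all forward orbits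
    enter, then g^-n o G^n is eventually constant in n and intertwines them. This is used near 0 for
    g and its cut-off, near infinity for the inverses of the cut-off and of M, and in small steps
    along segments of linear maps. Contraction must persist along such segments, so the maps are
    first multiplied by a small constant. The complex analysis rests on a maximum principle for
    continuous functions that are holomorphic off a finite set. The exceptional points make it
    applicable to difference quotients and to lines through the origin, and the Cauchy estimates are
    bounds of such quotients. Freeness and proper discontinuity of <f> have to be derived, from the
    covering, the compactness of H and the connectedness of W. *)

Section RealNorm.
Variable R : realType.
Local Notation C := (Cplx R).
Implicit Types V U : normedModType (Cplx R).

(* The library norm on a module over [Cplx R] is complex valued. *)
Definition nr V (x : V) : R := complex.Re `|x|.

Lemma nrE V (x : V) : `|x| = ((nr x)%:C)%C :> C.
Proof.
rewrite /nr; have := normr_ge0 x; case: `|x| => a b.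
by rewrite lecE /= => /andP[/eqP -> _].
Qed.

Lemma nr_le V (x : V) (r : R) : (`|x| <= (r%:C)%C :> C) = (nr x <= r).
Proof. by rewrite nrE lecR. Qed.

Lemma nr_lt V (x : V) (r : R) : (`|x| < (r%:C)%C :> C) = (nr x < r).
Proof. by rewrite nrE ltcR. Qed.

Lemma nr_ge0 V (x : V) : 0 <= nr x.
Proof. by rewrite -lecR -nrE; exact: normr_ge0. Qed.

Lemma nr0 V : nr (0 : V) = 0.
Proof. by rewrite /nr normr0. Qed.

Lemma nr_eq0 V (x : V) : (nr x == 0) = (x == 0).
Proof. by rewrite -[RHS]normr_eq0 nrE; apply/eqP/eqP => [->//|[]]. Qed.

Lemma nr_gt0 V (x : V) : (0 < nr x) = (x != 0).
Proof. by rewrite lt_def nr_ge0 nr_eq0 andbT. Qed.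

Lemma nrN V (x : V) : nr (- x) = nr x.
Proof. by rewrite /nr normrN. Qed.

Lemma nrBC V (x y : V) : nr (x - y) = nr (y - x).
Proof. by rewrite -nrN opprB. Qed.

Lemma nrD V (x y : V) : nr (x + y) <= nr x + nr y.
Proof. by rewrite -lecR rmorphD /= -!nrE ler_normD. Qed.

Lemma nrB V (x y : V) : nr (x - y) <= nr x + nr y.
Proof. by rewrite -(nrN y) nrD. Qed.

Lemma nr_tri V (y x z : V) : nr (x - z) <= nr (x - y) + nr (y - z).
Proof. by rewrite -[x - z](subrKA y) nrD. Qed.

Lemma nr_sub V (x y : V) : nr x - nr y <= nr (x - y).
Proof. by rewrite lerBlDr -{1}[x](subrK y) nrD. Qed.

Lemma nr_dist V (x y : V) : `|nr x - nr y| <= nr (x - y).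
Proof. by rewrite ler_norml nr_sub andbT lerNl opprB nrBC nr_sub. Qed.

Lemma nrZ V (a : C) (x : V) : nr (a *: x) = nr a * nr x.
Proof. by apply: complexI; rewrite rmorphM /= -!nrE normrZ. Qed.

Lemma nrM (a b : C) : nr (a * b) = nr a * nr b.
Proof. exact: (nrZ a (b : C)). Qed.

Lemma nrV (a : C) : nr a^-1 = (nr a)^-1.
Proof.
by apply: complexI; rewrite -nrE normfV nrE fmorphV.
Qed.

Lemma nr_real (r : R) : nr ((r%:C)%C : C) = `|r|.
Proof.
apply: complexI; rewrite -nrE normc_def /= expr0n addr0.
by rewrite sqrtr_sqr.
Qed.

Lemma nrconj (z : C) : nr (Num.conj z : C) = nr z.
Proof. by rewrite /nr norm_conjC. Qed.

Lemma nr_sqr (z : C) : nr z ^+ 2 = complex.Re z ^+ 2 + complex.Im z ^+ 2.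
Proof.
rewrite /nr normc_def /= sqr_sqrtr// addr_ge0// sqr_ge0//.
Qed.

Lemma Re_le_nr (z : C) : `|complex.Re z| <= nr z.
Proof.
rewrite -(@ler_pXn2r _ 2)// ?nnegrE ?nr_ge0// nr_sqr real_normK ?num_real//.
by rewrite lerDl sqr_ge0.
Qed.

Lemma Im_le_nr (z : C) : `|complex.Im z| <= nr z.
Proof.
rewrite -(@ler_pXn2r _ 2)// ?nnegrE ?nr_ge0// nr_sqr real_normK ?num_real//.
by rewrite lerDr sqr_ge0.
Qed.

Lemma nr_ReIm (z : C) : nr z <= `|complex.Re z| + `|complex.Im z|.
Proof.
rewrite -(@ler_pXn2r _ 2)// ?nnegrE ?nr_ge0 ?addr_ge0// nr_sqr.
rewrite sqrrD !real_normK ?num_real//.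
by rewrite lerD2r lerDl mulrn_wge0 ?mulr_ge0.
Qed.

Lemma nr_sum V (I : Type) (s : seq I) (P : pred I) (F : I -> V) :
  nr (\sum_(i <- s | P i) F i) <= \sum_(i <- s | P i) nr (F i).
Proof.
elim/big_ind2 : _ => //; first by rewrite nr0.
by move=> x1 x2 y1 y2 h1 h2; apply: le_trans (nrD _ _) _; rewrite lerD.
Qed.

Lemma nbhs_nrP V (x : V) (A : set V) :
  nbhs x A <-> exists2 r : R, 0 < r & forall y, nr (x - y) < r -> A y.
Proof.
split=> [/nbhs_normP[[r s]] /=|[r r0 rA]].
  rewrite ltcE /= => /andP[/eqP -> r0] rA; exists r => // y xy.
  by apply: rA; rewrite /ball_ /= nr_lt.
apply/nbhs_normP; exists (r%:C)%C => /=; first by rewrite ltcR.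
by move=> y /=; rewrite nr_lt => /rA.
Qed.

Lemma cont_nrP V U (f : V -> U) (x : V) : {for x, continuous f} <->
  forall e : R, 0 < e -> exists2 d : R, 0 < d & forall y, nr (x - y) < d -> nr (f x - f y) < e.
Proof.
split=> [fx e e0|fx A /nbhs_nrP[e e0 eA]].
  have /fx/nbhs_nrP // : nbhs (f x) [set y | nr (f x - y) < e].
  by apply/nbhs_nrP; exists e.
have [d d0 dP] := fx _ e0; apply/nbhs_nrP; exists d => // y xy.
exact/eA/dP.
Qed.

Lemma contR_nrP V (f : V -> R) (x : V) : {for x, continuous f} <->
  forall e : R, 0 < e -> exists2 d : R, 0 < d & forall y, nr (x - y) < d -> `|f x - f y| < e.
Proof.
split=> [fx e e0|fx A /nbhs_ballP[e e0 eA]].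
  have /fx/nbhs_nrP // : nbhs (f x) [set y | `|f x - y| < e].
  by apply/nbhs_ballP; exists e.
have [d d0 dP] := fx _ e0; apply/nbhs_nrP; exists d => // y xy.
exact/eA/dP.
Qed.

Lemma nr_continuous V : continuous (@nr V).
Proof.
move=> x; apply/contR_nrP => e e0; exists e => // y.
by apply: le_lt_trans; exact: nr_dist.
Qed.

Lemma Re_continuous : continuous (fun z : C => complex.Re z).
Proof.
move=> x; apply/contR_nrP => e e0; exists e => // y.
by apply: le_lt_trans; rewrite -raddfB Re_le_nr.
Qed.

Lemma Im_continuous : continuous (fun z : C => complex.Im z).
Proof.
move=> x; apply/contR_nrP => e e0; exists e => // y.
by apply: le_lt_trans; rewrite -raddfB Im_le_nr.
Qed.

Lemma closed_nr_le V (r : R) : closed [set z : V | nr z <= r].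
Proof.
apply: (@closed_comp _ _ (@nr V) [set x | x <= r]); last exact: closed_le.
by move=> x _; exact: nr_continuous.
Qed.

Lemma compact_disc (r : R) : compact [set z : C | nr z <= r].
Proof.
pose A : set (R * R) := `[- r, r] `*` `[- r, r].
have cA : compact A by apply: compact_setX; exact: segment_compact.
pose f (p : R * R) : C := (p.1 +i* p.2)%C.
have cf : continuous f.
  move=> p B /nbhs_nrP[e e0 eB].
  apply/nbhs_ballP; exists (e / 2); first by rewrite /= divr_gt0.
  move=> q [/= h1 h2]; apply: eB; apply: le_lt_trans (nr_ReIm _) _ => /=.
  by rewrite (splitr e) ltrD.
apply: (@subclosed_compact _ _ (f @` A)).
- exact: closed_nr_le.
- by apply: continuous_compact => //; exact: continuous_subspaceT.
move=> [a b] /= h; exists (a, b) => //=; split=> /=; rewrite in_itv /= -ler_norml.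
  exact: le_trans (Re_le_nr (a +i* b)%C) h.
exact: le_trans (Im_le_nr (a +i* b)%C) h.
Qed.

End RealNorm.

Section Coordinates.
Variable R : realType.
Local Notation C := (Cplx R).

Lemma nr_rV_le (v : C2 R) (r : R) : 0 <= r ->
  nr v <= r <-> nr (v ord0 ord0) <= r /\ nr (v ord0 (lift ord0 ord0)) <= r.
Proof.
move=> r0; have rC : (0 : C) <= (r%:C)%C by rewrite lecR.
rewrite -!nr_le [X in X <= _]/Num.norm /= mx_normE -[(r%:C)%C]/((NngNum rC)%:num).
rewrite num_le; split.
  move/bigmax_leP => [_ h]; split.
    by have := h (ord0, ord0) isT; rewrite -num_le.
  by have := h (ord0, lift ord0 ord0) isT; rewrite -num_le.
move=> [h0 h1]; apply/bigmax_leP; split; first by rewrite -num_le.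
move=> [i j] _; rewrite -num_le /= ord1.
by case: (unliftP ord0 j) => [k ->|->//]; rewrite (ord1 k).
Qed.

Definition c2 (a b : C) : C2 R := \row_i (if i == ord0 then a else b).

Definition fst2 (z : C2 R) : C := z ord0 ord0.
Definition snd2 (z : C2 R) : C := z ord0 (lift ord0 ord0).

Lemma fst2K a b : fst2 (c2 a b) = a. Proof. by rewrite /fst2 mxE. Qed.
Lemma snd2K a b : snd2 (c2 a b) = b. Proof. by rewrite /snd2 mxE. Qed.

Lemma c2P (z w : C2 R) : fst2 z = fst2 w -> snd2 z = snd2 w -> z = w.
Proof.
move=> h0 h1; apply/rowP => j.
by case: (unliftP ord0 j) => [k ->|->//]; rewrite (ord1 k).
Qed.

Lemma c2_eta z : c2 (fst2 z) (snd2 z) = z.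
Proof. by apply: c2P; rewrite ?fst2K ?snd2K. Qed.

Lemma nr_fst2 z : nr (fst2 z) <= nr z.
Proof. by have [/(_ (lexx _))[]] := nr_rV_le z (nr_ge0 z). Qed.

Lemma nr_snd2 z : nr (snd2 z) <= nr z.
Proof. by have [/(_ (lexx _))[]] := nr_rV_le z (nr_ge0 z). Qed.

Lemma nr2_le (z : C2 R) r : nr (fst2 z) <= r -> nr (snd2 z) <= r -> nr z <= r.
Proof. by move=> h0 h1; apply/nr_rV_le; [exact: le_trans (nr_ge0 _) h0|]. Qed.

Lemma nr2_lt (z : C2 R) r : nr (fst2 z) < r -> nr (snd2 z) < r -> nr z < r.
Proof.
move=> h0 h1; apply: (@le_lt_trans _ _ (Num.max (nr (fst2 z)) (nr (snd2 z)))).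
  by apply: nr2_le; rewrite le_max lexx ?orbT.
by rewrite gt_max h0.
Qed.

Lemma fst2B z w : fst2 (z - w) = fst2 z - fst2 w. Proof. by rewrite /fst2 !mxE. Qed.
Lemma snd2B z w : snd2 (z - w) = snd2 z - snd2 w. Proof. by rewrite /snd2 !mxE. Qed.
Lemma fst2D z w : fst2 (z + w) = fst2 z + fst2 w. Proof. by rewrite /fst2 !mxE. Qed.
Lemma snd2D z w : snd2 (z + w) = snd2 z + snd2 w. Proof. by rewrite /snd2 !mxE. Qed.
Lemma fst2Z a z : fst2 (a *: z) = a * fst2 z. Proof. by rewrite /fst2 !mxE. Qed.
Lemma snd2Z a z : snd2 (a *: z) = a * snd2 z. Proof. by rewrite /snd2 !mxE. Qed.

Lemma c2_eq0 a b : (c2 a b == 0) = (a == 0) && (b == 0).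
Proof.
apply/eqP/andP => [h|[/eqP-> /eqP->]].
  split; apply/eqP.
    by rewrite -(fst2K a b) h /fst2 mxE.
  by rewrite -(snd2K a b) h /snd2 mxE.
by apply: c2P; rewrite ?fst2K ?snd2K /fst2 /snd2 mxE.
Qed.

Lemma fst2_continuous : continuous fst2.
Proof.
move=> x; apply/cont_nrP => e e0; exists e => // y.
by apply: le_lt_trans; rewrite -fst2B nr_fst2.
Qed.

Lemma snd2_continuous : continuous snd2.
Proof.
move=> x; apply/cont_nrP => e e0; exists e => // y.
by apply: le_lt_trans; rewrite -snd2B nr_snd2.
Qed.

Lemma compact_ball2 (r : R) : compact [set z : C2 R | nr z <= r].
Proof.
have [r0|r0] := leP 0 r; last first.
  rewrite (_ : [set _ | _] = set0); first exact: compact0.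
  by apply/seteqP; split=> z //= h; have := le_lt_trans h r0; rewrite ltNge nr_ge0.
apply: (@subclosed_compact _ _ [set v : 'rV[C]_2 | forall i, nr (v ord0 i) <= r]).
- exact: closed_nr_le.
- by apply: (@rV_compact C _ (fun=> [set z : C | nr z <= r])) => i; exact: compact_disc.
- move=> z /= /(nr_rV_le _ r0)[h0 h1] j.
  by case: (unliftP ord0 j) => [k ->|->//]; rewrite (ord1 k).
Qed.

End Coordinates.

(** * Differentiability in terms of real-valued norms *)

Section Differentials.
Variable R : realType.
Local Notation C := (Cplx R).

Lemma diff_eps (V W : normedModType C) (h : V -> W) (a : V) : differentiable h a ->
  forall e : R, 0 < e -> exists2 d : R, 0 < d & forall z, nr (z - a) < d ->
    nr (h z - h a - 'd h a (z - a)) <= e * nr (z - a).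
Proof.
move=> /diff_locally/eqaddoP dh e e0.
have eC : (0 : C) < (e%:C)%C by rewrite ltcR.
have /nbhs_nrP[d d0 dP] := dh _ eC; exists d => // z za.
have := dP (z - a); rewrite sub0r nrN => /(_ za) /=.
have -> : (h \o shift a - (cst (h a) + 'd h a)) (z - a) = h z - h a - 'd h a (z - a).
  by rewrite -addrA -opprD -{2}(subrK a z).
by rewrite (nrE (z - a)) nrE -rmorphM lecR.
Qed.

Lemma diffC_eps (W : normedModType C) (h : C -> W) (a : C) : differentiable h a ->
  exists b : W, forall e : R, 0 < e -> exists2 d : R, 0 < d & forall z, nr (z - a) < d ->
    nr (h z - h a - (z - a) *: b) <= e * nr (z - a).
Proof.
move=> /diff_eps dh; exists ('d h a 1) => e /dh[d d0 dP]; exists d => // z /dP.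
rewrite -[in 'd h a (z - a)](mulr1 (z - a)).
by have -> : 'd h a ((z - a) * 1) = (z - a) *: 'd h a 1 by exact: linearZ_LR.
Qed.

Lemma eps_diffC (W : normedModType C) (h : C -> W) (a : C) (b : W) :
  (forall e : R, 0 < e -> exists2 d : R, 0 < d & forall z, nr (z - a) < d ->
    nr (h z - h a - (z - a) *: b) <= e * nr (z - a)) -> differentiable h a.
Proof.
move=> dh; apply/derivable1_diffP/cvg_ex; exists b => A /nbhs_nrP[e e0 eA].
have e2 : 0 < e / 2 by rewrite divr_gt0.
have [d d0 dP] := dh _ e2.
apply/nbhs_nrP; exists d => // u; rewrite sub0r nrN => ud u0 /=; apply: eA.
have := dP (u + a); rewrite addrK => /(_ ud) h1.
rewrite /shift /= [u *: 1]mulr1.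
have nu : 0 < nr u by rewrite nr_gt0.
rewrite -(ltr_pM2l nu) -nrZ scalerBr scalerA divff// scale1r nrBC.
by apply: le_lt_trans h1 _; rewrite mulrC ltr_pM2l// ltr_pdivrMr// mulr_natr mulr2n ltrDl.
Qed.

(** Differentiability is local: [diff_unique] identifies the differential of [k] with that of
    [h]. *)
Lemma near_diff (V W : normedModType C) (h k : V -> W) (a : V) :
  (\forall x \near a, h x = k x) -> differentiable h a -> differentiable k a.
Proof.
move=> hk dh; have [dc dl] := (diff_locallyP a h).1 dh.
have df : k \o shift a = cst (k a) + 'd h a +o_0 id.
  apply/eqaddoP => e e0; have /eqaddoP/(_ e e0) := dl.
  rewrite -(nbhs_singleton hk).
  have := hk; rewrite (near_shift 0) subr0; apply: filterS2 => x /= hx.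
  have -> // : (k \o shift a - (cst (h a) + 'd h a)) x = (h \o shift a - (cst (h a) + 'd h a)) x.
  by transitivity (k (x + a) - (h a + 'd h a x)); [|rewrite -hx].
by apply/diff_locallyP; rewrite (diff_unique dc df); split.
Qed.

End Differentials.

(** * The complex exponential *)

Section ComplexExp.
Variable R : realType.
Local Notation C := (Cplx R).

Definition cexp (u : C) : C :=
  (expR (complex.Re u) * cos (complex.Im u) +i* (expR (complex.Re u) * sin (complex.Im u)))%C.

Definition ii : C := (0 +i* 1)%C.

Lemma nr_ii : nr ii = 1.
Proof.
by apply/eqP; rewrite -(@eqrXn2 _ 2)// ?nr_ge0// nr_sqr /= expr0n add0r expr1n.
Qed.

Lemma cexpD u v : cexp (u + v) = cexp u * cexp v.
Proof.
case: u v => [a b] [c d]; rewrite /cexp /= expRD cosD sinD; apply/eqP.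
by rewrite eq_complex /=; apply/andP; split; apply/eqP; ring.
Qed.

Lemma nr_cexp u : nr (cexp u) = expR (complex.Re u).
Proof.
apply/eqP; rewrite -(@eqrXn2 _ 2)// ?nr_ge0 ?expR_ge0// nr_sqr /=.
by rewrite !exprMn -mulrDr cos2Dsin2 mulr1.
Qed.

Lemma cexp_period u : cexp (u + ii * ((pi *+ 2 : R)%:C)%C) = cexp u.
Proof.
rewrite cexpD (_ : cexp (ii * _) = 1) ?mulr1//.
have -> : ii * ((pi *+ 2 : R)%:C)%C = (0 +i* (pi *+ 2))%C.
  by apply/eqP; rewrite eq_complex /=; apply/andP; split; apply/eqP; ring.
by rewrite /cexp /= expR0 cos2pi sin2pi mulr0 mulr1.
Qed.

Lemma derive_eps (f : R -> R) (l : R) : is_derive (0 : R) 1 f l ->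
  forall e : R, 0 < e -> exists2 d : R, 0 < d & forall x, `|x| < d -> `|f x - f 0 - l * x| <= e * `|x|.
Proof.
move=> [df dl] e e0.
have : (fun h : R => h^-1 *: ((f \o shift 0) (h *: 1) - f 0)) @ 0^' --> l.
  by rewrite -dl.
move=> /cvgrPdist_le/(_ e e0)/nbhs_ballP[d d0 dP]; exists d => // x xd.
have [->|x0] := eqVneq x 0; first by rewrite subrr mulr0 subrr normr0 mulr0.
have := dP x; rewrite /ball /= sub0r normrN => /(_ xd x0).
rewrite /shift /= [x *: 1]mulr1 addr0 => h.
rewrite distrC; rewrite (_ : _ - _ = x * (l - x^-1 *: (f x - f 0))).
  by rewrite normrM mulrC ler_wpM2r.
by rewrite mulrBr /GRing.scale /= mulrA divff// mul1r mulrC.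
Qed.

(** By the functional equation the increment at [u] is [cexp u] times the increment at 0, which the
    derivatives of [expR], [cos] and [sin] at 0 control. *)
Lemma cexp_diff u : differentiable cexp u.
Proof.
apply: (@eps_diffC _ _ _ _ (cexp u)) => e e0.
pose m := nr (cexp u); have m0 : 0 <= m by exact: nr_ge0.
(* The factor 8 absorbs the four error terms below, of sizes 2, 1, 2 and 2 times [e1 * nr w]. *)
pose e1 := e / (m + 1) / 8.
have e10 : 0 < e1 by rewrite !divr_gt0// ltr_wpDl.
have [d1 d10 h1] := derive_eps (is_derive_expR 0) e10.
have [d2 d20 h2] := derive_eps (is_derive_cos 0) e10.
have [d3 d30 h3] := derive_eps (is_derive_sin 0) e10.
(* The tolerance 1 serves to bound [expR x] by 2 and the modulus of [expR x - 1] by twice that of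
   [x]. *)
have [d4 d40 h4] := derive_eps (is_derive_expR 0) ltr01.
pose d := Num.min (Num.min d1 d2) (Num.min (Num.min d3 d4) (Num.min e1 (1 / 2))).
exists d; first by rewrite /d !lt_min d10 d20 d30 d40 e10 divr_gt0.
move=> z; rewrite /d !lt_min => /andP[/andP[zd1 zd2] /andP[/andP[zd3 zd4] /andP[ze1 z2]]].
set w := z - u in zd1 zd2 zd3 zd4 ze1 z2 *.
have -> : z = u + w by rewrite addrC subrK.
rewrite cexpD (_ : _ - _ - _ = cexp u * (cexp w - 1 - w)); last first.
  by rewrite /GRing.scale /=; ring.
rewrite nrM.
suff key : nr (cexp w - 1 - w) <= 8 * e1 * nr w.
  apply: (@le_trans _ _ (m * (8 * e1 * nr w))); first by rewrite ler_wpM2l.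
  have m1 : 0 < m + 1 by rewrite ltr_wpDl.
  rewrite mulrA ler_wpM2r ?nr_ge0// (_ : 8 * e1 = e / (m + 1)).
    by rewrite mulrA ler_pdivrMr// mulrC ler_wpM2l ?ltW// ltrDl.
  by rewrite /e1; field; exact: lt0r_neq0.
move: zd1 zd2 zd3 zd4 ze1 z2; case: w => x y.
set n := nr _ => zd1 zd2 zd3 zd4 ze1 z2.
have xn : `|x| <= n by exact: (Re_le_nr (x +i* y)%C).
have yn : `|y| <= n by exact: (Im_le_nr (x +i* y)%C).
have n0 : 0 <= n by exact: nr_ge0.
apply: le_trans (nr_ReIm _) _; rewrite /= !subr0.
have := h1 x (le_lt_trans xn zd1); have := h2 y (le_lt_trans yn zd2).
have := h3 y (le_lt_trans yn zd3); have := h4 x (le_lt_trans xn zd4).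
rewrite expR0 cos0 sin0 !mul1r oppr0 mul0r !subr0 addr0.
move=> k4 k3 k2 k1.
have x2 : `|x| <= 1/2 by exact/ltW/(le_lt_trans xn).
have E2 : `|expR x| <= 2.
  rewrite (_ : expR x = (expR x - 1 - x) + 1 + x); last by ring.
  apply: le_trans (ler_normD _ _) _; apply: le_trans (lerD (ler_normD _ _) (lexx _)) _.
  by rewrite normr1; lra.
have E1 : `|expR x - 1| <= 2 * e1.
  rewrite (_ : expR x - 1 = (expR x - 1 - x) + x); last by ring.
  by apply: le_trans (ler_normD _ _) _; move: (ltW ze1); lra.
rewrite (_ : expR x * cos y - 1 - x = expR x * (cos y - 1) + (expR x - 1 - x)); last by ring.
rewrite (_ : expR x * sin y - y = expR x * (sin y - y) + (expR x - 1) * y); last by ring.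
have B1 : `|expR x * (cos y - 1)| <= 2 * (e1 * n).
  rewrite normrM; apply: ler_pM => //; apply: le_trans k2 _.
  by rewrite ler_wpM2l// ltW.
have B2 : `|expR x * (sin y - y)| <= 2 * (e1 * n).
  rewrite normrM; apply: ler_pM => //; apply: le_trans k3 _.
  by rewrite ler_wpM2l// ltW.
have B3 : `|(expR x - 1) * y| <= 2 * e1 * n.
  by rewrite normrM; apply: ler_pM.
have B4 : `|expR x - 1 - x| <= e1 * n.
  by apply: le_trans k1 _; rewrite ler_wpM2l// ltW.
apply: le_trans (lerD (ler_normD _ _) (ler_normD _ _)) _.
apply: le_trans (lerD (lerD B1 B4) (lerD B2 B3)) _.
have : 0 <= e1 * n by exact: mulr_ge0 (ltW e10) n0.
by rewrite -!mulrA; move: (e1 * n) => p; lra.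
Qed.

End ComplexExp.

(** * Isolated singularities in dimension two *)

Section DiscreteGoursat.
Variable R : realType.
Local Notation C := (Cplx R).
Implicit Types (k : C -> C) (z d u : C).
Local Notation ii := (@ii R).

Definition riemann_sum k (N : nat) z d : C := d * \sum_(j < N) k (z + j%:R * d).

(* Riemann sums of the integral of [k] around the square with lower left corner
   [z] and side [N * d], for [d] real. *)
Definition square_sum k (N : nat) z d : C :=
  riemann_sum k N z d + riemann_sum k N (z + N%:R * d) (ii * d)
  - riemann_sum k N (z + N%:R * (ii * d)) d - riemann_sum k N z (ii * d).

Lemma riemann_sumD k N M z d :
  riemann_sum k (N + M) z d = riemann_sum k N z d + riemann_sum k M (z + N%:R * d) d.
Proof.
rewrite /riemann_sum big_split_ord /= mulrDr; congr (_ + _ * _).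
by apply: eq_bigr => j _; rewrite natrD mulrDl addrA.
Qed.

(** Sums along adjacent segments add up exactly, so the interior edges cancel as in the subdivision
    of a contour integral. *)
Lemma square_sum_split k N z d : square_sum k (N + N) z d =
  square_sum k N z d + square_sum k N (z + N%:R * d) d +
  square_sum k N (z + N%:R * (ii * d)) d +
  square_sum k N (z + N%:R * d + N%:R * (ii * d)) d.
Proof.
rewrite /square_sum !riemann_sumD.
rewrite natrD !mulrDl !addrA.
rewrite (addrAC (z + N%:R * (ii * d)) (N%:R * (ii * d)) (N%:R * d)).
rewrite (addrAC z (N%:R * (ii * d)) (N%:R * d)).
rewrite (addrAC (z + N%:R * d) (N%:R * d) (N%:R * (ii * d))).
by ring.
Qed.

Lemma riemann_sum_lin k k' N z d :
  riemann_sum (fun u => k u + k' u) N z d = riemann_sum k N z d + riemann_sum k' N z d.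
Proof. by rewrite /riemann_sum -mulrDr -big_split. Qed.

Lemma square_sum_lin k k' N z d :
  square_sum (fun u => k u + k' u) N z d = square_sum k N z d + square_sum k' N z d.
Proof. by rewrite /square_sum !riemann_sum_lin; ring. Qed.

(** Translating a segment changes the sum of an affine function by an exact multiple of the shift,
    and the two pairs of opposite sides contribute opposite amounts. There is no discretisation
    error. *)
Lemma square_sum_affine (b c : C) N z d : square_sum (fun u => b * u + c) N z d = 0.
Proof.
have shift w v e : riemann_sum (fun u => b * u + c) N (w + v) e =
    riemann_sum (fun u => b * u + c) N w e + e * (N%:R * (b * v)).
  rewrite /riemann_sum -mulrDr; congr (_ * _).
  have -> : N%:R * (b * v) = \sum_(j < N) (b * v) by rewrite sumr_const card_ord mulr_natl.
  by rewrite -big_split /=; apply: eq_bigr => j _; ring.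
by rewrite /square_sum !shift; ring.
Qed.

Lemma riemann_sum_bound k N z d (B : R) :
  (forall j : 'I_N, nr (k (z + j%:R * d)) <= B) ->
  nr (riemann_sum k N z d) <= nr d * (N%:R * B).
Proof.
move=> h; rewrite /riemann_sum nrM ler_wpM2l ?nr_ge0//.
apply: le_trans (nr_sum _ _ _) _.
rewrite (_ : N%:R * B = \sum_(j < N) B); last by rewrite sumr_const card_ord mulr_natl.
by apply: ler_sum => j _; exact: h.
Qed.

Lemma nr_nat n : nr (n%:R : C) = n%:R.
Proof.
have -> : (n%:R : C) = ((n%:R : R)%:C)%C by rewrite rmorph_nat.
by rewrite nr_real normr_nat.
Qed.

Lemma square_sum_bound k N z d (B : R) :
  (forall u, nr (u - z) <= 2 * (N%:R * nr d) -> nr (k u) <= B) ->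
  nr (square_sum k N z d) <= 4 * (nr d * (N%:R * B)).
Proof.
move=> h.
have side w e : nr (w - z) <= N%:R * nr d -> nr e = nr d ->
    nr (riemann_sum k N w e) <= nr d * (N%:R * B).
  move=> wz ed; rewrite -ed; apply: riemann_sum_bound => j; apply: h.
  rewrite addrAC; apply: le_trans (nrD _ _) _; rewrite [leRHS]mulr_natl mulr2n lerD//.
  by rewrite nrM nr_nat ed ler_wpM2r ?nr_ge0// ler_nat ltnW.
have nd : nr (ii * d) = nr d by rewrite nrM nr_ii mul1r.
have Nd : 0 <= N%:R * nr d by rewrite mulr_ge0 ?nr_ge0.
have s0 (e : C) : nr e = nr d -> nr (z + N%:R * e - z) <= N%:R * nr d.
  by move=> ed; rewrite addrC addKr nrM nr_nat ed.
have h1 := side z d; have h2 := side _ (ii * d) (s0 d erefl) nd.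
have h3 := side _ d (s0 _ nd) erefl; have h4 := side z (ii * d).
rewrite subrr nr0 in h1 h4; move/(_ Nd erefl): h1 => h1; move/(_ Nd nd): h4 => h4.
rewrite /square_sum.
apply: le_trans (nrB _ _) _; apply: le_trans (lerD (nrB _ _) (lexx _)) _.
apply: le_trans (lerD (lerD (nrD _ _) (lexx _)) (lexx _)) _.
apply: le_trans (lerD (lerD (lerD h1 h2) h3) h4) _.
by move: (nr d * _) => q; lra.
Qed.

(** With [2 ^ n] sample points per side, level [n.+1] on a square is level [n] on its four
    quarters. *)
Definition square_sums k (p : R * R) (s : R) (n : nat) : C :=
  square_sum k (2 ^ n) (p.1 +i* p.2)%C ((s / (2 ^ n)%:R)%:C)%C.

Lemma square_sumsS k x y s n : square_sums k (x, y) s n.+1 =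
  square_sums k (x, y) (s / 2) n + square_sums k (x + s / 2, y) (s / 2) n +
  square_sums k (x, y + s / 2) (s / 2) n +
  square_sums k (x + s / 2, y + s / 2) (s / 2) n.
Proof.
have p2 : ((2 ^ n)%:R : R) != 0 by rewrite pnatr_eq0 expn_eq0.
rewrite /square_sums /= expnS mul2n -addnn.
have -> : s / ((2 ^ n + 2 ^ n)%N%:R) = s / 2 / (2 ^ n)%:R.
  by rewrite natrD; field; rewrite p2 -mulr2n mulrn_eq0 (negPf p2).
have E : ((2 ^ n)%:R : C) * ((s / 2 / (2 ^ n)%:R)%:C)%C = ((s / 2)%:C)%C.
  have -> : ((2 ^ n)%:R : C) = (((2 ^ n)%:R : R)%:C)%C by rewrite rmorph_nat.
  by rewrite -rmorphM /= mulrC divfK.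
rewrite square_sum_split [_ * (ii * _)]mulrCA E.
have E1 : (x +i* y)%C + ((s / 2)%:C)%C = ((x + s / 2) +i* y)%C :> C.
  by apply/eqP; rewrite eq_complex /= addr0 !eqxx.
have E2 a b : (a +i* b)%C + ii * ((s / 2)%:C)%C = (a +i* (b + s / 2))%C :> C.
  by apply/eqP; rewrite eq_complex /=; apply/andP; split; apply/eqP; ring.
by rewrite E1 !E2.
Qed.

(** Goursat's bisection for Riemann sums. A square that violates a bound proportional to its area
    has a quarter that violates it. Nested bad squares shrink to a point where [k] is affine up to a
    small error, and affine functions have zero sums. *)
Lemma goursat k x y s : 0 < s ->
  (forall u, x <= complex.Re u <= x + s -> y <= complex.Im u <= y + s ->
     differentiable k u) ->
  forall e : R, 0 < e -> exists n0, forall n, (n0 <= n)%N ->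
    nr (square_sums k (x, y) s n) <= e.
Proof.
move=> s0 kd e e0.
pose good (q : R * R) (t : R) := exists n0, forall n, (n0 <= n)%N ->
  nr (square_sums k q t n) <= e / s ^+ 2 * t ^+ 2.
suff [n0 h] : good (x, y) s.
  by exists n0 => n /h; rewrite divfK// expf_neq0// gt_eqF.
apply: contrapT => bad0.
have step (p : R * R * R) : exists q : R * R * R,
    [/\ q.2 = p.2 / 2, q.1.1 = p.1.1 \/ q.1.1 = p.1.1 + p.2 / 2,
        q.1.2 = p.1.2 \/ q.1.2 = p.1.2 + p.2 / 2 & ~ good p.1 p.2 -> ~ good q.1 q.2].
  case: p => [[a b] t] /=.
  have [ha|ha] := pselect (good (a, b) (t / 2)); last first.
    by exists ((a, b), t / 2); split => //; left.
  have [hb|hb] := pselect (good (a + t / 2, b) (t / 2)); last first.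
    by exists ((a + t / 2, b), t / 2); split => //; [right|left].
  have [hc|hc] := pselect (good (a, b + t / 2) (t / 2)); last first.
    by exists ((a, b + t / 2), t / 2); split => //; [left|right].
  (* When three quarters are good, the last one must be bad if the whole square is. *)
  exists ((a + t / 2, b + t / 2), t / 2); split => //; [by right|by right|].
  move=> bad [n4 h4]; apply: bad; case: ha hb hc => [n1 h1] [n2 h2] [n3 h3].
  exists (maxn (maxn n1 n2) (maxn n3 n4)).+1 => -[//|n].
  rewrite ltnS !geq_max => /andP[/andP[l1 l2] /andP[l3 l4]].
  rewrite square_sumsS.
  apply: le_trans (nrD _ _) _; apply: le_trans (lerD (nrD _ _) (lexx _)) _.
  apply: le_trans (lerD (lerD (nrD _ _) (lexx _)) (lexx _)) _.
  apply: le_trans (lerD (lerD (lerD (h1 _ l1) (h2 _ l2)) (h3 _ l3)) (h4 _ l4)) _.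
  by rewrite /= le_eqVlt; apply/orP; left; apply/eqP; field; rewrite gt_eqF.
have [phi phiP] := choice step.
pose Q n := iter n phi ((x, y), s).
have QS n : Q n.+1 = phi (Q n) by [].
have Qs n : (Q n).2 = s / 2 ^+ n.
  elim: n => [|n IH]; first by rewrite expr0 divr1.
  by rewrite QS; have [-> _ _ _] := phiP (Q n); rewrite IH exprSr invfM mulrA.
have Qs0 n : 0 < (Q n).2 by rewrite Qs divr_gt0// exprn_gt0.
have Qbad n : ~ good (Q n).1 (Q n).2.
  elim: n => [//|n IH]; rewrite QS; have [_ _ _] := phiP (Q n); exact.
have nested (f : R * R * R -> R) :
    (forall p, f (phi p) = f p \/ f (phi p) = f p + p.2 / 2) ->
    exists c, forall n, f (Q n) <= c <= f (Q n) + (Q n).2.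
  move=> fP.
  have st n : f (Q n) <= f (Q n.+1) /\ f (Q n.+1) + (Q n.+1).2 <= f (Q n) + (Q n).2.
    rewrite QS; have [-> _ _ _] := phiP (Q n); have := Qs0 n.
    by case: (fP (Q n)) => ->; lra.
  have mono n m : f (Q n) <= f (Q (n + m)%N) /\ f (Q (n + m)%N) + (Q (n + m)%N).2 <= f (Q n) + (Q n).2.
    elim: m => [|m [h1 h2]]; first by rewrite addn0.
    rewrite addnS; have [g1 g2] := st (n + m)%N.
    by split; [exact: le_trans g1|exact: le_trans h2].
  have up n m : f (Q n) <= f (Q m) + (Q m).2.
    have [g1 _] := mono n m; have [_ g2] := mono m n.
    rewrite addnC in g2; have := Qs0 (n + m)%N; lra.
  exists (sup [set f (Q n) | n in setT]) => n; apply/andP; split.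
    apply: ub_le_sup; last by exists n.
    by exists (f (Q 0) + (Q 0).2) => _ [m _ <-]; exact: up.
  apply: ge_sup; first by exists (f (Q 0)), 0%N.
  by move=> _ [m _ <-]; exact: up.
have [cx cxP] := nested (fun p => p.1.1) (fun p => let: And4 _ h _ _ := phiP p in h).
have [cy cyP] := nested (fun p => p.1.2) (fun p => let: And4 _ _ h _ := phiP p in h).
pose c : C := (cx +i* cy)%C.
have kc : differentiable k c by apply: kd; [exact: (cxP 0%N)|exact: (cyP 0%N)].
have [b bP] := diffC_eps kc.
(* [square_sum_bound] will yield [4 * t * (eta * (4 * t))], which is then the area bound
   [e / s ^+ 2 * t ^+ 2]. *)
pose eta := e / s ^+ 2 / 16.
have eta0 : 0 < eta by rewrite !divr_gt0// exprn_gt0.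
have [d d0 dP] := bP _ eta0.
have [n nd] : exists n, 4 * (Q n).2 < d.
  have d4 : 0 < d / 4 / s by rewrite !divr_gt0.
  have [n _ /(_ n (leqnn n)) hn] := near_infty_natSinv_expn_lt (PosNum d4).
  exists n; rewrite Qs; move: hn; rewrite /= div1r => hn.
  by rewrite mulrC -ltr_pdivlMr// mulrC -ltr_pdivlMr.
(* On a square this small the bound holds at every level, so the threshold is 0. *)
apply: (Qbad n); exists 0%N => m _.
move: (cxP n) (cyP n) (Qs0 n) nd.
case: (Q n) => [[a a'] t] /= /andP[ca1 ca2] /andP[cb1 cb2] t0 nd.
set r := fun u => k u - k c - (u - c) * b.
have -> : square_sums k (a, a') t m = square_sums r (a, a') t m.
  rewrite /square_sums (_ : k = fun u => r u + (b * u + (k c - b * c))); last first.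
    by apply/funext => u; rewrite /r; ring.
  by rewrite square_sum_lin square_sum_affine addr0.
have p2 : ((2 ^ m)%:R : R) != 0 by rewrite pnatr_eq0 expn_eq0.
have p20 : 0 < ((2 ^ m)%:R : R) by rewrite ltr0n expn_gt0.
have nd2 : nr ((t / (2 ^ m)%:R)%:C%C : C) = t / (2 ^ m)%:R.
  by rewrite nr_real ger0_norm// divr_ge0 ?ltW.
apply: le_trans (square_sum_bound (B := eta * (4 * t)) _) _.
  move=> u; rewrite nd2 [_%:R * (t / _)]mulrC divfK// => hu.
  have uc : nr (u - c) <= 4 * t.
    apply: le_trans (nr_tri ((a +i* a')%C : C) u c) _.
    have : nr ((a +i* a')%C - c : C) <= 2 * t.
      apply: le_trans (nr_ReIm _) _; rewrite /= distrC [`|a' - _|]distrC !ger0_norm ?subr_ge0//.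
      lra.
    by rewrite /= in hu *; lra.
  apply: le_trans (dP u (le_lt_trans uc nd)) _.
  by rewrite ler_wpM2l// ltW.
by rewrite nd2 /eta le_eqVlt; apply/orP; left; apply/eqP; field; rewrite p2 gt_eqF.
Qed.

End DiscreteGoursat.

(** * Mean values and the maximum principle *)

Section MaximumPrinciple.
Variable R : realType.
Local Notation C := (Cplx R).
Implicit Types (h : C -> C) (a z u : C).
Local Notation ii := (@ii R).

(* The logarithms of these points subdivide the vertical segment from [x] to
   [x + 2 pi i], so the dependence of circular means on the radius is controlled
   by Goursat's lemma for [u |-> h (a + cexp u)] on squares. *)
Definition circle_point (x : R) (n : nat) (j : nat) : C :=
  cexp ((x%:C)%C + j%:R * (ii * ((pi *+ 2 / (2 ^ n)%:R : R)%:C)%C)).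

Definition circle_mean h a (x : R) (n : nat) : C :=
  (2 ^ n)%:R^-1 * \sum_(j < 2 ^ n) h (a + circle_point x n j).

Lemma nr_circle_point x n j : nr (circle_point x n j) = expR x.
Proof.
rewrite /circle_point nr_cexp; congr expR.
have -> : (j%:R : C) = ((j%:R : R)%:C)%C by rewrite rmorph_nat.
by rewrite /=; ring.
Qed.

(** In logarithmic coordinates the square has side 2 pi: by periodicity its horizontal sides cancel,
    and its vertical sides are the circles of radius exp x and exp (x - 2 pi). *)
Lemma circle_mean_step h a x :
  (forall z, 0 < nr (z - a) <= expR x -> differentiable h z) ->
  forall e : R, 0 < e -> exists n0, forall n, (n0 <= n)%N ->
    nr (circle_mean h a x n - circle_mean h a (x - pi *+ 2) n) <= e.
Proof.
move=> hd e e0.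
set s : R := pi *+ 2; have s0 : 0 < s by rewrite mulrn_wgt0// pi_gt0.
pose k u := h (a + cexp u).
have kd u : x - s <= complex.Re u <= x - s + s -> 0 <= complex.Im u <= 0 + s ->
    differentiable k u.
  rewrite subrK => /andP[_ ux] _.
  have dE : differentiable (cst a + @cexp R) u.
    by apply: differentiableD => //; exact: cexp_diff.
  apply: (differentiable_comp dE); apply: hd.
  have -> : (cst a + @cexp R) u - a = cexp u.
    by transitivity (a + cexp u - a); [|rewrite addrC addKr].
  by rewrite nr_cexp expR_gt0 ler_expR.
have es : 0 < e * s by rewrite mulr_gt0.
have [n0 n0P] := goursat s0 kd es.
exists n0 => n /n0P.
have p2 : ((2 ^ n)%:R : R) != 0 by rewrite pnatr_eq0 expn_eq0.
have p2C : ((2 ^ n)%:R : C) != 0 by rewrite pnatr_eq0 expn_eq0.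
rewrite /square_sums /square_sum /=; set d := ((s / _)%:C)%C; set z := (_ +i* 0)%C.
have Nd : ((2 ^ n)%:R : C) * d = (s%:C)%C.
  have -> : ((2 ^ n)%:R : C) = (((2 ^ n)%:R : R)%:C)%C by rewrite rmorph_nat.
  by rewrite /d -rmorphM /= mulrC divfK.
have -> : riemann_sum k (2 ^ n) (z + (2 ^ n)%:R * (ii * d)) d = riemann_sum k (2 ^ n) z d.
  rewrite mulrCA Nd /riemann_sum; congr (_ * _); apply: eq_bigr => j _.
  by rewrite addrAC /k cexp_period.
have dC : d = (s%:C)%C * (2 ^ n)%:R^-1 by rewrite -Nd mulrAC divff// mul1r.
have zs : z + (s%:C)%C = (x%:C)%C.
  by apply/eqP; rewrite eq_complex /= subrK addr0 !eqxx.
have sumE w y : w = (y%:C)%C ->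
    riemann_sum k (2 ^ n) w (ii * d) = ii * (s%:C)%C * circle_mean h a y n.
  move=> ->; rewrite /riemann_sum /circle_mean -/s.
  rewrite (eq_bigr (fun j : 'I_(2 ^ n) => h (a + circle_point y n j)))//.
  by rewrite dC; ring.
rewrite Nd zs (sumE _ x)// (sumE z (x - s))//.
rewrite addrAC addrC addrA addKr.
rewrite -mulrBr.
by rewrite !nrM nr_ii mul1r nr_real gtr0_norm// mulrC ler_pM2r.
Qed.

(** Shrinking the circle finitely often by the factor exp (-2 pi) brings it so close to [a] that
    continuity at [a] finishes the estimate. *)
Lemma mean_value h a x : {for a, continuous h} ->
  (forall z, 0 < nr (z - a) <= expR x -> differentiable h z) ->
  forall e : R, 0 < e -> exists n, nr (circle_mean h a x n - h a) <= e.
Proof.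
move=> /cont_nrP hc hd e e0.
have pi2 : 0 < pi *+ 2 :> R by rewrite mulrn_wgt0// pi_gt0.
have steps m e1 : 0 < e1 -> exists n0, forall n, (n0 <= n)%N ->
    nr (circle_mean h a x n - circle_mean h a (x - m%:R * (pi *+ 2)) n) <= e1.
  elim: m e1 => [|m IH] e1 e10.
    by exists 0%N => n _; rewrite mul0r subr0 subrr nr0 ltW.
  have e12 : 0 < e1 / 2 by rewrite divr_gt0.
  have [n1 h1] := IH _ e12.
  have [|n2 h2] := @circle_mean_step h a (x - m%:R * (pi *+ 2)) _ _ e12.
    move=> z /andP[z0 zx]; apply: hd; rewrite z0 (le_trans zx)// ler_expR.
    by rewrite gerBl mulr_ge0// ltW.
  exists (maxn n1 n2) => n; rewrite geq_max => /andP[/h1 l1 /h2 l2].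
  rewrite (_ : x - m.+1%:R * (pi *+ 2) = x - m%:R * (pi *+ 2) - pi *+ 2); last first.
    by rewrite -natr1; ring.
  by apply: le_trans (nr_tri _ _ _) _; rewrite (splitr e1); apply: lerD; [exact: l1|exact: l2].
have e2 : 0 < e / 2 by rewrite divr_gt0.
have [d d0 dP] := hc _ e2.
(* Since exp (2 pi m) >= 1 + 2 pi m >= m + 1, it suffices that 1 / (m + 1) is below d / exp x. *)
have [m md] : exists m, expR (x - m%:R * (pi *+ 2)) < d.
  have [m _ /(_ m (leqnn m)) /= hm] := near_infty_natSinv_lt (PosNum (divr_gt0 d0 (expR_gt0 x))).
  exists m; rewrite expRD -ltr_pdivlMl ?expR_gt0// [ltRHS]mulrC.
  apply: le_lt_trans hm; rewrite expRN lef_pV2 ?posrE ?expR_gt0//.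
  apply: le_trans (expR_ge1Dx _); rewrite -natr1 addrC lerD2l ler_peMr//.
  by have := @pi_ge2 R; rewrite mulr2n; lra.
have [n h1] := steps m _ e2; exists n.
apply: le_trans (nr_tri _ _ _) _; rewrite (splitr e); apply: lerD; first exact: h1.
set y := x - _ in md *.
have p20 : 0 < ((2 ^ n)%:R : R) by rewrite ltr0n expn_gt0.
have p2C : ((2 ^ n)%:R : C) != 0 by rewrite pnatr_eq0 expn_eq0.
have -> : circle_mean h a y n - h a =
    (2 ^ n)%:R^-1 * \sum_(j < 2 ^ n) (h (a + circle_point y n j) - h a).
  by rewrite sumrB sumr_const card_ord mulrBr -(mulr_natl (h a)) mulKf.
rewrite nrM nrV nr_nat ler_pdivrMl//.
apply: le_trans (nr_sum _ _ _) _.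
rewrite (_ : _ * (e / 2) = \sum_(j < 2 ^ n) (e / 2)); last by rewrite sumr_const card_ord mulr_natl.
apply: ler_sum => j _; rewrite nrBC ltW//; apply: dP.
by rewrite opprD addrA subrr sub0r nrN nr_circle_point.
Qed.

Lemma nr_sqrB (v w : C) :
  nr w ^+ 2 = nr v ^+ 2 + 2 * complex.Re (Num.conj v * (w - v)) + nr (w - v) ^+ 2.
Proof. by rewrite !nr_sqr; case: v w => [a b] [c d] /=; ring. Qed.

Lemma punctured_disc (E : seq C) a (r : R) : 0 < r ->
  exists2 t : R, 0 < t <= r & forall z, 0 < nr (z - a) <= t -> z \notin E.
Proof.
elim: E => [|b E IH] r0; first by exists r; rewrite ?r0 /=.
have [t /andP[t0 tr] tP] := IH r0.
have [ba|ba] := eqVneq b a.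
  exists t; rewrite ?t0// => z /[dup] /tP zE /andP[za _].
  by rewrite inE negb_or zE andbT; apply: contraTneq za => ->; rewrite ba subrr nr0 ltxx.
have nb : 0 < nr (b - a) / 2 by rewrite divr_gt0// nr_gt0 subr_eq0.
exists (Num.min t (nr (b - a) / 2)); first by rewrite lt_min t0 nb ge_min tr.
move=> z; rewrite le_min => /andP[za /andP[zt zb]].
rewrite inE negb_or tP ?za// andbT; apply: contraTneq zb => ->.
by rewrite -ltNge ltr_pdivrMr// mulr_natr mulr2n ltrDl nr_gt0 subr_eq0.
Qed.

(** If the bound failed, [phi] below would have an interior maximum [a]. There the increment of
    [phi] is twice the real part of the increment of [H], plus nonnegative terms including
    [eta * t ^+ 2]. Maximality thus keeps the real part of the circular means of [H] below that of
    [H a] by at least [eta * t ^+ 2 / 2], against the mean value property. *)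
Lemma maximum_principle h (E : seq C) (r M : R) : continuous h ->
  (forall z, z \notin E -> differentiable h z) ->
  (forall z, nr z = r -> nr (h z) <= M) ->
  forall z, nr z <= r -> nr (h z) <= M.
Proof.
move=> hc hd hM z1 z1r; rewrite leNgt; apply/negP => Mz1.
have r0 : 0 <= r by exact: le_trans (nr_ge0 _) z1r.
have [z1E|z1E] := eqVneq (nr z1) r; first by have := hM _ z1E; rewrite leNgt Mz1.
have rr : 0 < r.
  by apply: le_lt_trans (nr_ge0 z1) _; rewrite lt_neqAle z1E.
have M0 : 0 <= M.
  have : nr ((r%:C)%C : C) = r by rewrite nr_real ger0_norm.
  by move/hM; apply: le_trans; exact: nr_ge0.
(* On the circle of radius [r] the added term is half of [nr (h z1) ^+ 2 - M ^+ 2], too little for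
   the maximum to lie there. *)
pose eta := (nr (h z1) ^+ 2 - M ^+ 2) / (2 * r ^+ 2).
have gap : 0 < nr (h z1) ^+ 2 - M ^+ 2.
  by rewrite subr_gt0 ltr_pXn2r// nnegrE ?nr_ge0.
have eta0 : 0 < eta by rewrite divr_gt0// mulr_gt0// exprn_gt0.
pose phi z : R := nr (h z) ^+ 2 + eta * nr z ^+ 2.
have phic : continuous phi.
  have nc : continuous (fun z => nr (h z)).
    by move=> z; apply: (@continuous_comp _ _ _ h (@nr R C)); [exact: hc|exact: nr_continuous].
  move=> z; apply: (@continuousD _ _ _ (fun z => nr (h z) ^+ 2) (fun z => eta * nr z ^+ 2)).
    by apply: (@continuousM _ _ (fun z => nr (h z)) (fun z => nr (h z))); exact: nc.
  apply: (@continuousM _ _ (fun=> eta) (fun z : C => nr z ^+ 2)); first exact: cst_continuous.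
  by apply: (@continuousM _ _ (fun z : C => nr z) (fun z : C => nr z)); exact: nr_continuous.
have [a /set_mem /= ar amax] : exists2 c : C, c \in [set z : C | nr z <= r] &
    forall t, t \in [set z : C | nr z <= r] -> phi t <= phi c.
  apply: compact_EVT_max; [by exists z1|exact: compact_disc|exact: continuous_subspaceT].
have {}ar : nr a < r.
  rewrite lt_neqAle ar andbT; apply/eqP => aE.
  have : phi z1 <= phi a by apply: amax; rewrite inE.
  rewrite /phi aE leNgt => /negP; apply.
  have h1 : nr (h a) ^+ 2 <= M ^+ 2 by rewrite lerXn2r ?nnegrE ?nr_ge0// hM.
  have h2 : 0 <= eta * nr z1 ^+ 2 by rewrite mulr_ge0 ?exprn_ge0 ?nr_ge0// ltW.
  have h3 : eta * r ^+ 2 = (nr (h z1) ^+ 2 - M ^+ 2) / 2.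
    by rewrite /eta; field; rewrite gt_eqF.
  move: gap h2; rewrite h3; lra.
have ra : 0 < r - nr a by rewrite subr_gt0.
have [t /andP[t0 tr] tE] := punctured_disc E a ra.
pose H z := Num.conj (h a) * h z + (eta%:C)%C * Num.conj a * z.
have Hc : {for a, continuous H}.
  apply: (@continuousD _ _ _ (fun z => Num.conj (h a) * h z) (fun z => (eta%:C)%C * Num.conj a * z)).
    by apply: (@continuousM _ _ (fun=> Num.conj (h a)) h); [exact: cst_continuous|exact: hc].
  by apply: (@continuousM _ _ (fun=> (eta%:C)%C * Num.conj a) id); [exact: cst_continuous|exact: id].
have et : expR (ln t) = t by rewrite lnK ?posrE.
have Hd z : 0 < nr (z - a) <= expR (ln t) -> differentiable H z.
  rewrite et => zt; have hz := hd _ (tE _ zt).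
  apply: (@differentiableD _ _ _ (fun z => Num.conj (h a) * h z) (fun z => (eta%:C)%C * Num.conj a * z)).
    by apply: (@differentiableM _ _ (fun=> Num.conj (h a)) h).
  by apply: (@differentiableM _ _ (fun=> (eta%:C)%C * Num.conj a) id).
have e0 : 0 < eta * t ^+ 2 / 4 by rewrite divr_gt0// mulr_gt0// exprn_gt0.
have [n] := mean_value Hc Hd e0.
have p20 : 0 < ((2 ^ n)%:R : R) by rewrite ltr0n expn_gt0.
have p2C : ((2 ^ n)%:R : C) != 0 by rewrite pnatr_eq0 expn_eq0.
have -> : circle_mean H a (ln t) n - H a =
    (2 ^ n)%:R^-1 * \sum_(j < 2 ^ n) (H (a + circle_point (ln t) n j) - H a).
  by rewrite sumrB sumr_const card_ord mulrBr -(mulr_natl (H a)) mulKf.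
rewrite nrM nrV nr_nat ler_pdivrMl// leNgt => /negP; apply.
apply: lt_le_trans (Re_le_nr _); rewrite raddf_sum /= -normrN.
apply: lt_le_trans (ler_norm _); rewrite -sumrN.
apply: (@lt_le_trans _ _ (\sum_(j < 2 ^ n) (eta * t ^+ 2 / 2))).
  rewrite sumr_const card_ord -[ltRHS]mulr_natl ltr_pM2l//.
  by move: e0; lra.
apply: ler_sum => j _; set w := circle_point _ _ _.
have wt : nr w = t by rewrite nr_circle_point et.
have : phi (a + w) <= phi a.
  apply: amax; rewrite inE /=; apply: le_trans (nrD _ _) _.
  by rewrite wt addrC -lerBrDr.
rewrite /phi (nr_sqrB (h a) (h (a + w))) (nr_sqrB a (a + w)) [a + w - a]addrC addKr wt.
have : 0 <= nr (h (a + w) - h a) ^+ 2 by rewrite exprn_ge0// nr_ge0.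
rewrite /H; set A := complex.Re (_ * _); set B := complex.Re (_ * w).
have -> : - complex.Re (Num.conj (h a) * h (a + w) + (eta%:C)%C * Num.conj a * (a + w) -
     (Num.conj (h a) * h a + (eta%:C)%C * Num.conj a * a)) = - A - eta * B.
  rewrite /A /B; move: (Num.conj (h a)) (h a) (h (a + w)) (Num.conj a) => [? ?] [? ?] [? ?] [? ?].
  by move: (a) w {wt A B} => [? ?] [? ?] /=; ring.
set N := nr _ ^+ 2; lra.
Qed.

End MaximumPrinciple.

(** * Cauchy estimates through difference quotients *)

Section CauchyEstimates.
Variable R : realType.
Local Notation C := (Cplx R).
Implicit Types (h q : C -> C) (a b z : C).

Lemma near_neq (V : normedModType C) (x y : V) : x != y -> \forall z \near x, z != y.
Proof.
move=> xy; apply/nbhs_nrP; exists (nr (x - y)); first by rewrite nr_gt0 subr_eq0.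
by move=> z; apply: contraTneq => ->; rewrite ltxx.
Qed.

(** Filling in the difference quotient at [b] costs one more exceptional point, which the maximum
    principle tolerates. *)
Lemma slope_fun h (E : seq C) b : continuous h -> b \notin E ->
  (forall z, z \notin E -> differentiable h z) ->
  exists q, [/\ continuous q, forall z, z \notin b :: E -> differentiable q z &
    forall z, h z - h b = (z - b) * q z].
Proof.
move=> hc bE hd; have [l lP] := diffC_eps (hd _ bE).
pose q z := if z == b then l else (h z - h b) * (z - b)^-1.
have qd z : z != b -> differentiable (fun z => (h z - h b) * (z - b)^-1) z <-> differentiable q z.
  move=> zb; have near_b := near_neq zb.
  by split; apply: near_diff; apply: filterS near_b => x xb; rewrite /q (negPf xb).
exists q; split.
- move=> z; have [->|zb] := eqVneq z b.
    apply/cont_nrP => e e0; have e2 : 0 < e / 2 by rewrite divr_gt0.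
    have [d d0 dP] := lP _ e2; exists d => // y; rewrite nrBC => yd.
    have [->|yb] := eqVneq y b; first by rewrite subrr nr0.
    rewrite /q eqxx (negPf yb) nrBC.
    have n0 : 0 < nr (y - b) by rewrite nr_gt0 subr_eq0.
    rewrite -(ltr_pM2l n0) -nrM mulrBr mulrCA divff ?subr_eq0// mulr1.
    apply: le_lt_trans (dP _ yd) _; rewrite mulrC ltr_pM2l//.
    by rewrite ltr_pdivrMr// mulr_natr mulr2n ltrDl.
  have cb : {for z, continuous (fun z => (h z - h b) * (z - b)^-1)}.
    apply: (@continuousM _ _ (fun z => h z - h b) (fun z => (z - b)^-1)).
      by apply: (@continuousB _ _ _ h (fun=> h b)); [exact: hc|exact: cst_continuous].
    apply: (@continuousV _ _ (fun z => z - b)); first by rewrite subr_eq0.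
    by apply: (@continuousB _ _ _ id (fun=> b)); [exact: id|exact: cst_continuous].
  have near_b := near_neq zb.
  move=> A; rewrite {1}/q (negPf zb) => /cb hA.
  by apply: filterS2 near_b hA => x xb; rewrite /= /q (negPf xb).
- move=> z; rewrite inE negb_or => /andP[zb zE]; apply/(qd _ zb).
  apply: (@differentiableM _ _ (fun z => h z - h b) (fun z => (z - b)^-1)).
    by apply: (@differentiableB _ _ _ h (fun=> h b)); [exact: hd|].
  apply: (@differentiableV _ _ (fun z => z - b)); last by rewrite subr_eq0.
  by apply: (@differentiableB _ _ _ id (fun=> b)).
- move=> z; rewrite /q; case: eqVneq => [->|zb]; first by rewrite !subrr mul0r.
  by rewrite mulrCA divff ?mulr1 ?subr_eq0.
Qed.

(** On the circle [nr z = r] the denominator is at least [r / 2] and the numerator at most [2 * M];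
    the maximum principle carries the bound inside. *)
Lemma slope_bound h (E : seq C) (r M : R) b q : 0 < r ->
  (forall z, nr z = r -> nr (h z) <= M) -> nr (h b) <= M -> nr b <= r / 2 ->
  continuous q -> (forall z, z \notin E -> differentiable q z) ->
  (forall z, h z - h b = (z - b) * q z) ->
  forall z, nr z <= r -> nr (q z) <= 4 * M / r.
Proof.
move=> r0 hM hb br qc qd hq; apply: (maximum_principle qc qd) => z zr.
have zb : r / 2 <= nr (z - b).
  by apply: le_trans (nr_sub _ _); rewrite zr; lra.
have r2 : 0 < r / 2 by rewrite divr_gt0.
have n0 : 0 < nr (z - b) by exact: lt_le_trans zb.
have q0 := nr_ge0 (q z).
rewrite ler_pdivlMr//.
have : nr (z - b) * nr (q z) <= M + M.
  by rewrite -nrM -hq (le_trans (nrB _ _))// lerD// hM.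
have : r / 2 * nr (q z) <= nr (z - b) * nr (q z) by rewrite ler_wpM2r.
by move: (nr (z - b) * _) => p; nra.
Qed.

(** The slope based at [b] needs a derivative there; when [b] is the exceptional point [c], the
    roles of [a] and [b] are exchanged. *)
Lemma cauchy_lipschitz h (c : C) (r M : R) : 0 < r -> continuous h ->
  (forall z, z != c -> differentiable h z) ->
  (forall z, nr z = r -> nr (h z) <= M) ->
  forall a b, nr a <= r / 2 -> nr b <= r / 2 -> nr (h a - h b) <= 4 * M / r * nr (a - b).
Proof.
move=> r0 hc hd hM.
have hdE z : z \notin [:: c] -> differentiable h z by rewrite inE; exact: hd.
have hM' := maximum_principle hc hdE hM.
have key a b : nr a <= r / 2 -> nr b <= r / 2 -> b != c ->
    nr (h a - h b) <= 4 * M / r * nr (a - b).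
  move=> ar br bc; have bE : b \notin [:: c] by rewrite inE.
  have [q [qc qd qP]] := slope_fun hc bE hdE.
  rewrite qP nrM mulrC ler_wpM2r ?nr_ge0//.
  apply: (slope_bound r0 hM (hM' b _) br qc qd qP); lra.
move=> a b ar br; have [bc|/key] := eqVneq b c; last exact.
have [ac|/key h1] := eqVneq a c; last by rewrite nrBC [nr (a - b)]nrBC h1.
by rewrite bc ac !subrr !nr0 mulr0.
Qed.

(** The slope based at [c] is continuous, differentiable off one point and bounded by [4 * M / r],
    so [cauchy_lipschitz] applies to it. *)
Lemma cauchy_lipschitz2 h (r M : R) : 0 < r ->
  (forall z, differentiable h z) ->
  (forall z, nr z = r -> nr (h z) <= M) ->
  forall c a b, nr a <= r / 2 -> nr b <= r / 2 -> nr c <= r / 2 -> a != c -> b != c ->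
  nr ((h a - h c) / (a - c) - (h b - h c) / (b - c)) <= 16 * M / r ^+ 2 * nr (a - b).
Proof.
move=> r0 hd hM c a b ar br cr ac bc.
have hc : continuous h by move=> z; exact: differentiable_continuous.
have hdE z : z \notin [::] -> differentiable h z by move=> _; exact: hd.
have hM' := maximum_principle hc hdE hM.
have [q [qc qd qP]] := slope_fun hc (isT : c \notin [::]) hdE.
rewrite !qP ![(_ - c) * _]mulrC !mulfK ?subr_eq0//.
have -> : 16 * M / r ^+ 2 = 4 * (4 * M / r) / r by field; rewrite gt_eqF.
have qd' z : z != c -> differentiable q z by move=> zc; apply: qd; rewrite inE.
have qb z : nr z = r -> nr (q z) <= 4 * M / r.
  by move=> zr; apply: (slope_bound r0 hM (hM' c _) cr qc qd qP); rewrite ?zr//; lra.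
exact: (cauchy_lipschitz r0 qc qd' qb).
Qed.

(** [l] is a cluster value of [phi] at 0, provided by compactness of discs; the Lipschitz bound
    gives the rate. *)
Lemma lipschitz_limit (phi : C -> C) (r K : R) : 0 < r -> 0 <= K ->
  (forall s t, s != 0 -> t != 0 -> nr s <= r -> nr t <= r ->
     nr (phi s - phi t) <= K * nr (s - t)) ->
  exists l, forall t, t != 0 -> nr t <= r -> nr (phi t - l) <= K * nr t.
Proof.
move=> r0 K0 hphi.
have near0 (e : R) : 0 < e -> \forall t \near (0 : C)^', t != 0 /\ nr t < e.
  move=> e0; rewrite near_withinE; apply/nbhs_nrP; exists e => // t.
  by rewrite sub0r nrN => te t0.
pose t1 : C := (r%:C)%C.
have t1r : nr t1 = r by rewrite nr_real gtr0_norm.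
have t10 : t1 != 0 by rewrite -nr_gt0 t1r.
have PF : ProperFilter ((0 : C)^') by exact: Proper_dnbhs_numFieldType.
have [|l [_ lP]] := @compact_disc R (nr (phi t1) + K * (r + r)) (phi @ (0 : C)^') _.
  rewrite !nbhs_simpl /=; apply: filterS (near0 _ r0) => t [t0 tr] /=.
  rewrite -[phi t](subrK (phi t1)) addrC (le_trans (nrD _ _))// lerD2l.
  apply: le_trans (hphi _ _ t0 t10 (ltW tr) _) _; first by rewrite t1r.
  by rewrite ler_wpM2l// (le_trans (nrB _ _))// t1r lerD2r ltW.
exists l => t t0 tr; apply/ler_addgt0Pr => e e0.
have e2 : 0 < e / (2 * (K + 1)) by rewrite divr_gt0// mulr_gt0// ltr_wpDl.
have re : 0 < Num.min r (e / (2 * (K + 1))) by rewrite lt_min r0.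
have lb : nbhs l [set z | nr (l - z) < e / 2].
  by apply/nbhs_nrP; exists (e / 2) => //; rewrite divr_gt0.
have /(lP _ _ ) : (phi @ (0 : C)^') (phi @` [set s | s != 0 /\ nr s < Num.min r (e / (2 * (K + 1)))]).
  by rewrite !nbhs_simpl /=; apply: filterS (near0 _ re) => s hs; exists s.
move=> /(_ _ lb) [_ [[s [s0]] + <-] /=]; rewrite lt_min => /andP[sr se] sl.
apply: le_trans (nr_tri (phi s) _ _) _.
have h1 := hphi _ _ t0 s0 tr (ltW sr).
have h2 : K * nr (t - s) <= K * nr t + K * nr s by rewrite -mulrDr ler_wpM2l// nrB.
have h3 : K * nr s <= e / 2.
  apply: (@le_trans _ _ ((K + 1) * (e / (2 * (K + 1))))).
    by apply: ler_pM; rewrite ?nr_ge0// ?lerDl// ltW.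
  by rewrite le_eqVlt; apply/orP; left; apply/eqP; field; rewrite gt_eqF// ltr_wpDl.
rewrite nrBC in sl; lra.
Qed.

End CauchyEstimates.

(** * Functions of two variables at an isolated singularity *)

Section IsolatedSingularity.
Variable R : realType.
Local Notation C := (Cplx R).
Implicit Types (f : C -> C -> C) (z w : C) (x y : C2 R).

Definition uncurry2 f x : C := f (fst2 x) (snd2 x).

(** Continuity and separate holomorphy, since all estimates take place on lines parallel to the
    axes. *)
Definition hol_off0 f := forall x, x != 0 ->
  [/\ {for x, continuous (uncurry2 f)}, differentiable (f^~ (snd2 x)) (fst2 x) &
      differentiable (f (fst2 x)) (snd2 x)].

Lemma hol_off0C f : hol_off0 f -> hol_off0 (fun z w => f w z).
Proof.
move=> hf x x0; have x0' : c2 (snd2 x) (fst2 x) != 0.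
  by rewrite c2_eq0 andbC -c2_eq0 c2_eta.
have [hc h1 h2] := hf _ x0'; rewrite !fst2K !snd2K in h1 h2; split; [|exact: h2|exact: h1].
move/cont_nrP in hc; apply/cont_nrP => e /hc[d d0 dP]; exists d => // y xy.
have := dP (c2 (snd2 y) (fst2 y)); rewrite /uncurry2 !fst2K !snd2K; apply.
apply: nr2_lt; rewrite ?fst2B ?snd2B !(fst2K, snd2K) -?fst2B -?snd2B.
  exact: le_lt_trans (nr_snd2 _) xy.
exact: le_lt_trans (nr_fst2 _) xy.
Qed.

Lemma hol_off0_line f w : w != 0 -> hol_off0 f -> forall z, differentiable (f^~ w) z.
Proof.
move=> w0 hf z; have h : c2 z w != 0 by rewrite c2_eq0 negb_and w0 orbT.
by have [_ +] := hf _ h; rewrite fst2K snd2K.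
Qed.

(* The circle [nr z = r] in the line through [w] misses the origin for every [w],
   including [w] near 0. *)
Lemma tube_bound f (r : R) : 0 < r -> hol_off0 f ->
  exists M, forall z w, w != 0 -> nr z <= r -> nr w <= r -> nr (f z w) <= M.
Proof.
move=> r0 hf; pose K := [set x : C2 R | nr (fst2 x) = r /\ nr (snd2 x) <= r].
have K0 x : K x -> x != 0.
  move=> [xr _]; apply: contra_eq_neq xr => ->.
  by rewrite /fst2 mxE nr0 lt_eqF.
have cK : compact K.
  apply: (@subclosed_compact _ _ [set x : C2 R | nr x <= r]); last first.
  - by move=> x [h1 h2]; apply: nr2_le => //; rewrite h1.
  - exact: compact_ball2.
  apply: closedI.
    apply: (@closed_comp _ _ (fun x => nr (fst2 x)) [set y | y = r]); last exact: closed_eq.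
    by move=> x _; apply: continuous_comp; [exact: fst2_continuous|exact: nr_continuous].
  apply: (@closed_comp _ _ (fun x => nr (snd2 x)) [set y | y <= r]); last exact: closed_le.
  by move=> x _; apply: continuous_comp; [exact: snd2_continuous|exact: nr_continuous].
have rn : nr ((r%:C)%C : C) = r by rewrite nr_real gtr0_norm.
have [||m _ mP] := @compact_EVT_max _ _ (fun x => nr (uncurry2 f x)) K _ cK.
- by exists (c2 (r%:C)%C 0); split; rewrite ?fst2K ?snd2K ?nr0 ?ltW.
- move=> x; apply: continuous_in_subspaceT => {}x /set_mem /K0 x0.
  have [hc _ _] := hf _ x0.
  by apply: (@continuous_comp _ _ _ (uncurry2 f) (@nr R C)); [exact: hc|exact: nr_continuous].
exists (nr (uncurry2 f m)) => z w w0 zr wr.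
have hd := hol_off0_line w0 hf.
have hc : continuous (f^~ w) by move=> u; exact: differentiable_continuous.
apply: (maximum_principle (E := [::]) hc _ _ zr) => [u _|u ur]; first exact: hd.
have := mP (c2 u w); rewrite /uncurry2 fst2K snd2K; apply.
by rewrite inE; split; rewrite ?fst2K ?snd2K.
Qed.

(** A point other than the origin has a nonzero coordinate, so it lies on a line of one of the two
    families that misses the origin. *)
Lemma polydisc_bound f (r : R) : 0 < r -> hol_off0 f ->
  exists2 M, 0 <= M & forall z w, c2 z w != 0 -> nr z <= r -> nr w <= r -> nr (f z w) <= M.
Proof.
move=> r0 hf; have [M1 h1] := tube_bound r0 hf; have [M2 h2] := tube_bound r0 (hol_off0C hf).
exists (Num.max 0 (Num.max M1 M2)); first by rewrite le_max lexx.
move=> z w; rewrite c2_eq0 negb_and => /orP[z0|w0] zr wr; rewrite !le_max.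
  by rewrite (h2 w z z0 wr zr) !orbT.
by rewrite (h1 z w w0 zr wr) orbT.
Qed.

(** A Hartogs phenomenon: on axis-parallel lines missing the origin [f] is Lipschitz with a constant
    that does not depend on the line. The limit is taken on the diagonal, to which every nearby
    point is joined by two such segments. *)
Lemma extension0 f : hol_off0 f -> exists l, forall e : R, 0 < e ->
  exists2 d : R, 0 < d & forall x, x != 0 -> nr x < d -> nr (uncurry2 f x - l) <= e.
Proof.
move=> hf; have [M M0 hM] := polydisc_bound ltr01 hf.
have lip1 g : hol_off0 g -> (forall z w, c2 z w != 0 -> nr z <= 1 -> nr w <= 1 -> nr (g z w) <= M) ->
    forall w a b, w != 0 -> nr w <= 1 -> nr a <= 1 / 2 -> nr b <= 1 / 2 ->
    nr (g a w - g b w) <= 4 * M * nr (a - b).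
  move=> hg gM w a b w0 w1 a1 b1; have hd := hol_off0_line w0 hg.
  have hc : continuous (g^~ w) by move=> u; exact: differentiable_continuous.
  have hb u : nr u = 1 -> nr (g u w) <= M.
    by move=> u1; apply: gM; rewrite ?u1// c2_eq0 negb_and w0 orbT.
  have hd' u : u != 0 -> differentiable (g^~ w) u by move=> _; exact: hd.
  by have := cauchy_lipschitz ltr01 hc hd' hb a1 b1; rewrite divr1.
have hM' z w : c2 z w != 0 -> nr z <= 1 -> nr w <= 1 -> nr (f w z) <= M.
  by move=> zw z1 w1; apply: hM => //; rewrite c2_eq0 andbC -c2_eq0.
have lipG z w z' w' : nr z <= 1 / 2 -> nr w <= 1 / 2 -> nr z' <= 1 / 2 -> nr w' <= 1 / 2 ->
    w != 0 -> z' != 0 -> nr (f z w - f z' w') <= 4 * M * (nr (z - z') + nr (w - w')).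
  move=> z2 w2 z2' w2' w0 z0'; apply: le_trans (nr_tri (f z' w) _ _) _.
  rewrite mulrDr lerD//; first by apply: lip1 => //; lra.
  by apply: (lip1 _ (hol_off0C hf) hM') => //; lra.
have h2 : 0 < 1 / 2 :> R by lra.
have K0 : 0 <= 8 * M by lra.
have [|l lP] := @lipschitz_limit R (fun t => f t t) (1 / 2) (8 * M) h2 K0.
  move=> s t s0 t0 s1 t1; apply: le_trans (lipG _ _ _ _ s1 s1 t1 t1 s0 t0) _.
  by rewrite le_eqVlt; apply/orP; left; apply/eqP; ring.
exists l => e e0.
(* Passing from [x] to the diagonal point with coordinates [nr x] costs [16 * M * nr x], and from
   there to the limit [8 * M * nr x]. *)
pose d := Num.min (1 / 2) (e / (24 * M + 1)).
have d0 : 0 < d by rewrite lt_min h2 divr_gt0// ltr_wpDl// mulr_ge0.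
exists d => // x x0 xd; set t : C := ((nr x)%:C)%C.
have nt : nr t = nr x by rewrite nr_real ger0_norm// nr_ge0.
have t0 : t != 0 by rewrite -nr_gt0 nt nr_gt0.
have x2 : nr x <= 1 / 2 by move: xd; rewrite lt_min => /andP[/ltW].
have z2 := le_trans (nr_fst2 x) x2; have w2 := le_trans (nr_snd2 x) x2.
have t2 : nr t <= 1 / 2 by rewrite nt.
apply: le_trans (nr_tri (f t t) _ _) _.
have h1 : nr (uncurry2 f x - f t t) <= 16 * M * nr x.
  have hz : nr (fst2 x - t) <= nr x + nr x.
    by rewrite (le_trans (nrB _ _))// nt lerD// nr_fst2.
  have hw : nr (snd2 x - t) <= nr x + nr x.
    by rewrite (le_trans (nrB _ _))// nt lerD// nr_snd2.
  have b16 : 4 * M * (nr (fst2 x - t) + nr (snd2 x - t)) <= 16 * M * nr x.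
    rewrite (_ : 16 * M * nr x = 4 * M * (nr x + nr x + (nr x + nr x))); last by ring.
    by rewrite ler_wpM2l ?lerD// mulr_ge0.
  apply: le_trans b16; rewrite /uncurry2.
  (* Both legs must lie on lines missing the origin; when it is [fst2 x] that is nonzero, the path
     is run from the diagonal to [x]. *)
  have : c2 (fst2 x) (snd2 x) != 0 by rewrite c2_eta.
  rewrite c2_eq0 negb_and => /orP[z0|w0]; last exact: lipG.
  by rewrite nrBC [nr (fst2 x - t)]nrBC [nr (snd2 x - t)]nrBC; exact: lipG.
have := lP t t0 t2; rewrite nt => h3.
have h4 : (24 * M + 1) * nr x <= e.
  rewrite mulrC -ler_pdivlMr ?ltr_wpDl ?mulr_ge0//.
  by move: xd; rewrite lt_min => /andP[_ /ltW].
apply: le_trans (lerD h1 h3) _; have := nr_ge0 x; lra.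
Qed.

Definition partial_slope f z z' w : C := (f z w - f z' w) / (z - z').

(** The slope is Lipschitz in each argument: in [w] as a bounded function holomorphic off 0, in [z]
    and [z'] by [cauchy_lipschitz2] when [w] is nonzero, and by comparison with nearby lines when
    [w = 0]. Its limit [a] is the partial derivative at 0. *)
Lemma partial_slope_limit f : continuous (uncurry2 f) -> hol_off0 f ->
  exists a, forall e : R, 0 < e -> exists2 d : R, 0 < d &
    forall z z' w, nr z < d -> nr z' < d -> nr w < d ->
      nr (f z w - f z' w - a * (z - z')) <= e * nr (z - z').
Proof.
move=> fc hf; have [M M0 hM0] := polydisc_bound (ltr0n R 2) hf.
have hM z w : nr z = 2 -> nr w <= 2 -> nr (f z w) <= M.
  move=> z2 w2; apply: hM0; rewrite ?z2//.
  by rewrite c2_eq0 negb_and -nr_gt0 z2 ltr0n.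
have linec w : continuous (f^~ w).
  move=> z; apply/cont_nrP => e; have /cont_nrP/[apply] := fc (c2 z w).
  case=> d d0 dP; exists d => // y zy; have := dP (c2 y w).
  rewrite /uncurry2 !fst2K !snd2K; apply; apply: nr2_lt.
    by rewrite fst2B !fst2K.
  by rewrite snd2B !snd2K subrr nr0.
have linec' z : continuous (f z).
  move=> w; apply/cont_nrP => e; have /cont_nrP/[apply] := fc (c2 z w).
  case=> d d0 dP; exists d => // y wy; have := dP (c2 z y).
  rewrite /uncurry2 !fst2K !snd2K; apply; apply: nr2_lt.
    by rewrite fst2B !fst2K subrr nr0.
  by rewrite snd2B !snd2K.
have lined w z : z != 0 -> differentiable (f^~ w) z.
  move=> z0; have h : c2 z w != 0 by rewrite c2_eq0 negb_and z0.
  by have [_ + _] := hf _ h; rewrite fst2K snd2K.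
have bound z z' w : z != z' -> nr z <= 1 -> nr z' <= 1 -> nr w <= 2 ->
    nr (partial_slope f z z' w) <= 2 * M.
  move=> zz' z1 z1' w2; rewrite /partial_slope nrM nrV ler_pdivrMr ?nr_gt0 ?subr_eq0//.
  have hb u : nr u = 2 -> nr (f u w) <= M by move=> u2; exact: hM.
  have two : 2 / 2 = 1 :> R by rewrite divff.
  have := cauchy_lipschitz (ltr0n R 2) (linec w) (lined w) hb (a := z) (b := z').
  rewrite two => /(_ z1 z1') h; apply: le_trans h _.
  by rewrite ler_wpM2r ?nr_ge0//; lra.
have lipw z z' w w' : z != z' -> nr z <= 1 -> nr z' <= 1 -> nr w <= 1 -> nr w' <= 1 ->
    nr (partial_slope f z z' w - partial_slope f z z' w') <= 4 * M * nr (w - w').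
  move=> zz' z1 z1' w1 w1'.
  have pd u : u != 0 -> differentiable (partial_slope f z z') u.
    move=> u0; apply: (@differentiableM _ _ (fun u => f z u - f z' u) (fun=> (z - z')^-1)).
      have hd v : differentiable (f v) u.
        have h : c2 v u != 0 by rewrite c2_eq0 negb_and u0 orbT.
        by have [_ _] := hf _ h; rewrite fst2K snd2K.
      by apply: (@differentiableB _ _ _ (f z) (f z')); exact: hd.
    exact: differentiable_cst.
  have pc : continuous (partial_slope f z z').
    move=> u; apply: (@continuousM _ _ (fun u => f z u - f z' u) (fun=> (z - z')^-1)).
      by apply: (@continuousB _ _ _ (f z) (f z')); exact: linec'.
    exact: cst_continuous.
  have pb u : nr u = 2 -> nr (partial_slope f z z' u) <= 2 * M.
    by move=> u2; apply: bound; rewrite ?u2.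
  have two : 2 / 2 = 1 :> R by rewrite divff.
  have := cauchy_lipschitz (ltr0n R 2) pc pd pb (a := w) (b := w').
  rewrite two => /(_ w1 w1') h; apply: le_trans h _.
  by rewrite ler_wpM2r ?nr_ge0//; lra.
have lipz (z y z' w : C) : z != z' -> y != z' -> nr z <= 1 -> nr y <= 1 -> nr z' <= 1 -> nr w <= 1 ->
    nr (partial_slope f z z' w - partial_slope f y z' w) <= 4 * M * nr (z - y).
  move=> zz' yz' z1 y1 z1' w1.
  have two : 2 / 2 = 1 :> R by rewrite divff.
  have gen u : u != 0 -> nr u <= 1 ->
      nr (partial_slope f z z' u - partial_slope f y z' u) <= 4 * M * nr (z - y).
    move=> u0 u1; have hb v : nr v = 2 -> nr (f v u) <= M by move=> v2; apply: hM => //; lra.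
    have := cauchy_lipschitz2 (ltr0n R 2) (hol_off0_line u0 hf) hb (c := z') (a := z) (b := y).
    rewrite two => /(_ z1 y1 z1' zz' yz') h; apply: le_trans h _.
    rewrite ler_wpM2r ?nr_ge0// le_eqVlt; apply/orP; left; apply/eqP; by field.
  have [w0|w0] := eqVneq w 0; last exact: gen.
  apply/ler_addgt0Pr => e e0.
  pose t : R := Num.min 1 (e / (8 * M + 1)).
  have M8 : 0 < 8 * M + 1 by rewrite ltr_wpDl// mulr_ge0.
  have t0 : 0 < t by rewrite lt_min ltr01 divr_gt0.
  have tC : nr ((t%:C)%C : C) = t by rewrite nr_real gtr0_norm.
  have tC0 : ((t%:C)%C : C) != 0 by rewrite -nr_gt0 tC.
  have t1 : t <= 1 by rewrite ge_min lexx.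
  have te : (8 * M + 1) * t <= e by rewrite mulrC -ler_pdivlMr// ge_min lexx orbT.
  have tC1 : nr ((t%:C)%C : C) <= 1 by rewrite tC.
  have h1 := gen _ tC0 tC1.
  have h2 := lipw z z' w _ zz' z1 z1' w1 tC1.
  have h3 := lipw y z' w _ yz' y1 z1' w1 tC1.
  have nwt : nr (w - (t%:C)%C) = t by rewrite w0 sub0r nrN.
  rewrite nwt in h2 h3; rewrite nrBC in h3.
  apply: le_trans (nr_tri (partial_slope f z z' (t%:C)%C) _ _) _.
  apply: le_trans (lerD (lexx _) (nr_tri (partial_slope f y z' (t%:C)%C) _ _)) _.
  apply: le_trans (lerD h2 (lerD h1 h3)) _.
  move: t0 te; lra.
have symm z z' w : partial_slope f z z' w = partial_slope f z' z w.
  by rewrite /partial_slope -[f z' w - _]opprB -[z' - z]opprB invrN mulrNN.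
have z01 : nr (0 : C) <= 1 by rewrite nr0.
have K0 : 0 <= 4 * M by lra.
have [|a aP] := @lipschitz_limit R (fun t => partial_slope f t 0 0) 1 (4 * M) ltr01 K0.
  by move=> s t s0 t0 s1 t1; exact: lipz.
exists a => e e0.
(* The limit is reached from [(z, z', w)] through [(t, z', w)], [(t, 0, w)] and [(t, 0, 0)]; the
   moves have total length at most [5 * d], each at rate [4 * M]. *)
have M20 : 0 < 20 * M + 1 by rewrite ltr_wpDl// mulr_ge0.
pose d := Num.min 1 (e / (20 * M + 1)).
have d0 : 0 < d by rewrite lt_min ltr01 divr_gt0.
exists d => // z z' w zd zd' wd.
have [->|zz'] := eqVneq z z'; first by rewrite !subrr mulr0 subrr nr0 mulr0.
have d1 : d <= 1 by rewrite ge_min lexx.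
have de : (20 * M + 1) * d <= e by rewrite mulrC -ler_pdivlMr// ge_min lexx orbT.
have z1 : nr z <= 1 by apply/ltW/(lt_le_trans zd).
have z1' : nr z' <= 1 by apply/ltW/(lt_le_trans zd').
have w1 : nr w <= 1 by apply/ltW/(lt_le_trans wd).
have -> : f z w - f z' w - a * (z - z') = (partial_slope f z z' w - a) * (z - z').
  by rewrite mulrBl /partial_slope divfK// subr_eq0.
rewrite nrM ler_wpM2r ?nr_ge0//.
(* Slopes need distinct arguments, so [t] must avoid 0 and [z']; [d / 2] or its opposite does. *)
have [t [t0 td tz]] : exists t : C, [/\ t != 0, nr t < d & t != z'].
  pose t : C := ((d / 2)%:C)%C; have tC : nr t = d / 2 by rewrite nr_real gtr0_norm// divr_gt0.
  have td : nr t < d by rewrite tC ltr_pdivrMr// mulr_natr mulr2n ltrDl.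
  have t0 : t != 0 by rewrite -nr_gt0 tC divr_gt0.
  have [tz|tz] := eqVneq t z'; last by exists t.
  exists (- t); rewrite oppr_eq0 nrN; split => //; rewrite -tz.
  by rewrite eqNr.
have t1 : nr t <= 1 by apply/ltW/(lt_le_trans td).
have g1 := lipz z t z' w zz' tz z1 t1 z1' w1.
have z't : z' != t by rewrite eq_sym.
have t0' : 0 != t by rewrite eq_sym.
have g2 := lipz z' 0 t w z't t0' z1' z01 t1 w1.
have g3 := lipw t 0 w 0 t0 t1 z01 w1 z01.
have g4 := aP t t0 t1.
rewrite [partial_slope f z' t w]symm [partial_slope f 0 t w]symm in g2.
apply: le_trans (nr_tri (partial_slope f t z' w) _ _) _.
apply: le_trans (lerD (lexx _) (nr_tri (partial_slope f t 0 w) _ _)) _.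
apply: le_trans (lerD (lexx _) (lerD (lexx _) (nr_tri (partial_slope f t 0 0) _ _))) _.
apply: le_trans (lerD g1 (lerD g2 (lerD g3 g4))) _.
rewrite !subr0.
have zt : nr (z - t) <= d + d by rewrite (le_trans (nrB _ _))// lerD// ltW.
have dd : 4 * M * (nr (z - t) + (nr z' + (nr w + nr t))) <= 4 * M * (5 * d).
  by rewrite ler_wpM2l//; move: zd' wd td; lra.
rewrite -!mulrDr; apply: le_trans dd _; move: de d0; lra.
Qed.

Lemma strict_derivative f : continuous (uncurry2 f) -> hol_off0 f ->
  exists a b, forall e : R, 0 < e -> exists2 d : R, 0 < d &
    forall x y, nr x < d -> nr y < d ->
      nr (uncurry2 f x - uncurry2 f y - (a * fst2 (x - y) + b * snd2 (x - y))) <= e * nr (x - y).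
Proof.
move=> fc hf; have [a aP] := partial_slope_limit fc hf.
have fc' : continuous (uncurry2 (fun z w => f w z)).
  move=> x; apply/cont_nrP => e; have /cont_nrP/[apply] := fc (c2 (snd2 x) (fst2 x)).
  case=> d d0 dP; exists d => // y xy; have := dP (c2 (snd2 y) (fst2 y)).
  rewrite /uncurry2 !fst2K !snd2K; apply; apply: nr2_lt.
    by rewrite fst2B !fst2K -snd2B; exact: le_lt_trans (nr_snd2 _) xy.
  by rewrite snd2B !snd2K -fst2B; exact: le_lt_trans (nr_fst2 _) xy.
have [b bP] := partial_slope_limit fc' (hol_off0C hf).
exists a, b => e e0; have e2 : 0 < e / 2 by rewrite divr_gt0.
have [d1 d10 h1] := aP _ e2; have [d2 d20 h2] := bP _ e2.
exists (Num.min d1 d2); first by rewrite lt_min d10.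
move=> x y; rewrite !lt_min => /andP[x1 x2] /andP[y1 y2].
have lt (P : C2 R -> C) (u : C2 R) (d : R) : (forall u, nr (P u) <= nr u) -> nr u < d -> nr (P u) < d.
  by move=> hP; apply: le_lt_trans.
have k1 := h1 (fst2 x) (fst2 y) (snd2 x) (lt _ _ _ (@nr_fst2 R) x1) (lt _ _ _ (@nr_fst2 R) y1)
  (lt _ _ _ (@nr_snd2 R) x1).
have k2 := h2 (snd2 x) (snd2 y) (fst2 y) (lt _ _ _ (@nr_snd2 R) x2) (lt _ _ _ (@nr_snd2 R) y2)
  (lt _ _ _ (@nr_fst2 R) y2).
rewrite /= in k1 k2; rewrite /uncurry2 (_ : _ - _ - _ =
  (f (fst2 x) (snd2 x) - f (fst2 y) (snd2 x) - a * (fst2 x - fst2 y)) +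
  (f (fst2 y) (snd2 x) - f (fst2 y) (snd2 y) - b * (snd2 x - snd2 y))); last first.
  by rewrite fst2B snd2B; ring.
apply: le_trans (nrD _ _) _; apply: le_trans (lerD k1 k2) _.
rewrite -fst2B -snd2B.
have -> : e * nr (x - y) = e / 2 * nr (x - y) + e / 2 * nr (x - y) by rewrite -mulrDl -splitr.
by apply: lerD; rewrite ler_wpM2l ?nr_fst2 ?nr_snd2// ltW.
Qed.

End IsolatedSingularity.

(** * Antiholomorphic germs and their linear parts *)

Section Germs.
Variable R : realType.
Local Notation C := (Cplx R).
Implicit Types (x y : C2 R) (g G L : C2 R -> C2 R).

Lemma conjC2K : involutive (@conjC2 R).
Proof. by move=> x; apply/matrixP => i j; rewrite !mxE conjCK. Qed.

Lemma conjC2B x y : conjC2 (x - y) = conjC2 x - conjC2 y.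
Proof. by apply/matrixP => i j; rewrite !mxE rmorphB. Qed.

Lemma conjC2D x y : conjC2 (x + y) = conjC2 x + conjC2 y.
Proof. by apply/matrixP => i j; rewrite !mxE rmorphD. Qed.

Lemma nr_conjC2 x : nr (conjC2 x) = nr x.
Proof.
apply/eqP; rewrite eq_le; apply/andP; split; apply: nr2_le.
- by rewrite /fst2 mxE nrconj nr_fst2.
- by rewrite /snd2 mxE nrconj nr_snd2.
- by rewrite -nrconj; have := nr_fst2 (conjC2 x); rewrite /fst2 mxE.
- by rewrite -nrconj; have := nr_snd2 (conjC2 x); rewrite /snd2 mxE.
Qed.

Lemma conjC2_continuous : continuous (@conjC2 R).
Proof.
move=> x; apply/cont_nrP => e e0; exists e => // y.
by rewrite -conjC2B nr_conjC2.
Qed.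

Lemma hol_off0_coord G (i : 'I_2) : (forall x, x != 0 -> differentiable G x) ->
  hol_off0 (fun z w => G (c2 z w) ord0 i).
Proof.
move=> Gd x x0.
have dG : differentiable (fun y => G y ord0 i) x.
  apply: (@differentiable_comp _ _ _ _ G (fun y : C2 R => y ord0 i)); first exact: Gd.
  exact: differentiable_coord.
have dline (h : C -> C2 R) (a b : C) (v : C2 R) : h a = x -> (forall z, h z - h a = (z - a) *: v) ->
    differentiable (fun z => G (h z) ord0 i) a.
  move=> hx hv; have hd : differentiable h a.
    apply: (@eps_diffC _ _ _ _ v) => e e0; exists 1 => // z _.
    by rewrite hv subrr nr0 mulr_ge0 ?nr_ge0 ?ltW.
  by apply: (@differentiable_comp _ _ _ _ h (fun y => G y ord0 i)); rewrite ?hx.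
split.
- rewrite (_ : uncurry2 _ = fun y => G y ord0 i); last first.
    by apply/funext => y; rewrite /uncurry2 c2_eta.
  exact: differentiable_continuous.
- apply: (dline (fun z => c2 z (snd2 x)) _ 0 (c2 1 0)); rewrite ?c2_eta// => z.
  apply: c2P; rewrite ?fst2B ?snd2B ?fst2Z ?snd2Z !(fst2K, snd2K) ?mulr1//.
  by rewrite mulr0 subrr.
- apply: (dline (fun z => c2 (fst2 x) z) _ 0 (c2 0 1)); rewrite ?c2_eta// => z.
  apply: c2P; rewrite ?fst2B ?snd2B ?fst2Z ?snd2Z !(fst2K, snd2K) ?mulr1//.
  by rewrite mulr0 subrr.
Qed.

Lemma extension_C2 G : (forall x, x != 0 -> differentiable G x) ->
  exists l : C2 R, forall e : R, 0 < e ->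
    exists2 d : R, 0 < d & forall x, x != 0 -> nr x < d -> nr (G x - l) <= e.
Proof.
move=> Gd; have [l1 h1] := extension0 (hol_off0_coord ord0 Gd).
have [l2 h2] := extension0 (hol_off0_coord (lift ord0 ord0) Gd).
exists (c2 l1 l2) => e e0; have [d1 d10 k1] := h1 _ e0; have [d2 d20 k2] := h2 _ e0.
exists (Num.min d1 d2); first by rewrite lt_min d10.
move=> x x0; rewrite lt_min => /andP[/(k1 _ x0) + /(k2 _ x0)].
rewrite /uncurry2 c2_eta => g1 g2.
by apply: nr2_le; rewrite ?fst2B ?snd2B ?(fst2K, snd2K).
Qed.

(** [g - L] has arbitrarily small Lipschitz constant near 0; a pointwise derivative would not
    survive the cut-off. *)
Definition strict_diff0 g L := forall e : R, 0 < e -> exists2 d : R, 0 < d &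
  forall x y, nr x < d -> nr y < d -> nr (g x - g y - L (x - y)) <= e * nr (x - y).

Lemma strict_diff0_C2 G : continuous G -> (forall x, x != 0 -> differentiable G x) ->
  exists M : 'M[C]_2, strict_diff0 G (fun x => x *m M).
Proof.
move=> Gc Gd.
have Pc i : continuous (uncurry2 (fun z w => G (c2 z w) ord0 i)).
  rewrite (_ : uncurry2 _ = fun y => G y ord0 i); last first.
    by apply/funext => y; rewrite /uncurry2 c2_eta.
  move=> x; apply: (@continuous_comp _ _ _ G (fun y : C2 R => y ord0 i)); first exact: Gc.
  exact: coord_continuous.
have [a1 [b1 h1]] := strict_derivative (Pc ord0) (hol_off0_coord ord0 Gd).
have [a2 [b2 h2]] := strict_derivative (Pc (lift ord0 ord0)) (hol_off0_coord (lift ord0 ord0) Gd).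
exists (\matrix_(i, j) if i == ord0 then if j == ord0 then a1 else a2
        else if j == ord0 then b1 else b2) => e e0.
have [d1 d10 k1] := h1 _ e0; have [d2 d20 k2] := h2 _ e0.
exists (Num.min d1 d2); first by rewrite lt_min d10.
move=> x y; rewrite !lt_min => /andP[x1 x2] /andP[y1 y2].
have := k1 _ _ x1 y1; have := k2 _ _ x2 y2; rewrite /uncurry2 !c2_eta => g2 g1.
apply: nr2_le.
  apply: le_trans g1; rewrite le_eqVlt; apply/orP; left; apply/eqP; congr nr.
  rewrite fst2B fst2B; congr (_ - _); rewrite /fst2 mxE !big_ord_recl big_ord0 !mxE /= addr0.
  by rewrite /snd2 !mxE ![_ * a1]mulrC ![_ * b1]mulrC.
apply: le_trans g2; rewrite le_eqVlt; apply/orP; left; apply/eqP; congr nr.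
rewrite snd2B snd2B; congr (_ - _); rewrite /fst2 /snd2 mxE !big_ord_recl big_ord0 !mxE /= addr0.
by rewrite ![_ * a2]mulrC ![_ * b2]mulrC.
Qed.

(** Every complex antilinear map of C^2 has this form; vectors are rows, so matrices act on the
    right. *)
Definition antilin (M : 'M[C]_2) x : C2 R := conjC2 (x *m M).

Lemma mulmx_bound (M : 'M[C]_2) : exists2 B : R, 0 < B & forall x, nr (x *m M) <= B * nr x.
Proof.
pose B := 1 + \sum_i \sum_j nr (M i j).
have B0 : 0 < B by rewrite ltr_wpDr// sumr_ge0// => i _; rewrite sumr_ge0// => j _; exact: nr_ge0.
have coordB x j : nr ((x *m M) ord0 j) <= B * nr x.
  rewrite mxE; apply: le_trans (nr_sum _ _ _) _.
  apply: (@le_trans _ _ (\sum_i nr (M i j) * nr x)).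
    apply: ler_sum => i _; rewrite nrM mulrC ler_wpM2l ?nr_ge0//.
    by case: (unliftP ord0 i) => [k ->|->]; rewrite ?(ord1 k); [exact: nr_snd2|exact: nr_fst2].
  rewrite -mulr_suml ler_wpM2r ?nr_ge0// ler_wpDl// ler_sum// => i _.
  by rewrite (bigD1 j)//= lerDl sumr_ge0// => k _; exact: nr_ge0.
by exists B => // x; apply: nr2_le; exact: coordB.
Qed.

Lemma antilinD M x y : antilin M (x + y) = antilin M x + antilin M y.
Proof. by rewrite /antilin mulmxDl conjC2D. Qed.

Lemma antilinB M x y : antilin M (x - y) = antilin M x - antilin M y.
Proof. by rewrite /antilin mulmxBl conjC2B. Qed.

Lemma antilin0 M : antilin M 0 = 0.
Proof. by have := antilinB M 0 0; rewrite !subrr. Qed.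

Lemma antilinZ M (r : R) x : antilin M ((r%:C)%C *: x) = (r%:C)%C *: antilin M x.
Proof.
rewrite /antilin -scalemxAl; apply/matrixP => i j; rewrite !mxE rmorphM.
by congr (_ * _); apply/eqP; rewrite eq_complex /= oppr0 !eqxx.
Qed.

Lemma antilin_bound M : exists2 B : R, 0 < B & forall x, nr (antilin M x) <= B * nr x.
Proof.
by have [B B0 h] := mulmx_bound M; exists B => // x; rewrite /antilin nr_conjC2.
Qed.

Lemma antilin_strict_diff0 g : continuous g ->
  (forall x, x != 0 -> differentiable (@conjC2 R \o g) x) ->
  exists M, strict_diff0 g (antilin M).
Proof.
move=> gc gd; have Gc : continuous (@conjC2 R \o g).
  by move=> x; apply: continuous_comp; [exact: gc|exact: conjC2_continuous].
have [M MP] := strict_diff0_C2 Gc gd; exists M => e /MP[d d0 dP]; exists d => // x y xd yd.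
have := dP _ _ xd yd; rewrite -nr_conjC2 /antilin /=.
by rewrite !conjC2B !conjC2K.
Qed.

(** If the limit [l] of [g] at 0 were not 0, then [g'] would be continuous at [l], and
    [x = g' (g x)] would tend to the nonzero point [g' l]. *)
Lemma inverse_tends_to0 g g' (l : C2 R) : cancel g g' -> cancel g' g -> g 0 = 0 ->
  (forall x, x != 0 -> {for x, continuous g'}) ->
  (forall e : R, 0 < e -> exists2 d : R, 0 < d & forall x, x != 0 -> nr x < d -> nr (g x - l) <= e) ->
  {for 0, continuous g}.
Proof.
move=> gK g'K g0 g'c gl.
have l0 : l = 0.
  apply/eqP; apply: contraT => l0.
  have y0 : g' l != 0 by apply: contra_neq l0 => h; rewrite -(g'K l) h.
  have ny : 0 < nr (g' l) / 2 by rewrite divr_gt0// nr_gt0.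
  have /cont_nrP/(_ _ ny)[d d0 dP] := g'c _ l0.
  have d2 : 0 < d / 2 by rewrite divr_gt0.
  have [d' d'0 d'P] := gl _ d2.
  pose r := Num.min (d' / 2) (nr (g' l) / 2).
  have r0 : 0 < r by rewrite lt_min divr_gt0.
  pose x : C2 R := c2 (r%:C)%C 0.
  have xr : nr x <= r.
    by apply: nr2_le; [rewrite fst2K nr_real gtr0_norm|rewrite snd2K nr0 ltW].
  have x0 : x != 0 by rewrite c2_eq0 negb_and -nr_gt0 nr_real gtr0_norm ?r0.
  have xd' : nr x < d'.
    by apply: le_lt_trans xr _; rewrite gt_min ltr_pdivrMr// mulr_natr mulr2n ltrDl d'0.
  have := dP (g x); rewrite gK nrBC => /(_ (le_lt_trans (d'P _ x0 xd') _)).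
  rewrite ltr_pdivrMr// mulr_natr mulr2n ltrDl => /(_ d0); apply: contraTT => _.
  rewrite -leNgt; apply: le_trans (nr_sub _ _).
  have : nr x <= nr (g' l) / 2 by rewrite (le_trans xr)// ge_min lexx orbT.
  lra.
apply/cont_nrP => e e0; have e2 : 0 < e / 2 by rewrite divr_gt0.
have [d d0 dP] := gl _ e2; exists d => // x; rewrite sub0r nrN g0 sub0r nrN => xd.
have [->|x0] := eqVneq x 0; first by rewrite g0 nr0.
have := dP _ x0 xd; rewrite l0 subr0 => /le_lt_trans; apply.
by rewrite ltr_pdivrMr// mulr_natr mulr2n ltrDl.
Qed.

Lemma antihol_continuous g g' : cancel g g' -> cancel g' g -> g 0 = 0 ->
  (forall x, x != 0 -> differentiable (@conjC2 R \o g) x) ->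
  (forall x, x != 0 -> differentiable (@conjC2 R \o g') x) ->
  continuous g.
Proof.
move=> gK g'K g0 gd g'd.
have off0 h : (forall x, x != 0 -> differentiable (@conjC2 R \o h) x) ->
    forall x, x != 0 -> {for x, continuous h}.
  move=> hd x x0; have hc := differentiable_continuous (hd _ x0).
  rewrite (_ : h = @conjC2 R \o (@conjC2 R \o h)); last first.
    by apply/funext => y /=; rewrite conjC2K.
  by apply: (@continuous_comp _ _ _ (@conjC2 R \o h) (@conjC2 R)); [exact: hc|exact: conjC2_continuous].
move=> x; have [->|x0] := eqVneq x 0; last exact: (off0 _ gd).
have [l lP] := extension_C2 gd.
apply: (inverse_tends_to0 (l := conjC2 l) gK g'K g0 (off0 _ g'd)) => e /lP[d d0 dP].
exists d => // y y0 yd; have := dP _ y0 yd.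
by rewrite -nr_conjC2 conjC2B /= conjC2K.
Qed.

(** Along a kernel vector [g] would shrink faster than linearly, while [g'] stretches by a bounded
    factor near 0 and must undo this. *)
Lemma antilin_unitmx g g' M M' : cancel g g' -> g 0 = 0 -> continuous g ->
  strict_diff0 g (antilin M) -> strict_diff0 g' (antilin M') -> M \in unitmx.
Proof.
move=> gK g0 gc gM g'M'.
rewrite unitmxE unitfE; apply/negP => /det0P[v v0 vM].
have [B B0 BP] := antilin_bound M'.
(* [g'] stretches by at most [B + 1] near 0, so this factor leads to [nr x <= nr x / 2]. *)
have e0 : 0 < (2 * (B + 1))^-1 by rewrite invr_gt0 mulr_gt0// ltr_wpDl// ltW.
have g'0 : g' 0 = 0 by rewrite -{1}g0 gK.
have [d d0 dP] := gM _ e0; have [d' d'0 d'P] := g'M' _ ltr01.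
have nv : 0 < nr v by rewrite nr_gt0.
pose t := Num.min (d / 2) (d' / 2) / nr v.
have t0 : 0 < t by rewrite divr_gt0// lt_min !divr_gt0.
pose x : C2 R := (t%:C)%C *: v.
have nx : nr x = Num.min (d / 2) (d' / 2).
  by rewrite nrZ nr_real gtr0_norm// /t divfK// gt_eqF.
have nx0 : 0 < nr x by rewrite nx lt_min !divr_gt0.
have xd : nr x < d by rewrite nx gt_min ltr_pdivrMr// mulr_natr mulr2n ltrDl d0.
have xd' : nr x < d' by rewrite nx gt_min ltr_pdivrMr// [X in _ || X]ltr_pdivrMr// [d' * 2]mulr_natr mulr2n ltrDl d'0 orbT.
have := dP x 0 xd; rewrite nr0 => /(_ d0); rewrite g0 !subr0.
have -> : antilin M x = 0.
  by rewrite antilinZ /antilin vM; apply/matrixP => i j; rewrite !mxE conjC0 mulr0.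
rewrite subr0 => gx.
have B1 : 0 < B + 1 by rewrite ltr_wpDl// ltW.
have gx' : (B + 1) * nr (g x) <= nr x / 2.
  apply: le_trans (ler_wpM2l (ltW B1) gx) _.
  by rewrite le_eqVlt; apply/orP; left; apply/eqP; field; rewrite gt_eqF.
have gxd : nr (g x) < d'.
  apply: le_lt_trans xd'; have := nr_ge0 (g x); have := B0; nra.
have := d'P (g x) 0 gxd; rewrite nr0 => /(_ d'0); rewrite g'0 !subr0 gK mul1r => h.
by move: gx' h (nr_sub x (antilin M' (g x))) (BP (g x)) nx0; clear; lra.
Qed.

Lemma diff_mxP (h : C2 R -> C2 R) (a : C2 R) : differentiable h a <->
  exists M : 'M[C]_2, forall e : R, 0 < e -> exists2 d : R, 0 < d & forall z, nr (z - a) < d ->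
    nr (h z - h a - (z - a) *m M) <= e * nr (z - a).
Proof.
split=> [/diff_eps hd|[M MP]].
  exists (lin1_mx ('d h a)) => e /hd[d d0 dP]; exists d => // z /dP.
  by rewrite mul_rV_lin1.
have Mc : continuous (mulmxr M : C2 R -> C2 R).
  have [B B0 BP] := mulmx_bound M.
  move=> x; apply/cont_nrP => e e0; exists (e / B); first by rewrite divr_gt0.
  move=> y xy /=; rewrite -mulmxBl; apply: le_lt_trans (BP _) _.
  by rewrite mulrC -ltr_pdivlMr.
have df : h \o shift a = cst (h a) + (mulmxr M : C2 R -> C2 R) +o_0 id.
  apply/eqaddoP => e e0; move: e0; rewrite ltcE /= => /andP[/eqP eI e0].
  have eE : e = ((complex.Re e)%:C)%C by case: (e) eI => ? ? /= ->.
  have [d d0 dP] := MP _ e0; apply/nbhs_nrP; exists d => // x; rewrite sub0r nrN => xd.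
  have := dP (x + a); rewrite addrK => /(_ xd) hx.
  have -> : (h \o shift a - (cst (h a) + (mulmxr M : C2 R -> C2 R))) x = h (x + a) - h a - x *m M.
    by rewrite -addrA -opprD.
  by rewrite nrE (nrE x) [in leRHS]eE -rmorphM lecR.
by apply/diff_locallyP; rewrite (diff_unique Mc df); split.
Qed.

Lemma conj_diff_conj (h : C2 R -> C2 R) (a : C2 R) : differentiable h (conjC2 a) ->
  differentiable (@conjC2 R \o h \o @conjC2 R) a.
Proof.
move=> /diff_mxP[M MP]; apply/diff_mxP; exists (map_mx Num.conj M) => e /MP[d d0 dP].
exists d => // z; rewrite -nr_conjC2 conjC2B => /dP; rewrite -conjC2B nr_conjC2 -nr_conjC2.
have conjM v : conjC2 (v *m M) = conjC2 v *m map_mx Num.conj M by exact: map_mxM.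
by rewrite !conjC2B conjM conjC2B !conjC2K.
Qed.

(** The Schwarz lemma up to a constant: [cauchy_lipschitz], with exceptional point 0, is applied to
    the coordinates of [G] on the complex line through [x]. *)
Lemma schwarz_bound G (r S : R) : 0 < r -> continuous G -> G 0 = 0 ->
  (forall x, x != 0 -> differentiable G x) ->
  (forall x, nr x <= r -> nr (G x) <= S) ->
  forall x, nr x <= r / 2 -> nr (G x) <= 4 * S / r * nr x.
Proof.
move=> r0 Gc G0 Gd GS x xr; have [->|x0] := eqVneq x 0; first by rewrite G0 nr0 mulr0.
have nx : 0 < nr x by rewrite nr_gt0.
pose v : C2 R := (((nr x)^-1)%:C)%C *: x.
have nv : nr v = 1 by rewrite nrZ nr_real gtr0_norm ?invr_gt0// mulVf// gt_eqF.
have lined z : differentiable (fun z : C => z *: v) z.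
  apply: (@eps_diffC _ _ _ _ v) => e e0; exists 1 => // y _.
  by rewrite -scalerBl subrr nr0 mulr_ge0 ?nr_ge0 ?ltW.
have v0 : v != 0 by rewrite -nr_gt0 nv.
have coordP i : nr (G x ord0 i) <= 4 * S / r * nr x.
  pose h (z : C) : C := G (z *: v) ord0 i.
  have hc : continuous h.
    move=> z; apply: (@continuous_comp _ _ _ (fun z : C => G (z *: v)) (fun y : C2 R => y ord0 i)).
      apply: (@continuous_comp _ _ _ (fun z : C => z *: v) G); last exact: Gc.
      exact: differentiable_continuous.
    exact: coord_continuous.
  have hd z : z != 0 -> differentiable h z.
    move=> z0; have zv : z *: v != 0 by rewrite scaler_eq0 negb_or z0.
    apply: (@differentiable_comp _ _ _ _ (fun z : C => z *: v) (fun y : C2 R => G y ord0 i)) => //.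
    apply: (@differentiable_comp _ _ _ _ G (fun y : C2 R => y ord0 i)); first exact: Gd.
    exact: differentiable_coord.
  have hb z : nr z = r -> nr (h z) <= S.
    move=> zr; have GzS : nr (G (z *: v)) <= S by apply: GS; rewrite nrZ nv mulr1 zr.
    apply: le_trans GzS; rewrite /h; case: (unliftP ord0 i) => [k ->|->]; rewrite ?(ord1 k);
      [exact: nr_snd2|exact: nr_fst2].
  have nxC : nr (((nr x)%:C)%C : C) = nr x by rewrite nr_real gtr0_norm.
  have r2 : 0 <= r / 2 by rewrite ltW// divr_gt0.
  have := cauchy_lipschitz r0 hc hd hb (a := ((nr x)%:C)%C) (b := 0).
  rewrite subr0 nxC nr0 => /(_ xr r2); rewrite /h scale0r G0 /v scalerA -rmorphM divff ?gt_eqF//.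
  by rewrite rmorph1 scale1r (_ : (0 : C2 R) ord0 i = 0) ?subr0 ?mxE.
by apply: nr2_le; exact: coordP.
Qed.

Lemma iter_antilin_bound M n : exists2 B : R, 0 < B & forall x, nr (iter n (antilin M) x) <= B * nr x.
Proof.
have [B B0 BP] := antilin_bound M; elim: n => [|n [B' B'0 IH]].
  by exists 1 => // x; rewrite mul1r.
exists (B * B'); first by rewrite mulr_gt0.
move=> x; rewrite iterS; apply: le_trans (BP _) _.
by rewrite -mulrA ler_wpM2l// ltW.
Qed.

Lemma iter_diff0 g M n : g 0 = 0 -> strict_diff0 g (antilin M) ->
  forall e : R, 0 < e -> exists2 d : R, 0 < d &
    forall x, nr x < d -> nr (iter n g x - iter n (antilin M) x) <= e * nr x.
Proof.
move=> g0 gM; elim: n => [|n IH] e e0.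
  by exists 1 => // x _; rewrite subrr nr0 mulr_ge0 ?nr_ge0 ?ltW.
have [B B0 BP] := antilin_bound M; have [B' B'0 B'P] := iter_antilin_bound M n.
have e1 : 0 < e / (2 * (B' + 1)) by rewrite divr_gt0// mulr_gt0// addr_gt0.
have e2 : 0 < Num.min 1 (e / (2 * B)) by rewrite lt_min ltr01 divr_gt0// mulr_gt0.
have [d1 d10 h1] := gM _ e1; have [d2 d20 h2] := IH _ e2.
exists (Num.min d2 (d1 / (B' + 1))); first by rewrite lt_min d20 divr_gt0// addr_gt0.
move=> x; rewrite lt_min => /andP[x2 x1]; have k2 := h2 _ x2.
set a := iter n g x in k2 *; set b := iter n (antilin M) x in k2 *.
have B1 : 0 < B' + 1 by rewrite addr_gt0.
have ka : nr a <= (B' + 1) * nr x.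
  have hb := B'P x; rewrite -/b in hb.
  have : nr (a - b) <= 1 * nr x.
    by apply: le_trans k2 _; rewrite ler_wpM2r ?nr_ge0// ge_min lexx.
  have := nr_sub a b; lra.
have ad1 : nr a < d1.
  by apply: le_lt_trans ka _; rewrite mulrC -ltr_pdivlMr.
have := h1 a 0 ad1; rewrite nr0 => /(_ d10); rewrite g0 !subr0 => k1.
have -> : iter n.+1 g x - iter n.+1 (antilin M) x = (g a - antilin M a) + antilin M (a - b).
  by rewrite antilinB !iterS -/a -/b addrA subrK.
apply: le_trans (nrD _ _) _; rewrite (splitr e) mulrDl; apply: lerD.
  apply: le_trans k1 _; apply: le_trans (ler_wpM2l (ltW e1) ka) _.
  by rewrite le_eqVlt; apply/orP; left; apply/eqP; field; rewrite gt_eqF.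
apply: le_trans (BP _) _; apply: le_trans (ler_wpM2l (ltW B0) k2) _.
rewrite mulrA ler_wpM2r ?nr_ge0//.
apply: (@le_trans _ _ (B * (e / (2 * B)))).
  by apply: ler_wpM2l; [exact: ltW|rewrite ge_min lexx orbT].
by rewrite le_eqVlt; apply/orP; left; apply/eqP; field; rewrite gt_eqF.
Qed.

(** Some iterate [F] of [g \o g] maps the ball of radius [r] into that of radius [r / 16], so it
    contracts by 1/4 near 0 by the Schwarz bound. Its linear part deviates by at most another 1/4 on
    short vectors, and homogeneity extends the factor 1/2 to all vectors. *)
Lemma antilin_iter_contracts g M (r : R) : 0 < r -> g 0 = 0 -> continuous g ->
  strict_diff0 g (antilin M) ->
  (forall x, x != 0 -> g x != 0) ->
  (forall x, x != 0 -> differentiable (g \o g) x) ->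
  (forall e : R, 0 < e -> exists N, forall x, nr x <= r -> nr (iter N (g \o g) x) <= e) ->
  exists n, forall x, nr (iter n (antilin M) x) <= nr x / 2.
Proof.
move=> r0 g0 gc gM gn0 fd fcontr.
have [N NP] := fcontr (r / 16) (divr_gt0 r0 (ltr0n _ 16)).
set F := iter N (g \o g).
have iterF n : iter n (g \o g) =1 iter (n + n) g.
  by elim: n => // n IH x; rewrite addnS addSn !iterS IH.
have F0 : F 0 = 0 by rewrite /F; elim: (N) => // n IH; rewrite iterS IH /= !g0.
have Fc n : continuous (iter n (g \o g)).
  elim: n => [|n IH] x; first exact: id.
  apply: (@continuous_comp _ _ _ (iter n (g \o g)) (g \o g)); first exact: IH.
  by apply: continuous_comp; exact: gc.
have Fn0 n x : x != 0 -> iter n (g \o g) x != 0.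
  by move=> x0; elim: n => // n IH; rewrite iterS; apply/gn0/gn0.
have Fd n x : x != 0 -> differentiable (iter n (g \o g)) x.
  move=> x0; elim: n => [|n IH]; first by apply/diff_mxP; exists 1%:M => e e0;
    exists 1 => // z _; rewrite mulmx1 subrr nr0 mulr_ge0 ?nr_ge0 ?ltW.
  apply: (@differentiable_comp _ _ _ _ (iter n (g \o g)) (g \o g)); first exact: IH.
  exact/fd/Fn0.
have quarter x : nr x <= r / 2 -> nr (F x) <= nr x / 4.
  move=> xr; apply: le_trans (schwarz_bound r0 (Fc N) F0 (Fd N) NP xr) _.
  by rewrite le_eqVlt; apply/orP; left; apply/eqP; field; rewrite gt_eqF.
exists (N + N)%N => x.
have [d d0 dP] := iter_diff0 (N + N) g0 gM (divr_gt0 (@ltr01 R) (ltr0n _ 4)).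
have [->|x0] := eqVneq x 0.
  by elim: (N + N)%N => [|n IH]; rewrite ?iterS ?nr0 ?mul0r// (_ : iter n _ _ = 0) ?antilin0 ?nr0//;
    apply/eqP; rewrite -nr_eq0 eq_le nr_ge0 (le_trans IH)// nr0 mul0r.
have nx : 0 < nr x by rewrite nr_gt0.
pose t := Num.min (d / 2) (r / 2) / nr x.
have t0 : 0 < t by rewrite divr_gt0// lt_min !divr_gt0.
have nt : nr ((t%:C)%C : C) = t by rewrite nr_real gtr0_norm.
have ntx : nr ((t%:C)%C *: x) = Num.min (d / 2) (r / 2) by rewrite nrZ nt /t divfK// gt_eqF.
have iterZ n y : iter n (antilin M) ((t%:C)%C *: y) = (t%:C)%C *: iter n (antilin M) y.
  by elim: n => // n IH; rewrite !iterS IH antilinZ.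
have := dP ((t%:C)%C *: x); rewrite ntx gt_min ltr_pdivrMr// mulr_natr mulr2n ltrDl d0 => /(_ isT).
have := quarter ((t%:C)%C *: x); rewrite ntx ge_min lexx orbT /F iterF => /(_ isT) h1 h2.
have h3 := nr_sub (iter (N + N) (antilin M) ((t%:C)%C *: x)) (iter (N + N) g ((t%:C)%C *: x)).
rewrite nrBC in h2; rewrite -(ler_pM2l t0).
have -> : t * nr (iter (N + N) (antilin M) x) = nr (iter (N + N) (antilin M) ((t%:C)%C *: x)).
  by rewrite iterZ nrZ nt.
have -> : t * (nr x / 2) = Num.min (d / 2) (r / 2) / 2 by rewrite -ntx nrZ nt mulrA.
lra.
Qed.

End Germs.

(** * Conjugacy on the punctured plane *)

Section PuncturedConjugacy.
Variable R : realType.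
Local Notation V := (C2 R).
Implicit Types (f g h F G : V -> V) (U : set V).

(** A homeomorphism of the punctured plane, as a bijection of C^2 fixing 0. Continuity is required
    off 0, where [agree_conj] is controlled by the entry of orbits into an open set. *)
Definition homeo0 g g' := [/\ cancel g g', cancel g' g, g 0 = 0 &
  forall x, x != 0 -> {for x, continuous g} /\ {for x, continuous g'}].

Definition conj0 g h := exists F F', homeo0 F F' /\ forall x, F (g x) = h (F x).

Lemma homeo0_sym g g' : homeo0 g g' -> homeo0 g' g.
Proof.
move=> [gK g'K g0 gc]; split; [exact: g'K|exact: gK|by rewrite -{1}g0 gK|].
by move=> x x0; have [h1 h2] := gc _ x0; split; [exact: h2|exact: h1].
Qed.

Lemma homeo0_id : homeo0 id id.
Proof. by split; [move=> x|move=> x|by []|move=> x _; split; exact: cvg_id]. Qed.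

Lemma homeo0_neq0 g g' x : homeo0 g g' -> x != 0 -> g x != 0.
Proof.
by move=> [gK _ g0 _]; apply: contra_neq => h; rewrite -(gK x) h -{1}g0 gK.
Qed.

Lemma homeo0_comp f f' g g' : homeo0 f f' -> homeo0 g g' -> homeo0 (g \o f) (f' \o g').
Proof.
move=> hf hg; have [fK f'K f0 fc] := hf; have [gK g'K g0 gc] := hg; split.
- by move=> x /=; rewrite gK fK.
- by move=> x /=; rewrite f'K g'K.
- by rewrite /= f0 g0.
- move=> x x0; split; apply: continuous_comp.
  + exact: (fc _ x0).1.
  + by apply: (gc _ _).1; exact: homeo0_neq0 hf _.
  + exact: (gc _ x0).2.
  + by apply: (fc _ _).2; exact: homeo0_neq0 (homeo0_sym hg) _.
Qed.

Lemma homeo0_iter g g' n : homeo0 g g' -> homeo0 (iter n g) (iter n g').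
Proof.
move=> hg; elim: n => [|n IH]; first exact: homeo0_id.
have -> : iter n.+1 g = g \o iter n g by apply/funext.
have -> : iter n.+1 g' = iter n g' \o g' by apply/funext => x; rewrite iterSr.
exact: homeo0_comp.
Qed.

Lemma conj0_refl g : conj0 g g.
Proof. by exists id, id; split; [exact: homeo0_id|]. Qed.

Lemma conj0_sym g h : conj0 g h -> conj0 h g.
Proof.
move=> [F [F' [FP Fgh]]]; exists F', F; split; first exact: homeo0_sym.
by have [FK F'K _ _] := FP; move=> x; rewrite -{1}(F'K x) -Fgh FK.
Qed.

Lemma conj0_trans h f g : conj0 f h -> conj0 h g -> conj0 f g.
Proof.
move=> [F [F' [FP Ffh]]] [G [G' [GP Ghg]]]; exists (G \o F), (F' \o G').
by split; [exact: homeo0_comp|move=> x /=; rewrite Ffh Ghg].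
Qed.

Lemma conj0_inv g g' h h' : homeo0 g g' -> homeo0 h h' -> conj0 g' h' -> conj0 g h.
Proof.
move=> [gK g'K _ _] [hK h'K _ _] [F [F' [FP Fgh]]]; exists F, F'; split => // x.
by rewrite -[LHS]h'K -Fgh gK.
Qed.

Section Agree.
Variables (U : set V) (g g' G G' : V -> V).
Hypotheses (hg : homeo0 g g') (hG : homeo0 G G').
Hypothesis Uopen : forall x, U x -> nbhs x U.
Hypothesis UG : forall x, U x -> U (G x).
Hypothesis UgG : forall x, U x -> G x = g x.
Hypothesis GU : forall x, x != 0 -> exists n, U (iter n G x).

(* [g^-n o G^n] at [x] is independent of [n] as soon as [G^n x] lies in [U]. *)
Definition agree_conj x : V :=
  if pselect (exists n, U (iter n G x)) is left h then
    iter (projT1 (cid h)) g' (iter (projT1 (cid h)) G x) else 0.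

Lemma iter_agree k y : U y -> U (iter k G y) /\ iter k G y = iter k g y.
Proof. by move=> Uy; elim: k => // k [IU IE]; rewrite !iterS -IE -UgG//; split => //; exact: UG. Qed.

Lemma agree_conjE x n : U (iter n G x) -> agree_conj x = iter n g' (iter n G x).
Proof.
have [gK _ _ _] := hg.
have iterK k : cancel (iter k g) (iter k g').
  by move=> y; have [+ _ _ _] := homeo0_iter k hg; exact.
have mono i k : U (iter i G x) ->
    iter (k + i) g' (iter (k + i) G x) = iter i g' (iter i G x).
  move=> Ui; have [_ E] := iter_agree k Ui.
  by rewrite addnC iterD [in iter _ G]addnC iterD E iterK.
move=> Un; rewrite /agree_conj; case: pselect => [h|[]]; last by exists n.
set m := projT1 _; have Um : U (iter m G x) by rewrite /m; case: cid.
by rewrite -(mono m n Um) -(mono n m Un) addnC.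
Qed.

Lemma agree_conj0 : agree_conj 0 = 0.
Proof.
have [_ _ g'0 _] := homeo0_sym hg; have [_ _ G0 _] := hG.
have it0 h : h 0 = 0 -> forall n, iter n h 0 = 0 by move=> h0; elim=> // n IH; rewrite iterS IH.
by rewrite /agree_conj; case: pselect => // h; rewrite (it0 G G0) (it0 g' g'0).
Qed.

Lemma agree_conj_comm x : agree_conj (G x) = g (agree_conj x).
Proof.
have [gK g'K g0 _] := hg; have [_ _ G0 _] := hG.
have [->|x0] := eqVneq x 0; first by rewrite G0 agree_conj0.
have [n Un] := GU (homeo0_neq0 hG x0).
(* [n] steps from [G x] are [n.+1] steps from [x]; the additional [g'] is undone by [g]. *)
rewrite (agree_conjE Un) (agree_conjE (n := n.+1)); last by rewrite iterSr.
by rewrite [iter n.+1 g' _]iterS g'K [iter n.+1 G x]iterSr.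
Qed.

Lemma agree_conj_continuous x : x != 0 -> {for x, continuous agree_conj}.
Proof.
move=> x0; have [n Un] := GU x0.
have [_ _ _ Gc] := homeo0_iter n hG; have [_ _ _ gc] := homeo0_iter n hg.
have near_U : \forall y \near x, U (iter n G y) by exact: (Gc _ x0).1 _ (Uopen Un).
have y0 := homeo0_neq0 (homeo0_iter n hG) x0.
have c : {for x, continuous (iter n g' \o iter n G)}.
  by apply: continuous_comp; [exact: (Gc _ x0).1|exact: (gc _ y0).2].
move=> A; rewrite (agree_conjE Un) => /c hA.
by apply: filterS2 near_U hA => y Uy; rewrite /= (agree_conjE Uy).
Qed.

End Agree.

(** Both maps are absorbed by the set where they agree, so the construction also works with [g] and
    [G] exchanged, which provides the inverse. *)
Lemma conj0_of_agree U g g' G G' : homeo0 g g' -> homeo0 G G' ->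
  (forall x, U x -> nbhs x U) -> (forall x, U x -> U (G x)) -> (forall x, U x -> G x = g x) ->
  (forall x, x != 0 -> exists n, U (iter n G x)) ->
  (forall x, x != 0 -> exists n, U (iter n g x)) -> conj0 G g.
Proof.
move=> hg hG Uo UG UgG GU gU.
have Ug x : U x -> U (g x) by move=> Ux; rewrite -UgG//; exact: UG.
have UGg x : U x -> g x = G x by move=> Ux; rewrite UgG.
have can (a a' b b' : V -> V) : homeo0 a a' -> homeo0 b b' -> (forall x, U x -> U (b x)) ->
    (forall x, U x -> b x = a x) -> (forall x, x != 0 -> exists n, U (iter n b x)) ->
    cancel (agree_conj U a' b) (agree_conj U b' a).
  move=> ha hb Ub Uab bU x; have [->|x0] := eqVneq x 0.
    by rewrite (agree_conj0 _ ha hb) (agree_conj0 _ hb ha).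
  have [n Un] := bU _ x0.
  have [aK a'K _ _] := homeo0_iter n ha; have [bK _ _ _] := homeo0_iter n hb.
  have Ua y : U y -> U (a y) by move=> Uy; rewrite -Uab//; exact: Ub.
  have Uba y : U y -> a y = b y by move=> Uy; rewrite Uab.
  rewrite (agree_conjE ha Ub Uab Un) (agree_conjE hb Ua Uba (n := n)) a'K//.
exists (agree_conj U g' G), (agree_conj U G' g); split; last first.
  by move=> x; rewrite (agree_conj_comm hg hG UG UgG GU).
split.
- exact: can.
- exact: can.
- exact: agree_conj0 hg hG.
- move=> x x0; split.
    exact: (agree_conj_continuous hg hG Uo UG UgG GU x0).
  exact: (agree_conj_continuous hG hg Uo Ug UGg gU x0).
Qed.

End PuncturedConjugacy.

(** * Lipschitz perturbations of linear contractions *)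

Section Patching.
Variable R : realType.
Local Notation C := (Cplx R).
Local Notation V := (C2 R).

(** Homogeneity is over the reals, because a norm adapted to a real linear map need not be
    compatible with complex scalars. Domination of [nr] is a normalisation. *)
Record real_norm (N : V -> R) : Prop := RealNorm {
  rnormD : forall x y, N (x + y) <= N x + N y;
  rnormZ : forall (r : R) x, N ((r%:C)%C *: x) = `|r| * N x;
  rnorm_ge : forall x, nr x <= N x;
  rnorm_le : exists2 K : R, 0 < K & forall x, N x <= K * nr x }.

Definition real_linear (A : V -> V) : Prop :=
  (forall x y, A (x + y) = A x + A y) /\ forall (r : R) x, A ((r%:C)%C *: x) = (r%:C)%C *: A x.

Lemma real_linearB A x y : real_linear A -> A (x - y) = A x - A y.
Proof.
move=> [AD AZ]; rewrite AD; congr (_ + _).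
have E z : - z = ((-1 : R)%:C)%C *: z :> V by rewrite rmorphN rmorph1 scaleN1r.
by rewrite E AZ -E.
Qed.

Lemma real_linear0 A : real_linear A -> A 0 = 0.
Proof. by move=> hA; have := real_linearB 0 0 hA; rewrite !subrr. Qed.

Lemma expr_small (q c e : R) : 0 <= q -> q < 1 -> 0 < e -> exists n, q ^+ n * c < e.
Proof.
move=> q0 q1 e0; have c1 : 0 < `|c| + 1 by rewrite ltr_wpDl.
have /cvgrPdist_lt/(_ _ (divr_gt0 e0 c1)) : (fun n => q ^+ n) @ \oo --> 0.
  by apply: cvg_expr; rewrite ger0_norm.
case=> n _ /(_ n (leqnn n)); rewrite /= sub0r normrN ger0_norm ?exprn_ge0// => h.
exists n; rewrite ltr_pdivlMr// in h; apply: le_lt_trans h.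
by rewrite ler_wpM2l ?exprn_ge0// (le_trans (ler_norm _))// lerDl.
Qed.

Section Norm.
Variables (N : V -> R) (hN : real_norm N).

Lemma rnorm_ge0 x : 0 <= N x.
Proof. exact: le_trans (nr_ge0 _) (rnorm_ge hN x). Qed.

Lemma rnorm0 : N 0 = 0.
Proof.
by have := rnormZ hN 0 0; rewrite normr0 mul0r scaler0.
Qed.

Lemma rnormN x : N (- x) = N x.
Proof.
have := rnormZ hN (-1) x; rewrite rmorphN rmorph1 scaleN1r => ->.
by rewrite normrN normr1 mul1r.
Qed.

Lemma rnormBC x y : N (x - y) = N (y - x).
Proof. by rewrite -rnormN opprB. Qed.

Lemma rnormB x y : N (x - y) <= N x + N y.
Proof. by rewrite -(rnormN y) rnormD. Qed.

Lemma rnorm_dist x y : `|N x - N y| <= N (x - y).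
Proof.
have h a b : N a - N b <= N (a - b) by rewrite lerBlDr -{1}[a](subrK b) rnormD.
by rewrite ler_norml h andbT lerNl opprB rnormBC h.
Qed.

Lemma rnorm_eq0 x : N x = 0 -> x = 0.
Proof.
move=> h; apply/eqP; rewrite -nr_eq0 eq_le nr_ge0 andbT.
by have := rnorm_ge hN x; rewrite h.
Qed.

Lemma rnorm_gt0 x : x != 0 -> 0 < N x.
Proof. by move=> x0; apply: lt_le_trans (rnorm_ge hN x); rewrite nr_gt0. Qed.

Lemma lipschitz_continuous (h : V -> V) (k : R) :
  (forall x y, N (h x - h y) <= k * N (x - y)) -> continuous h.
Proof.
move=> hk; have [K K0 KP] := rnorm_le hN; move=> x; apply/cont_nrP => e e0.
have k1 : 0 < `|k| * K + 1 by rewrite ltr_wpDl// mulr_ge0// ltW.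
exists (e / (`|k| * K + 1)); first by rewrite divr_gt0.
move=> y xy; apply: le_lt_trans (rnorm_ge hN _) _; apply: le_lt_trans (hk _ _) _.
apply: (@le_lt_trans _ _ ((`|k| * K + 1) * nr (x - y))); last by rewrite mulrC -ltr_pdivlMr.
apply: (@le_trans _ _ (`|k| * (K * nr (x - y)))).
  apply: le_trans (ler_wpM2r (rnorm_ge0 _) (ler_norm k)) _.
  by rewrite ler_wpM2l.
by rewrite mulrA ler_wpM2r ?nr_ge0// lerDl.
Qed.

Lemma rnorm_continuous : continuous N.
Proof.
have [K K0 KP] := rnorm_le hN; move=> x; apply/contR_nrP => e e0.
exists (e / K); first by rewrite divr_gt0.
move=> y xy; apply: le_lt_trans (rnorm_dist _ _) _; apply: le_lt_trans (KP _) _.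
by rewrite mulrC -ltr_pdivlMr.
Qed.

Section Perturbation.
Variables (A A' P : V -> V) (theta m k : R).
Hypotheses (hA : real_linear A) (AK : cancel A A') (A'K : cancel A' A).
Hypotheses (m0 : 0 < m) (km : k <= m / 2) (k0 : 0 <= k) (theta0 : 0 <= theta) (tk1 : theta + k < 1).
Hypotheses (Atheta : forall x, N (A x) <= theta * N x) (Am : forall x, m * N x <= N (A x)).
Hypotheses (Pk : forall x y, N (P x - P y) <= k * N (x - y)) (P0 : P 0 = 0).

Let G x := A x + P x.

Lemma perturb_upper x y : N (G x - G y) <= (theta + k) * N (x - y).
Proof.
have -> : G x - G y = A (x - y) + (P x - P y) by rewrite (real_linearB x y hA) /G opprD addrACA.
by apply: le_trans (rnormD hN _ _) _; rewrite mulrDl lerD.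
Qed.

Lemma perturb_lower x y : m / 2 * N (x - y) <= N (G x - G y).
Proof.
have -> : G x - G y = A (x - y) - (P y - P x).
  by rewrite (real_linearB x y hA) /G opprD opprB addrACA.
have h1 := Am (x - y); have h2 := Pk y x; rewrite (rnormBC y x) in h2.
have h3 : N (A (x - y)) <= N (A (x - y) - (P y - P x)) + N (P y - P x).
  by rewrite -{1}[A (x - y)](subrK (P y - P x)) rnormD.
have h4 : k * N (x - y) <= m / 2 * N (x - y) by rewrite ler_wpM2r ?rnorm_ge0.
move: h1 h2 h3 h4; lra.
Qed.

Lemma perturb_continuous : continuous G.
Proof. exact: lipschitz_continuous perturb_upper. Qed.

(* A minimizer [a] of [N (y - G x)] must be a zero: the Newton step
   [a + A' (y - G a)] halves the residual. *)
Lemma perturb_surj y : exists x, G x = y.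
Proof.
pose rho := 4 * N y / m.
have rho0 : 0 <= rho by rewrite divr_ge0 ?mulr_ge0 ?rnorm_ge0// ltW.
have fc : continuous (fun x => N (y - G x)).
  move=> x; apply: (@continuous_comp _ _ _ (fun x => y - G x) N); last exact: rnorm_continuous.
  by apply: (@continuousB _ _ _ (fun=> y) G); [exact: cst_continuous|exact: perturb_continuous].
have G0 : G 0 = 0 by rewrite /G P0 addr0 real_linear0.
have small x : N (y - G x) <= N y -> nr x <= rho.
  move=> h; have := perturb_lower x 0; rewrite G0 !subr0 => h1.
  have h2 : N (G x) <= N y + N y.
    by rewrite -[G x](subKr y) (le_trans (rnormB _ _))// lerD.
  apply: le_trans (rnorm_ge hN x) _; rewrite ler_pdivlMr//.
  by move: h1 h2; lra.
have [||a /set_mem /= ar amin] := @compact_EVT_min _ _ (fun x => N (y - G x)) [set x : V | nr x <= rho] _ (@compact_ball2 _ _).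
- by exists 0; rewrite /= nr0.
- exact: continuous_subspaceT.
exists a; apply/eqP; rewrite eq_sym -subr_eq0; apply/eqP/rnorm_eq0/eqP.
rewrite eq_le rnorm_ge0 andbT leNgt; apply/negP => v0.
set v := y - G a in v0 amin.
have ay : N v <= N y by have := amin 0; rewrite inE /= nr0 G0 subr0; exact.
have half : N (y - G (a + A' v)) <= N v / 2.
  have -> : y - G (a + A' v) = P a - P (a + A' v).
    have [AD _] := hA; rewrite /G AD A'K /v /G.
    rewrite !opprD opprK; move: (A a) (P a) (P (a + _)) => u w t.
    by apply/matrixP => i j; rewrite !mxE; ring.
  apply: le_trans (Pk _ _) _; rewrite opprD addrA subrr sub0r rnormN.
  have h : m * N (A' v) <= N v by rewrite -{2}[v]A'K; exact: Am.
  have : k * N (A' v) <= m / 2 * N (A' v) by rewrite ler_wpM2r ?rnorm_ge0.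
  by move: h; lra.
set q := N (y - G (a + A' v)) in half.
have qv : q < N v by move: half v0; lra.
have H : nr (a + A' v) <= rho.
  by apply: small; apply: le_trans half _; apply: le_trans ay; move: v0; lra.
by have := amin (a + A' v); rewrite inE /= => /(_ H); rewrite leNgt -/q qv.
Qed.

(** Lipschitz inverse function theorem: a perturbation with constant at most half the lower bound
    [m] of [A] leaves the lower bound [m / 2], hence a Lipschitz inverse. *)
Lemma perturb_homeo : exists G', homeo0 G G' /\ forall x, N (G x) <= (theta + k) * N x.
Proof.
have [G' G'K] := choice perturb_surj.
have G0 : G 0 = 0 by rewrite /G P0 addr0 real_linear0.
have inj x y : G x = G y -> x = y.
  move=> h; apply/eqP; rewrite -subr_eq0; apply/eqP/rnorm_eq0/eqP.
  rewrite eq_le rnorm_ge0 andbT.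
  have := perturb_lower x y; rewrite h subrr rnorm0.
  by rewrite pmulr_rle0// divr_gt0.
have GK : cancel G G' by move=> x; apply: inj; rewrite G'K.
have G'c : continuous G'.
  apply: (@lipschitz_continuous _ (m / 2)^-1) => x y.
  by rewrite ler_pdivlMl ?divr_gt0//; have := perturb_lower (G' x) (G' y); rewrite !G'K.
exists G'; split; last first.
  by move=> x; have := perturb_upper x 0; rewrite G0 !subr0.
split; [exact: GK|exact: G'K|exact: G0|].
by move=> x _; split; [exact: perturb_continuous|exact: G'c].
Qed.

End Perturbation.
End Norm.
End Patching.

(** * Cut-off conjugacies and adapted norms *)

Section Patch.
Variable R : realType.
Local Notation C := (Cplx R).
Local Notation V := (C2 R).

Lemma contraction_small (N : V -> R) (hN : real_norm N) (h : V -> V) (q e : R) x :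
  0 <= q -> q < 1 -> 0 < e -> (forall y, N (h y) <= q * N y) -> exists n, N (iter n h x) < e.
Proof.
move=> q0 q1 e0 hq; have [n nP] := expr_small (N x) q0 q1 e0; exists n.
apply: le_lt_trans nP; elim: n => [|n IH]; first by rewrite expr0 mul1r.
by rewrite iterS exprS -mulrA (le_trans (hq _))// ler_wpM2l.
Qed.

Lemma expansion_large (N : V -> R) (hN : real_norm N) (h : V -> V) (q e : R) x :
  0 <= q -> q < 1 -> 0 < e -> x != 0 -> (forall y, N y <= q * N (h y)) ->
  exists n, e < N (iter n h x).
Proof.
move=> q0 q1 e0 x0 hq; have [n nP] := expr_small e q0 q1 (rnorm_gt0 hN x0); exists n.
rewrite ltNge; apply/negP => le_e.
have : N x <= q ^+ n * N (iter n h x).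
  elim: (n) => [|k IH]; first by rewrite expr0 mul1r.
  by rewrite iterS exprSr -mulrA (le_trans IH)// ler_wpM2l// exprn_ge0.
apply/negP; rewrite -ltNge; apply: le_lt_trans nP.
by rewrite ler_wpM2l// exprn_ge0.
Qed.

Definition cutoff (t : R) : R := Num.max 0 (Num.min 1 (2 - 2 * t)).

Lemma cutoff_in t : 0 <= cutoff t <= 1.
Proof. by rewrite /cutoff le_max lexx ge_max ler01 ge_min lexx. Qed.

Lemma cutoff1 t : t <= 1 / 2 -> cutoff t = 1.
Proof.
by move=> ht; rewrite /cutoff min_l ?max_r ?ler01//; move: ht; lra.
Qed.

Lemma cutoff0 t : 1 <= t -> cutoff t = 0.
Proof.
move=> ht; rewrite /cutoff max_l// ge_min; apply/orP; right; move: ht; lra.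
Qed.

Lemma cutoff_lip s t : `|cutoff s - cutoff t| <= 2 * `|s - t|.
Proof.
wlog st : s t / s <= t.
  move=> h; have [|/ltW ts] := leP s t; first exact: h.
  by rewrite distrC [`|s - t|]distrC; exact: h.
rewrite [`|s - t|]distrC (@ger0_norm _ (t - s)) ?subr_ge0//.
have : cutoff t <= cutoff s /\ cutoff s <= cutoff t + 2 * (t - s).
  rewrite /cutoff /Num.max /Num.min.
  by split; repeat case: ifPn; rewrite -?leNgt; move: st; lra.
by case=> h1 h2; rewrite ger0_norm ?subr_ge0//; move: h2; lra.
Qed.

Lemma real_linear_homeo (N : V -> R) (hN : real_norm N) (A A' : V -> V) (theta m : R) :
  real_linear A -> cancel A A' -> cancel A' A -> 0 < m ->
  (forall x, N (A x) <= theta * N x) -> (forall x, m * N x <= N (A x)) -> homeo0 A A'.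
Proof.
move=> hA AK A'K m0 Atheta Am.
have Ac : continuous A.
  by apply: (lipschitz_continuous hN (k := theta)) => x y; rewrite -real_linearB.
have A'c : continuous A'.
  apply: (lipschitz_continuous hN (k := m^-1)) => x y; rewrite ler_pdivlMl//.
  by apply: le_trans (Am _) _; rewrite real_linearB// !A'K.
split; [exact: AK|exact: A'K|exact: real_linear0|].
by move=> x _; split; [exact: Ac|exact: A'c].
Qed.

(* The cut-off map [A + chi * (g - A)] agrees with [g] near 0 and with [A] far
   from 0, and each point reaches the first region forwards and the second one
   backwards. *)
Lemma patch_conj (N : V -> R) (hN : real_norm N) (g g' A A' : V -> V) (theta m r k : R) :
  homeo0 g g' -> real_linear A -> cancel A A' -> cancel A' A ->
  0 < m -> 0 <= theta -> 0 < r -> 0 <= k -> 3 * k <= m / 2 -> theta + 3 * k < 1 ->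
  (forall x, N (A x) <= theta * N x) -> (forall x, m * N x <= N (A x)) ->
  (forall x y, N x <= r -> N y <= r -> N ((g x - A x) - (g y - A y)) <= k * N (x - y)) ->
  (forall x, x != 0 -> exists n, N (iter n g x) < r / 2) -> conj0 g A.
Proof.
move=> hg hA AK A'K m0 theta0 r0 k0 km tk1 Atheta Am uk gsmall.
have [_ _ g0 _] := hg.
pose u x := g x - A x; pose chi x := cutoff (N x / r).
pose P x : V := ((chi x)%:C)%C *: u x.
have u0 : u 0 = 0 by rewrite /u g0 real_linear0// subrr.
have uN x : N x <= r -> N (u x) <= k * r.
  move=> xr; have := uk x 0 xr; rewrite rnorm0// => /(_ (ltW r0)).
  rewrite -/(u x) -/(u 0) u0 !subr0 => /le_trans; apply.
  by rewrite ler_wpM2l.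
have chi_lip x y : `|chi x - chi y| <= 2 / r * N (x - y).
  apply: le_trans (cutoff_lip _ _) _; rewrite -mulrBl normrM (@gtr0_norm _ r^-1) ?invr_gt0//.
  rewrite -mulrA [r^-1 * _]mulrC ler_wpM2l// ler_wpM2r ?invr_ge0 ?(ltW r0)//.
  exact: rnorm_dist.
have chi0 x : r <= N x -> chi x = 0.
  by move=> h; apply: cutoff0; rewrite ler_pdivlMr// mul1r.
have diff_bound x y : N y <= r -> N (((chi x - chi y)%:C)%C *: u y) <= 2 * k * N (x - y).
  move=> yr; rewrite rnormZ//; apply: le_trans (ler_pM _ _ (chi_lip x y) (uN _ yr)) _ => //.
    exact: rnorm_ge0.
  by rewrite le_eqVlt; apply/orP; left; apply/eqP; field; rewrite gt_eqF.
have dist0 x y : 0 <= N (x - y) by exact: rnorm_ge0.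
(* The factor 3: one [k] is the Lipschitz constant of [u], two come from the slope [2 / r] of the
   cutoff times the bound [k * r] on [u]. *)
have Pk1 x y : N x <= r -> N (P x - P y) <= 3 * k * N (x - y).
  move=> xr; have [yr|/ltW yr] := leP (N y) r; last first.
    have -> : P x - P y = - (((chi y - chi x)%:C)%C *: u x).
      by rewrite /P (chi0 _ yr) scale0r subr0 sub0r rmorphN scaleNr opprK.
    rewrite rnormN//; apply: le_trans (diff_bound y x xr) _.
    by rewrite (rnormBC hN y x) ler_wpM2r// ler_wpM2r//; lra.
  have -> : P x - P y = ((chi x)%:C)%C *: (u x - u y) + ((chi x - chi y)%:C)%C *: u y.
    rewrite /P; move: (u x) (u y) => a b.
    by apply/matrixP => i j; rewrite !mxE rmorphB; ring.
  apply: le_trans (rnormD hN _ _) _; rewrite rnormZ//.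
  have /andP[c0 c1] := cutoff_in (N x / r).
  have : `|chi x| * N (u x - u y) <= 1 * (k * N (x - y)).
    by apply: ler_pM; [|exact: rnorm_ge0|rewrite ger0_norm|exact: uk].
  have := diff_bound x y yr; move: (N (x - y)) => d; lra.
have Pk x y : N (P x - P y) <= 3 * k * N (x - y).
  have [xr|/ltW xr] := leP (N x) r; first exact: Pk1.
  have [yr|/ltW yr] := leP (N y) r; first by rewrite (rnormBC hN) (rnormBC hN x) Pk1.
  by rewrite /P !chi0// !scale0r subrr rnorm0// mulr_ge0// mulr_ge0.
have P0 : P 0 = 0 by rewrite /P u0 scaler0.
have k30 : 0 <= 3 * k by rewrite mulr_ge0.
have [G' [hG GN]] := perturb_homeo hN hA A'K m0 km Atheta Am Pk P0.
set G := fun x => A x + P x in hG GN.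
set q := theta + 3 * k in tk1 GN.
have q0 : 0 <= q by rewrite addr_ge0.
have hAA := real_linear_homeo hN hA AK A'K m0 Atheta Am.
have Nc := rnorm_continuous hN.
have [GK G'K _ _] := hG.
have shrink x : q * N x <= N x by rewrite ler_piMl ?rnorm_ge0// ltW.
have cGg : conj0 G g.
  apply: (conj0_of_agree (U := [set x | N x < r / 2]) hg hG).
  - move=> x xU; apply: open_nbhs_nbhs; split => //.
    by apply: (@open_comp _ _ N [set y | y < r / 2]); [move=> y _; exact: Nc|exact: open_lt].
  - by move=> x /= xU; apply: le_lt_trans (GN _) _; exact: le_lt_trans (shrink _) xU.
  - move=> x /= xU; rewrite /G /P /chi cutoff1.
      by rewrite rmorph1 scale1r addrC subrK.
    by rewrite ler_pdivrMr// mulrC mul1r mulrC ltW// mulrC.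
  - by move=> x _; apply: (contraction_small hN _ q0 tk1); rewrite ?divr_gt0.
  - exact: gsmall.
(* Forward orbits leave the outer region where [G] and [A] agree, but backward orbits are absorbed
   by it; hence the passage to inverses. *)
have cGA : conj0 G' A'.
  have qG' y : N y <= q * N (G' y) by have := GN (G' y); rewrite -/(G (G' y)) G'K.
  have tA' y : N y <= theta * N (A' y) by have := Atheta (A' y); rewrite A'K.
  have t1 : theta < 1 by apply: le_lt_trans tk1; rewrite lerDl.
  apply: (conj0_of_agree (U := [set x | r < N x]) (homeo0_sym hAA) (homeo0_sym hG)).
  - move=> x xU; apply: open_nbhs_nbhs; split => //.
    by apply: (@open_comp _ _ N [set y | r < y]); [move=> y _; exact: Nc|exact: open_gt].
  - by move=> x /= xU; apply: lt_le_trans xU _; apply: le_trans (qG' x) _.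
  - move=> x /= xU; rewrite -{1}(A'K x).
    have E : G (A' x) = A (A' x).
      rewrite /G /P chi0 ?scale0r ?addr0// ltW// (lt_le_trans xU)// (le_trans (tA' x))//.
      by rewrite ler_piMl ?rnorm_ge0// ltW.
    by rewrite -E GK.
  - by move=> x x0; exact: (expansion_large hN q0 tk1 r0 x0 qG').
  - by move=> x x0; exact: (expansion_large hN theta0 t1 r0 x0 tA').
by apply: (conj0_trans (conj0_sym cGg)); exact: conj0_inv hG hAA cGA.
Qed.

Lemma nr_real_norm : real_norm (@nr R V).
Proof.
split; [exact: nrD|by move=> r x; rewrite nrZ nr_real|by []|].
by exists 1 => // x; rewrite mul1r.
Qed.

Lemma antilin_real_linear M : real_linear (@antilin R M).
Proof. by split; [exact: antilinD|exact: antilinZ]. Qed.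

(** [N x] is the sum over [k < n] of the norms of the iterates [A^k x], each divided by
    [theta ^+ k]. Applying [A] shifts the terms, and the last one is absorbed by the first because
    [nr (iter n A x) <= nr x / 2 <= theta ^+ n * nr x]. *)
Lemma adapted_norm (A : V -> V) (B : R) n : real_linear A -> 0 < B -> (forall x, nr (A x) <= B * nr x) ->
  (forall x, nr (iter n A x) <= nr x / 2) ->
  exists N (theta : R), [/\ real_norm N, 0 < theta, theta < 1 & forall x, N (A x) <= theta * N x].
Proof.
move=> hA B0 AB An; have [AD AZ] := hA.
have n0 : (0 < n)%N.
  case: n An => // An; have := An (c2 1 0); rewrite /= leNgt.
  have : 0 < nr (c2 (1 : C) 0 : V) by rewrite nr_gt0 c2_eq0 oner_eq0.
  by move=> h; rewrite ltr_pdivrMr// mulr_natr mulr2n ltrDl h.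
have [theta [t0 t1 tn]] : exists theta : R, [/\ 0 < theta, theta < 1 & 1 / 2 <= theta ^+ n].
  (* Bernoulli's inequality gives [theta ^+ n >= 1 - n / (2 n) = 1/2]. *)
  exists (1 - (2 * n%:R)^-1).
  have nR : 0 < n%:R :> R by rewrite ltr0n.
  have i0 : 0 < (2 * n%:R)^-1 :> R by rewrite invr_gt0 mulr_gt0.
  have i1 : (2 * n%:R)^-1 <= 1 / 2 :> R.
    by rewrite invfM mul1r ler_piMr// invf_le1// ler1n.
  split; [lra|lra|].
  have bern k : 1 - k%:R * (2 * n%:R)^-1 <= (1 - (2 * n%:R)^-1) ^+ k :> R.
    set b := (2 * n%:R)^-1 in i0 i1 *; elim: k => [|k IH]; first by rewrite mul0r subr0 expr0.
    rewrite exprS -natr1; apply: le_trans (ler_wpM2l _ IH); last by lra.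
    have : 0 <= k%:R * b * b by rewrite !mulr_ge0// ltW.
    by move: (k%:R : R) => j h; nra.
  apply: le_trans (bern n); rewrite invfM mulrCA divff ?gt_eqF//; lra.
have tk k : 0 < theta ^+ k by rewrite exprn_gt0.
pose N x := \sum_(k < n) (theta ^+ k)^-1 * nr (iter k A x).
have iterD k x y : iter k A (x + y) = iter k A x + iter k A y.
  by elim: k => // k IH; rewrite !iterS IH AD.
have iterZ k (r : R) x : iter k A ((r%:C)%C *: x) = (r%:C)%C *: iter k A x.
  by elim: k => // k IH; rewrite !iterS IH AZ.
exists N, theta; split => //.
  split.
  - move=> x y; rewrite -big_split; apply: ler_sum => k _.
    by rewrite /= -mulrDr ler_wpM2l ?invr_ge0 ?(ltW (tk _))// iterD nrD.
  - move=> r x; rewrite mulr_sumr; apply: eq_bigr => k _.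
    by rewrite iterZ nrZ nr_real mulrCA.
  - move=> x; case: n n0 {An tn} @N => // n _ N; rewrite /N big_ord_recl /= invr1 mul1r lerDl.
    by rewrite sumr_ge0// => k _; rewrite mulr_ge0 ?nr_ge0// invr_ge0 ltW.
  exists (1 + \sum_(k < n) (theta ^+ k)^-1 * B ^+ k).
    by rewrite ltr_wpDr// sumr_ge0// => k _; rewrite mulr_ge0 ?exprn_ge0 ?invr_ge0 ?(ltW (tk _)) ?(ltW B0).
  move=> x; rewrite mulrDl mul1r ler_wpDl ?nr_ge0// mulr_suml.
  apply: ler_sum => k _; rewrite -mulrA ler_wpM2l ?invr_ge0 ?(ltW (tk _))//.
  elim: (nat_of_ord k) => [|j IH]; first by rewrite expr0 mul1r.
  by rewrite iterS exprS -mulrA (le_trans (AB _))// ler_wpM2l// ltW.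
move=> x; rewrite /N; case: n n0 An tn @N => // n _ An tn _.
rewrite mulr_sumr big_ord_recr /= [leRHS]big_ord_recl /= expr0 invr1 mul1r addrC.
apply: lerD.
  rewrite -iterSr; apply: le_trans (ler_wpM2l _ (An x)) _; first by rewrite invr_ge0 ltW.
  rewrite mulrCA mulrC ler_wpM2r ?nr_ge0// -exprVn.
  rewrite exprVn mulrC ler_pdivrMr// -exprS; move: tn; lra.
apply: ler_sum => k _; rewrite /bump /= add1n -iterSr exprS invfM !mulrA divff ?mul1r// gt_eqF//.
Qed.

End Patch.

(** * Deforming linear contractions along segments *)

Section LinearPaths.
Variable R : realType.
Local Notation C := (Cplx R).
Local Notation V := (C2 R).

(** Connectedness of [0, 1] as an induction principle; it stands in for a chain of conjugacies along
    a subdivision. *)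
Lemma unit_interval_ind (P : R -> Prop) : P 0 ->
  (forall t, 0 <= t <= 1 -> exists2 d : R, 0 < d & forall s, 0 <= s <= 1 -> `|t - s| < d -> (P s <-> P t)) ->
  P 1.
Proof.
move=> P0 Ploc.
pose near (Q : R -> Prop) := [set x : R | exists t (d : R), [/\ 0 <= t <= 1, Q t, `|t - x| < d &
  forall s, 0 <= s <= 1 -> `|t - s| < d -> (P s <-> P t)]].
have near_open Q : open (near Q).
  rewrite openE => x [t [d [t01 Qt tx h]]].
  apply/nbhs_ballP; exists (d - `|t - x|); first by rewrite /= subr_gt0.
  move=> y /= xy; exists t, d; split => //.
  have := ler_distD x t y; move: xy; rewrite /ball /= => xy /le_lt_trans; apply; move: xy; lra.
pose B := [set t : R | `[0, 1]%classic t /\ P t].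
have i01 (x : R) : `[0, 1]%classic x <-> 0 <= x <= 1 by rewrite /= in_itv.
suff BE : B = `[0, 1]%classic.
  have : `[0, 1]%classic (1 : R) by apply/i01; rewrite ler01 lexx.
  by rewrite -BE => -[].
apply: (@segment_connected R 0 1 B).
- by exists 0; split => //; apply/i01; rewrite lexx ler01.
- exists (near P); first exact: near_open.
  apply/seteqP; split=> x.
    move=> [x01 Px]; split => //; have /i01 x01' := x01; have [d d0 h] := Ploc x x01'.
    by exists x, d; split => //; rewrite subrr normr0.
  move=> [x01 [t [d [t01 Pt tx h]]]]; split => //; apply/(h x) => //; exact/i01.
exists (~` near (fun t => ~ P t)); first by rewrite closedC; exact: near_open.
apply/seteqP; split=> x.
  move=> [x01 Px]; split => // -[t [d [t01 nPt tx h]]]; apply: nPt; apply/(h x) => //; exact/i01.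
move=> [x01 nx]; split => //; apply: contrapT => nPx; apply: nx.
have /i01 x01' := x01; have [d d0 h] := Ploc x x01'.
by exists x, d; split => //; rewrite subrr normr0.
Qed.

Definition rscale (c : R) (x : V) : V := (c%:C)%C *: x.

Lemma nr_rscale c x : nr (rscale c x) = `|c| * nr x.
Proof. by rewrite nrZ nr_real. Qed.

Definition segment (A B : V -> V) (t : R) (x : V) : V := rscale (1 - t) (A x) + rscale t (B x).

Lemma real_linear_segment A B t : real_linear A -> real_linear B -> real_linear (segment A B t).
Proof.
move=> [AD AZ] [BD BZ]; split => [x y|r x]; rewrite /segment /rscale ?AD ?BD ?AZ ?BZ.
  by rewrite !scalerDr addrACA.
by rewrite scalerDr !scalerA ![_ * (r%:C)%C]mulrC.
Qed.

(** Neighbouring maps on the segment differ by a map of small Lipschitz constant, so [patch_conj]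
    conjugates them; convexity of [N] gives the whole segment the rate [theta]. *)
Lemma segment_conj (N : V -> R) (theta : R) (A B : V -> V) : real_norm N -> 0 <= theta -> theta < 1 ->
  real_linear A -> real_linear B ->
  (forall x, N (A x) <= theta * N x) -> (forall x, N (B x) <= theta * N x) ->
  (forall t, 0 <= t <= 1 -> exists (F : V -> V) (m : R), [/\ 0 < m, cancel (segment A B t) F,
     cancel F (segment A B t) & forall x, m * N x <= N (segment A B t x)]) ->
  conj0 A B.
Proof.
move=> hN t0 t1 hA hB Atheta Btheta inv.
have segtheta t x : 0 <= t <= 1 -> N (segment A B t x) <= theta * N x.
  move=> /andP[t_0 t_1]; apply: le_trans (rnormD hN _ _) _; rewrite !rnormZ// !ger0_norm ?subr_ge0//.
  have h1 : (1 - t) * N (A x) <= (1 - t) * (theta * N x) by rewrite ler_wpM2l ?subr_ge0.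
  have h2 : t * N (B x) <= t * (theta * N x) by rewrite ler_wpM2l.
  by apply: le_trans (lerD h1 h2) _; rewrite -mulrDl subrK mul1r.
have seg0 : segment A B 0 = A.
  by apply/funext => x; rewrite /segment /rscale subr0 rmorph1 rmorph0 scale1r scale0r addr0.
have seg1 : segment A B 1 = B.
  by apply/funext => x; rewrite /segment /rscale subrr rmorph1 rmorph0 scale1r scale0r add0r.
suff : conj0 A (segment A B 1) by rewrite seg1.
have hseg t : real_linear (segment A B t) by exact: real_linear_segment.
apply: (unit_interval_ind (P := fun t => conj0 A (segment A B t))).
  by rewrite seg0; exact: conj0_refl.
move=> t t01; have [F [m [m0 tF Ft mN]]] := inv t t01.
(* The difference has Lipschitz constant at most [2 * |t - s|]; three times that must be at most
   [m / 2] and less than [1 - theta]. *)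
have d0 : 0 < Num.min (m / 12) ((1 - theta) / 12) by rewrite lt_min !divr_gt0// subr_gt0.
exists (Num.min (m / 12) ((1 - theta) / 12)); first exact: d0.
move=> s s01; rewrite lt_min => /andP[ts1 ts2].
suff c : conj0 (segment A B s) (segment A B t).
  by split=> h; [exact: conj0_trans h c|exact: conj0_trans h (conj0_sym c)].
have [F' [m' [m'0 sF' F's m'N]]] := inv s s01.
have hs := real_linear_homeo hN (hseg s) sF' F's m'0 (fun x => segtheta s x s01) m'N.
have k0 : 0 <= 2 * `|t - s| by rewrite mulr_ge0.
apply: (patch_conj hN hs (hseg t) tF Ft m0 t0 ltr01 k0 _ _ (fun x => segtheta t x t01) mN).
- by move: ts1; lra.
- by move: ts2; lra.
- move=> x y _ _.
  have -> : segment A B s x - segment A B t x - (segment A B s y - segment A B t y) =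
      rscale (t - s) (A (x - y) - B (x - y)).
    rewrite (real_linearB x y hA) (real_linearB x y hB) /segment /rscale.
    by apply/matrixP => i j; rewrite !mxE !rmorphB rmorph1; ring.
  rewrite rnormZ// [2 * _]mulrC -mulrA ler_wpM2l//.
  apply: le_trans (rnormB hN _ _) _; rewrite mulr_natl mulr2n.
  have h : theta * N (x - y) <= N (x - y) by rewrite ler_piMl ?rnorm_ge0// ltW.
  by rewrite lerD// (le_trans _ h)//.
- move=> x _; apply: (contraction_small hN _ t0 t1) => //.
  by move=> y; exact: segtheta.
Qed.

(* One of the rays [M + s u], [u = 1, i, -1], avoids singular matrices: the
   determinant is quadratic in [s u] and cannot vanish on all three. *)
Lemma gl2_segments (E : 'M[C]_2 -> 'M[C]_2 -> Prop) :
  (forall A B D, E A B -> E B D -> E A D) ->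
  (forall A B : 'M[C]_2, (forall t : R, 0 <= t <= 1 ->
     (((1 - t)%:C)%C : C) *: A + ((t%:C)%C : C) *: B \in unitmx) -> E A B) ->
  forall M, M \in unitmx -> E M 1%:M.
Proof.
move=> Etrans Eseg M Mu.
have scal (a : C) : a != 0 -> (a%:M : 'M[C]_2) \in unitmx.
  by move=> a0; rewrite unitmxE det_scalar unitfE expf_neq0.
have seg1 (a b : C) : (forall t : R, 0 <= t <= 1 -> ((1 - t)%:C)%C * a + (t%:C)%C * b != 0 :> C) ->
    E (a%:M) (b%:M).
  move=> h; apply: Eseg => t t01; rewrite !scale_scalar_mx -raddfD /=.
  exact/scal/h.
have Ei1 : E ((@ii R)%:M) 1%:M.
  apply: seg1 => t _; rewrite eq_complex /= !(mulr0, mul0r, mulr1, subr0, oppr0, add0r, addr0).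
  by apply/negP => /andP[/eqP t0 /eqP t1]; move: t1; rewrite t0 subr0 => /eqP; rewrite oner_eq0.
(* The segment from -1 to 1 passes through 0, hence the detour through [i]. *)
have Em1 : E ((-1 : C)%:M) 1%:M.
  apply: (Etrans _ (@ii R)%:M) => //; apply: seg1 => t _.
  rewrite eq_complex /= !(mulr0, mul0r, mulr1, subr0, oppr0, add0r, addr0).
  apply/negP => /andP[/eqP h1 /eqP h2]; move: h1; rewrite h2 subr0 mul1r.
  by move/eqP; rewrite oppr_eq0 oner_eq0.
(* Up to the factor [1 - t], the segment from [M] to [u] is the ray [M + s u] with
   [s = t / (1 - t)]. *)
have ray (u : C) : u != 0 -> E M (u%:M) \/ exists2 s : R, 0 <= s & \det (M + ((s%:C)%C * u)%:M) = 0.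
  move=> u0; have [h|h] := pselect (forall s : R, 0 <= s -> (M + ((s%:C)%C * u)%:M) \in unitmx).
    left; apply: Eseg => t /andP[t0 t1].
    have [->|t1'] := eqVneq t 1.
      by rewrite subrr rmorph0 rmorph1 scale0r scale1r add0r scal.
    have t2 : 0 < 1 - t by rewrite subr_gt0 lt_neqAle t1' t1.
    have t2C : ((1 - t)%:C)%C != 0 :> C by rewrite -nr_gt0 nr_real normr_gt0 gt_eqF.
    have -> : ((1 - t)%:C)%C *: M + (t%:C)%C *: u%:M =
        ((1 - t)%:C)%C *: (M + (((t / (1 - t))%:C)%C * u)%:M).
      rewrite scalerDr; congr (_ + _); rewrite !scale_scalar_mx mulrA -rmorphM /=.
      by rewrite [(1 - t) * _]mulrC divfK ?gt_eqF.
    by rewrite unitmxZ ?unitfE//; apply: h; rewrite divr_ge0// ltW.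
  right; apply: contrapT => nz; apply: h => s s0; rewrite unitmxE unitfE.
  by apply/negP => /eqP d0; apply: nz; exists s.
have nzdet (s : R) (u : C) : \det (M + ((s%:C)%C * u)%:M) = 0 -> s != 0.
  apply: contra_eq_neq => ->; rewrite rmorph0 mul0r raddf0 addr0 -unitfE -unitmxE.
  exact: Mu.
have detE (w : C) : \det (M + w%:M) = w * w + (M ord0 ord0 + M (lift ord0 ord0) (lift ord0 ord0)) * w + \det M.
  have det2 (A : 'M[C]_2) : \det A = A ord0 ord0 * A (lift ord0 ord0) (lift ord0 ord0)
      - A ord0 (lift ord0 ord0) * A (lift ord0 ord0) ord0.
    rewrite (expand_det_row A ord0) !big_ord_recl !big_ord0 /cofactor !det_mx11 !mxE /=.
    have -> : lift (lift ord0 ord0) ord0 = ord0 :> 'I_2 by apply/val_inj.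
    by rewrite /bump /= addn0 expr0 expr1; ring.
  by rewrite !det2 !mxE /= !mulr1n !mulr0n !addr0; ring.
have u1 : (1 : C) != 0 by rewrite oner_eq0.
have ui : @ii R != 0 by rewrite -nr_gt0 nr_ii.
have um : (-1 : C) != 0 by rewrite oppr_eq0 oner_eq0.
have [//|[s1 s10 d1]] := ray _ u1.
have [h|[s2 s20 d2]] := ray _ ui; first exact: Etrans h Ei1.
have [h|[s3 s30 d3]] := ray _ um; first exact: Etrans h Em1.
have z1 := nzdet _ _ d1; have z2 := nzdet _ _ d2; have z3 := nzdet _ _ d3.
pose p := M ord0 ord0 + M (lift ord0 ord0) (lift ord0 ord0); pose q := \det M.
pose w1 : C := (s1%:C)%C * 1; pose w2 : C := (s2%:C)%C * ii R; pose w3 : C := (s3%:C)%C * -1.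
rewrite -/w1 detE -/p -/q in d1; rewrite -/w2 detE -/p -/q in d2; rewrite -/w3 detE -/p -/q in d3.
have n12 : w1 - w2 != 0.
  rewrite /w1 /w2 eq_complex /= !(mulr0, mul0r, mulr1, subr0, oppr0, add0r, addr0).
  by rewrite (negPf z1).
have n13 : w1 - w3 != 0.
  rewrite /w1 /w3 eq_complex /= !(mulr0, mul0r, mulr1, subr0, oppr0, add0r, addr0).
  rewrite eqxx andbT mulrN1 opprK gt_eqF// ltr_wpDr//.
  by rewrite lt_neqAle eq_sym z1.
have n23 : w2 - w3 != 0.
  rewrite /w2 /w3 eq_complex /= !(mulr0, mul0r, mulr1, subr0, oppr0, add0r, addr0).
  by rewrite (negPf z2) andbF.
have e12 : (w1 - w2) * (w1 + w2 + p) = 0.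
  by transitivity ((w1 * w1 + p * w1 + q) - (w2 * w2 + p * w2 + q)); [ring|rewrite d1 d2 subrr].
have e13 : (w1 - w3) * (w1 + w3 + p) = 0.
  by transitivity ((w1 * w1 + p * w1 + q) - (w3 * w3 + p * w3 + q)); [ring|rewrite d1 d3 subrr].
have f12 : w1 + w2 + p = 0 by apply/eqP; move/eqP: e12; rewrite mulf_eq0 (negPf n12).
have f13 : w1 + w3 + p = 0 by apply/eqP; move/eqP: e13; rewrite mulf_eq0 (negPf n13).
case/negP: n23; apply/eqP.
by transitivity ((w1 + w2 + p) - (w1 + w3 + p)); [ring|rewrite f12 f13 subrr].
Qed.

(** [S] and [T] are real linear coordinates in which the path of matrices takes place: conjugation
    and identity for antilinear maps, [regroup] twice for the conjugation itself. A small [c] makes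
    every map on a segment contract [nr] by 1/2; segments are joined by taking the smaller bound. *)
Lemma matrix_segment_conj (S S' T T' : V -> V) (K : R) : 0 < K ->
  real_linear S -> cancel S S' -> cancel S' S -> real_linear T -> cancel T T' -> cancel T' T ->
  (forall x, nr (S x) <= K * nr x) -> (forall x, nr (S' x) <= K * nr x) ->
  (forall x, nr (T x) <= K * nr x) -> (forall x, nr (T' x) <= K * nr x) ->
  forall M : 'M[C]_2, M \in unitmx ->
  exists2 c0 : R, 0 < c0 & forall c, 0 < c <= c0 ->
    conj0 (fun x => rscale c (S (T x *m M))) (fun x => rscale c (S (T x))).
Proof.
move=> K0 hS SK S'K hT TK T'K Sb S'b Tb T'b.
have [SD SZ] := hS; have [TD TZ] := hT.
pose L (M : 'M[C]_2) (c : R) x := rscale c (S (T x *m M)).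
suff key M : M \in unitmx -> exists2 c0 : R, 0 < c0 & forall c, 0 < c <= c0 -> conj0 (L M c) (L 1%:M c).
  move=> M /key[c0 c00 h]; exists c0 => // c /h.
  rewrite (_ : L 1%:M c = fun x => rscale c (S (T x)))//.
  by apply/funext => x; rewrite /L mulmx1.
move: M; apply: (gl2_segments (E := fun A B => exists2 c0 : R, 0 < c0 &
    forall c, 0 < c <= c0 -> conj0 (L A c) (L B c))).
  move=> A B D [c1 c10 h1] [c2 c20 h2]; exists (Num.min c1 c2); first by rewrite lt_min c10.
  move=> c /andP[c0]; rewrite le_min => /andP[cc1 cc2].
  by apply: (conj0_trans (h1 c _) (h2 c _)); rewrite c0.
move=> A B ABu; have [BA BA0 hBA] := mulmx_bound A; have [BB BB0 hBB] := mulmx_bound B.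
have KB : 0 < 2 * (K * K * (BA + BB)) by rewrite !mulr_gt0// addr_gt0.
exists (2 * (K * K * (BA + BB)))^-1; first by rewrite invr_gt0.
move=> c /andP[c0 cK].
have cK' : c * (K * K * (BA + BB)) <= 1 / 2.
  move: cK; rewrite -[X in _ <= X]mul1r ler_pdivlMr// => h; move: h; lra.
have Lb (M : 'M[C]_2) (b : R) : 0 < b -> b <= BA + BB -> (forall x : V, nr (x *m M) <= b * nr x) ->
    forall x, nr (L M c x) <= 1 / 2 * nr x.
  move=> b0 ble hb x; rewrite /L nr_rscale gtr0_norm//.
  apply: (@le_trans _ _ (c * (K * (b * (K * nr x))))).
    rewrite ler_wpM2l ?(ltW c0)// (le_trans (Sb _))// ler_wpM2l ?(ltW K0)// (le_trans (hb _))//.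
    by rewrite ler_wpM2l// ltW.
  rewrite (_ : c * _ = c * (K * K * b) * nr x); last by ring.
  rewrite ler_wpM2r ?nr_ge0//; apply: le_trans cK'.
  by rewrite ler_wpM2l ?(ltW c0)// ler_wpM2l// mulr_ge0// ltW.
have hL M : real_linear (L M c).
  split=> [x y|r x]; rewrite /L /rscale.
    by rewrite TD mulmxDl SD scalerDr.
  by rewrite TZ -scalemxAl SZ !scalerA mulrC.
have segE t x : segment (L A c) (L B c) t x = L ((((1 - t)%:C)%C : C) *: A + ((t%:C)%C : C) *: B) c x.
  rewrite /segment /L /rscale mulmxDr -!scalemxAr SD !SZ.
  by rewrite scalerDr !scalerA ![(c%:C)%C * _]mulrC.
apply: (segment_conj (theta := 1 / 2) (@nr_real_norm R)) => //.
- lra.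
- by apply: (Lb A BA) => //; rewrite lerDl ltW.
- by apply: (Lb B BB) => //; rewrite lerDr ltW.
move=> t t01; have Mu := ABu t t01; set M := _ + _ in Mu segE.
have {}segE : segment (L A c) (L B c) t = L M c by apply/funext => x; exact: segE.
have [b b0 hb] := mulmx_bound (invmx M).
have cinv x : rscale c (rscale c^-1 x) = x.
  by rewrite /rscale scalerA -rmorphM divff ?gt_eqF// rmorph1 scale1r.
have cinv' x : rscale c^-1 (rscale c x) = x.
  by rewrite /rscale scalerA -rmorphM mulVf ?gt_eqF// rmorph1 scale1r.
pose F x := T' (S' (rscale c^-1 x) *m invmx M).
have LF : cancel (L M c) F by move=> x; rewrite /F /L cinv' SK mulmxK// TK.
have FL : cancel F (L M c) by move=> x; rewrite /F /L T'K mulmxKV// S'K cinv.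
have kb : 0 < K * (b * (K * c^-1)) by rewrite !mulr_gt0// invr_gt0.
exists F, (K * (b * (K * c^-1)))^-1; rewrite segE; split => //; first by rewrite invr_gt0.
move=> x; rewrite -{1}(LF x); move: (L M c x) => y.
rewrite ler_pdivrMl// /F (le_trans (T'b _))// -!mulrA ler_wpM2l ?(ltW K0)//.
rewrite (le_trans (hb _))// ler_wpM2l ?(ltW b0)// (le_trans (S'b _))// ler_wpM2l ?(ltW K0)//.
by rewrite nr_rscale gtr0_norm// invr_gt0.
Qed.

(* In the real coordinates (Re z1, Re z2), (Im z1, Im z2) the conjugation of C^2
   becomes the complex linear map diag(1, -1). *)
Definition regroup (z : V) : V :=
  c2 (complex.Re (fst2 z) +i* complex.Re (snd2 z))%C (complex.Im (fst2 z) +i* complex.Im (snd2 z))%C.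

Lemma regroupK : involutive regroup.
Proof. by move=> z; apply: c2P; rewrite /regroup !(fst2K, snd2K) /=; [case: (fst2 z)|case: (snd2 z)]. Qed.

Lemma regroup_linear : real_linear regroup.
Proof.
split=> [x y|r x]; apply: c2P; rewrite /regroup ?fst2D ?snd2D ?fst2Z ?snd2Z !(fst2K, snd2K).
- by case: (fst2 x) (fst2 y) (snd2 x) (snd2 y) => [? ?] [? ?] [? ?] [? ?].
- by case: (fst2 x) (fst2 y) (snd2 x) (snd2 y) => [? ?] [? ?] [? ?] [? ?].
- by apply/eqP; rewrite eq_complex /=; case: (fst2 x) (snd2 x) => [? ?] [? ?] /=;
    apply/andP; split; apply/eqP; ring.
- by apply/eqP; rewrite eq_complex /=; case: (fst2 x) (snd2 x) => [? ?] [? ?] /=;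
    apply/andP; split; apply/eqP; ring.
Qed.

Lemma regroup_bound x : nr (regroup x) <= 2 * nr x.
Proof.
have h1 := nr_fst2 x; have h2 := nr_snd2 x.
apply: nr2_le; rewrite /regroup ?(fst2K, snd2K); apply: le_trans (nr_ReIm _) _ => /=.
  by move: (Re_le_nr (fst2 x)) (Re_le_nr (snd2 x)); lra.
by move: (Im_le_nr (fst2 x)) (Im_le_nr (snd2 x)); lra.
Qed.

Lemma conjC2_scalar : exists2 c0 : R, 0 < c0 & forall c, 0 < c <= c0 ->
  conj0 (fun x => rscale c (conjC2 x)) (rscale c).
Proof.
pose D : 'M[C]_2 := diag_mx (c2 1 (-1)).
have Du : D \in unitmx.
  rewrite unitmxE det_diag unitfE !big_ord_recl big_ord0 mulr1.
  by rewrite [X in X * _]fst2K [X in _ * X]snd2K mul1r oppr_eq0 oner_eq0.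
have conjE x : conjC2 x = regroup (regroup x *m D).
  have fD (y : V) : fst2 (y *m D) = fst2 y.
    by rewrite /fst2 mul_mx_diag mxE [X in _ * X]fst2K mulr1.
  have sD (y : V) : snd2 (y *m D) = - snd2 y.
    by rewrite /snd2 mul_mx_diag mxE [X in _ * X]snd2K mulrN1.
  apply: c2P; rewrite {1}/regroup ?(fst2K, snd2K) fD sD /regroup !(fst2K, snd2K) /=.
    by rewrite /fst2 mxE; case: (x ord0 ord0).
  by rewrite /snd2 mxE; case: (x ord0 _).
have two : 0 < 2 :> R by [].
have [c0 c00 h] := matrix_segment_conj two regroup_linear regroupK regroupK regroup_linear
  regroupK regroupK regroup_bound regroup_bound regroup_bound regroup_bound Du.
exists c0 => // c /h.
have -> : (fun x => rscale c (regroup (regroup x *m D))) = (fun x => rscale c (conjC2 x)).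
  by apply/funext => x; rewrite -conjE.
by have -> : (fun x => rscale c (regroup (regroup x))) = rscale c by apply/funext => x; rewrite regroupK.
Qed.

Lemma conjC2_linear : real_linear (@conjC2 R).
Proof. by have := antilin_real_linear (1%:M : 'M[C]_2); rewrite (_ : antilin _ = @conjC2 R)//;
  apply/funext => x; rewrite /antilin mulmx1. Qed.

(** [antilin M] is shrunk to [c] times itself, then [M] is moved to the identity, then the
    conjugation is removed. Shrinking takes place in the adapted norm, since [antilin M] itself may
    fail to contract [nr]. *)
Lemma antilin_scalar_conj (M : 'M[C]_2) n : M \in unitmx ->
  (forall x, nr (iter n (antilin M) x) <= nr x / 2) ->
  exists2 c : R, 0 < c < 1 & conj0 (antilin M) (rscale c).
Proof.
move=> Mu hn; have hL := antilin_real_linear M; have [LD LZ] := hL.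
have [B B0 hB] := antilin_bound M.
have [N [theta [hN t0 t1 Nt]]] := adapted_norm hL B0 hB hn.
have one : 0 < 1 :> R by [].
have [c1 c10 h1] : exists2 c0 : R, 0 < c0 & forall c, 0 < c <= c0 ->
    conj0 (fun x => rscale c (antilin M x)) (fun x => rscale c (conjC2 x)).
  by apply: (@matrix_segment_conj _ _ id id _ one conjC2_linear (@conjC2K R) (@conjC2K R) _ _ _ _ _ _ _ _ Mu) => // x;
    rewrite ?nr_conjC2 mul1r.
have [c2 c20 h2] := conjC2_scalar.
pose c := Num.min (1 / 2) (Num.min c1 c2).
have c0 : 0 < c by rewrite !lt_min c10 c20 divr_gt0.
have c12 : c <= 1 / 2 by rewrite ge_min lexx.
have cc1 : c <= c1 by rewrite !ge_min lexx /= orbT.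
have cc2 : c <= c2 by rewrite !ge_min lexx /= !orbT.
exists c; first by rewrite c0 (le_lt_trans c12)//; lra.
apply: (@conj0_trans R (fun x => rscale c (conjC2 x))); last by apply: h2; rewrite c0.
apply: (@conj0_trans R (fun x => rscale c (antilin M x))); last by apply: h1; rewrite c0.
have hcL : real_linear (fun x => rscale c (antilin M x)).
  split=> [x y|r x]; rewrite /rscale; first by rewrite LD scalerDr.
  by rewrite LZ !scalerA mulrC.
have Ntc x : N (rscale c (antilin M x)) <= theta * N x.
  rewrite rnormZ// gtr0_norm//; apply: le_trans (Nt x).
  by rewrite ler_piMl ?rnorm_ge0//; move: c12; lra.
apply: (segment_conj hN (ltW t0) t1 hL hcL Nt Ntc) => t /andP[t_0 t_1].
(* This segment consists of the multiples [d] of [antilin M], which are invertible because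
   [d > 0]. *)
pose d := 1 - t + t * c.
have d0 : 0 < d by rewrite /d; move: c0 t_0 t_1 c12; nra.
have segE : segment (antilin M) (fun x => rscale c (antilin M x)) t = fun x => rscale d (antilin M x).
  by apply/funext => x; rewrite /segment /rscale scalerA -scalerDl -rmorphM -rmorphD.
have [b b0 hb] := mulmx_bound (invmx M); have [K K0 hK] := rnorm_le hN.
pose F x := conjC2 (rscale d^-1 x) *m invmx M.
have dinv x : rscale d (rscale d^-1 x) = x.
  by rewrite /rscale scalerA -rmorphM divff ?gt_eqF// rmorph1 scale1r.
have dinv' x : rscale d^-1 (rscale d x) = x.
  by rewrite /rscale scalerA -rmorphM mulVf ?gt_eqF// rmorph1 scale1r.
have kb : 0 < K * (b * d^-1) by rewrite !mulr_gt0// invr_gt0.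
exists F, (K * (b * d^-1))^-1; rewrite segE; split.
- by rewrite invr_gt0.
- by move=> x; rewrite /F dinv' /antilin conjC2K mulmxK.
- by move=> x; rewrite /F /antilin mulmxKV// conjC2K dinv.
move=> x; rewrite ler_pdivrMl//.
have xE : x = F (rscale d (antilin M x)) by rewrite /F dinv' /antilin conjC2K mulmxK.
rewrite {1}xE; move: (rscale d _) => y; rewrite (le_trans (hK _))// -!mulrA ler_wpM2l ?(ltW K0)//.
rewrite (le_trans (hb _))// ler_wpM2l ?(ltW b0)// nr_conjC2 nr_rscale gtr0_norm ?invr_gt0//.
by rewrite ler_wpM2l ?invr_ge0 ?(ltW d0)// rnorm_ge.
Qed.

(** Patching in the adapted norm: strict differentiability at 0 bounds the Lipschitz constant of
    [g - antilin M], and the orbits of [g] enter the ball where both are compared. *)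
Lemma antihol_contraction_conj (g g' : V -> V) (M : 'M[C]_2) n : homeo0 g g' -> M \in unitmx ->
  strict_diff0 g (antilin M) -> (forall x, nr (iter n (antilin M) x) <= nr x / 2) ->
  (forall x (e : R), 0 < e -> exists k, nr (iter k g x) < e) ->
  exists2 c : R, 0 < c < 1 & conj0 g (rscale c).
Proof.
move=> hg Mu gM hn gsmall; have [c c01 Mc] := antilin_scalar_conj Mu hn.
exists c => //; apply: conj0_trans Mc.
have hL := antilin_real_linear M; have [LD LZ] := hL.
have [B B0 hB] := antilin_bound M.
have [N [theta [hN t0 t1 Nt]]] := adapted_norm hL B0 hB hn.
have [b b0 hb] := mulmx_bound (invmx M); have [K K0 hK] := rnorm_le hN.
pose F x := conjC2 x *m invmx M.
have LF : cancel (antilin M) F by move=> x; rewrite /F /antilin conjC2K mulmxK.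
have FL : cancel F (antilin M) by move=> x; rewrite /F /antilin mulmxKV// conjC2K.
have Kb : 0 < K * b by rewrite mulr_gt0.
pose m := (K * b)^-1; have m0 : 0 < m by rewrite invr_gt0.
have mN x : m * N x <= N (antilin M x).
  rewrite ler_pdivrMl// -{1}(LF x); move: (antilin M x) => y.
  rewrite (le_trans (hK _))// -mulrA ler_wpM2l ?(ltW K0)// (le_trans (hb _))//.
  by rewrite ler_wpM2l ?(ltW b0)// nr_conjC2 rnorm_ge.
pose k := Num.min (m / 6) ((1 - theta) / 6).
have k0 : 0 < k by rewrite lt_min !divr_gt0// subr_gt0.
have km : k <= m / 6 by rewrite ge_min lexx.
have kt : k <= (1 - theta) / 6 by rewrite ge_min lexx orbT.
have [d d0 dP] := gM (k / K) (divr_gt0 k0 K0).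
have d2 : 0 < d / 2 by rewrite divr_gt0.
have k30 : 3 * k <= m / 2 by move: km; lra.
have k31 : theta + 3 * k < 1 by move: kt t1; lra.
apply: (patch_conj hN hg hL LF FL m0 (ltW t0) d2 (ltW k0) k30 k31 Nt mN).
  move=> x y xd yd.
  have lt z : N z <= d / 2 -> nr z < d.
    by move=> h; apply: le_lt_trans (rnorm_ge hN z) _; apply: le_lt_trans h _; move: d0; lra.
  have := dP x y (lt _ xd) (lt _ yd); rewrite antilinB => h.
  have -> : g x - antilin M x - (g y - antilin M y) = g x - g y - (antilin M x - antilin M y).
    move: (antilin M x) (antilin M y) (g x) (g y) => p q u v.
    by apply/matrixP => i j; rewrite !mxE; ring.
  apply: le_trans (hK _) _; apply: le_trans (ler_wpM2l (ltW K0) h) _.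
  rewrite mulrA [K * _]mulrC divfK ?gt_eqF// ler_wpM2l ?(ltW k0)//; exact: rnorm_ge.
move=> x x0; have e0 : 0 < d / 2 / 2 / K by rewrite !divr_gt0.
have [j hj] := gsmall x _ e0; exists j; apply: le_lt_trans (hK _) _.
by rewrite mulrC -ltr_pdivlMr.
Qed.

End LinearPaths.

(** * Attraction and repulsion under proper iteration *)

(** Cantor's intersection argument for sets that need not be closed: a cluster point replaces a
    common point. *)
Lemma nested_cluster (T : topologicalType) (K : set T) (B : nat -> set T) : compact K ->
  (forall m, B m !=set0) -> (forall m n, (m <= n)%N -> B n `<=` B m) -> (forall m, B m `<=` K) ->
  exists x, K x /\ forall m U, nbhs x U -> (B m `&` U) !=set0.
Proof.
move=> cK B0 Bmono BK.
have FF : ProperFilter (filter_from setT B).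
  apply: filter_from_proper; last by move=> m _; exact: B0.
  apply: filter_from_filter; first by exists 0%N.
  by move=> i j _ _; exists (maxn i j) => // b Db; split; apply: Bmono Db; rewrite ?leq_maxl ?leq_maxr.
have [x [Kx cl]] : K `&` cluster (filter_from setT B) !=set0.
  by apply: cK; exists 0%N => //; exact: BK.
by exists x; split => // m U xU; apply: cl => //; exists m.
Qed.

Section Dynamics.
Variables (R : realType) (T : topologicalType) (rho : T -> R).
Hypotheses (rho_cont : continuous rho) (rho_gt0 : forall x, 0 < rho x).
Hypothesis annulus_compact : forall a b, 0 < a -> compact [set x | a <= rho x <= b].
Hypothesis rho_large : forall r, exists x, r < rho x.
Hypothesis rho_small : forall r, 0 < r -> exists x, rho x < r.
Hypothesis Tconn : connected [set: T].

(** Proper discontinuity of forward iteration, localised at pairs of points. *)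
Definition proper_iter (h : T -> T) := forall x y : T, exists (U W : set T) (n0 : nat),
  [/\ nbhs x U, nbhs y W & forall n u, (n0 <= n)%N -> U u -> ~ W (iter n h u)].

(** Otherwise pairs of a point of [K1] and a late iterate of it in [K2] would cluster at some
    [(x, y)], against properness there. *)
Lemma iter_leaves_compact (h : T -> T) (K1 K2 : set T) : proper_iter h -> compact K1 -> compact K2 ->
  exists n0, forall n x, (n0 <= n)%N -> K1 x -> ~ K2 (iter n h x).
Proof.
move=> ph c1 c2; apply: contrapT => nb.
pose B (m : nat) := [set p : T * T | [/\ K1 p.1, K2 p.2 & exists2 n, (m <= n)%N & p.2 = iter n h p.1]].
have B0 m : B m !=set0.
  apply: contrapT => Bm; apply: nb; exists m => n x mn K1x K2x; apply: Bm.
  by exists (x, iter n h x); split => //; exists n.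
have Bmono m n : (m <= n)%N -> B n `<=` B m.
  by move=> mn q [h1 h2 [i ni qi]]; split => //; exists i => //; exact: leq_trans ni.
have BK m : B m `<=` K1 `*` K2 by move=> q [h1 h2 _]; exact: (conj h1 h2).
have [[x y] [_ cl]] := nested_cluster (compact_setX c1 c2) B0 Bmono BK.
have [U [W [n0 [Ux Wy UW]]]] := ph x y.
have [|p [[h1 h2 [n nn pn]] [Up Wp]]] := cl n0 (U `*` W); first by exists (U, W).
by apply: (UW n p.1) => //; rewrite -pn.
Qed.

Section OneMap.
Variables (h h' : T -> T) (a b : R).
Hypotheses (hc : continuous h) (h'c : continuous h') (hK : cancel h h') (h'K : cancel h' h).
Hypotheses (ph : proper_iter h) (a0 : 0 < a) (ab : a < b).
Hypothesis meets : forall x, exists k, a < rho (iter k h x) < b \/ a < rho (iter k h' x) < b.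

Lemma iter_continuous (g : T -> T) n : continuous g -> continuous (iter n g).
Proof.
move=> gc; elim: n => [|n IH] x; first exact: cvg_id.
by apply: (@continuous_comp _ _ _ (iter n g) g); [exact: IH|exact: gc].
Qed.

Lemma iter_bounds (g : T -> T) (K : set T) N : continuous g -> compact K ->
  exists d M : R, 0 < d /\ forall n y, (n < N)%N -> K y -> d <= rho (iter n g y) <= M.
Proof.
move=> gc cK; have [[y0 Ky0]|K0] := pselect (exists y, K y); last first.
  by exists 1, 1; split => // n y _ Ky; case: K0; exists y.
elim: N => [|N [d [M [d0 IH]]]]; first by exists 1, 1.
have c : {within K, continuous (fun y => rho (iter N g y))}.
  apply: continuous_subspaceT => y.
  by apply: (@continuous_comp _ _ _ (iter N g) rho); [exact: iter_continuous|exact: rho_cont].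
have K0 : K !=set0 by exists y0.
have [m1 _ h1] := compact_EVT_min K0 cK c; have [m2 _ h2] := compact_EVT_max K0 cK c.
exists (Num.min d (rho (iter N g m1))), (Num.max M (rho (iter N g m2))).
split; first by rewrite lt_min d0 rho_gt0.
move=> n y; rewrite ltnS leq_eqVlt => /orP[/eqP -> Ky|nN Ky].
  by rewrite ge_min le_max h1 ?h2 ?inE ?orbT.
by have /andP[k1 k2] := IH n y nN Ky; rewrite ge_min le_max k1 k2.
Qed.

Definition tends_small (r : R) x := exists k, forall n, (k <= n)%N -> rho (iter n h x) < r.
Definition tends_big x := exists k, forall n, (k <= n)%N -> b < rho (iter n h x).

(* An orbit that avoids the annulus cannot jump across it, since points inside
   the radius [r] are mapped inside the radius [b]. *)
Lemma window (r : R) : 0 < r -> r <= a ->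
  (forall x, rho x < r -> rho (h x) <= b) -> (forall x, rho x < r -> rho (h' x) <= b) ->
  exists N, forall y, a < rho y < b ->
    (forall n, (N <= n)%N -> rho (iter n h y) < r) \/ (forall n, (N <= n)%N -> b < rho (iter n h y)).
Proof.
move=> r0 ra small_h small_h'.
have cK := annulus_compact (b := b) r0.
have [N NP] := iter_leaves_compact ph cK cK; exists N => y /andP[ay yb].
have out n : (N <= n)%N -> rho (iter n h y) < r \/ b < rho (iter n h y).
  move=> Nn; have := NP n y Nn; rewrite /= (ltW yb) (le_trans ra (ltW ay)) => /(_ isT) nK.
  have [|rn] := ltP (rho (iter n h y)) r; first by left.
  have [nb|] := leP (rho (iter n h y)) b; last by right.
  by case: nK; rewrite rn nb.
have [s|s] := out N (leqnn N).
  left=> n /subnK <-; elim: (n - N)%N => [//|m IH].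
  have [//|] := out (m.+1 + N)%N (leq_addl _ _).
  by rewrite addSn iterS => bb; have := small_h _ IH; rewrite leNgt bb.
right=> n /subnK <-; elim: (n - N)%N => [//|m IH].
have [|//] := out (m.+1 + N)%N (leq_addl _ _).
by rewrite addSn iterS => /small_h'; rewrite hK leNgt IH.
Qed.

(** Every orbit meets the annulus, and from [N] steps later it stays on one side. The side is
    locally constant by continuity, hence constant by connectedness. *)
Lemma small_or_big (r : R) : 0 < r -> r <= a ->
  (forall x, rho x < r -> rho (h x) <= b) -> (forall x, rho x < r -> rho (h' x) <= b) ->
  (forall x, tends_small r x) \/ (forall x, tends_big x).
Proof.
move=> r0 ra small_h small_h'; have [N NP] := window r0 ra small_h small_h'.
have key (x : T) : exists U : set T, nbhs x U /\ ((forall z, U z -> tends_small r z) \/ (forall z, U z -> tends_big z)).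
  have cont2 (g : T -> T) (P : R -> Prop) (z : T) : continuous g -> (\forall t \near rho (g z), P t) ->
      \forall w \near z, P (rho (g w)).
    move=> gc hP; have c : {for z, continuous (rho \o g)}.
      by apply: continuous_comp; [exact: gc|exact: rho_cont].
    exact: c.
  have ltn_near (s c : R) : s < c -> \forall t \near s, t < c.
    by move=> sc; apply: open_nbhs_nbhs; split => //; exact: open_lt.
  have gtn_near (s c : R) : c < s -> \forall t \near s, c < t.
    by move=> sc; apply: open_nbhs_nbhs; split => //; exact: open_gt.
  have oo (t : R) : a < t < b -> \forall s \near t, a < s < b.
    by move=> /andP[/gtn_near + /ltn_near]; apply: filterS2 => s -> ->.
  (* [g] is the forward or backward iterate taking [x] into the annulus; for every [z], the forward
     orbits of [z] and [g z] have a common tail. *)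
  have meetI : exists g : T -> T, [/\ continuous g, a < rho (g x) < b &
      exists j : nat, forall (z : T) n, (j <= n)%N -> exists2 i, (N <= i)%N & iter n h z = iter i h (g z)].
    have [k [kx|kx]] := meets x.
      exists (iter k h); split => //; first exact: iter_continuous.
      exists (N + k)%N => z n Nn; exists (n - k)%N; first by rewrite leq_subRL ?(leq_trans _ Nn)// ?leq_addl// addnC.
      by rewrite -iterD subnK// (leq_trans _ Nn)// leq_addl.
    exists (iter k h'); split => //; first exact: iter_continuous.
    exists N => z n Nn; exists (n + k)%N; first by rewrite (leq_trans Nn)// leq_addr.
    rewrite iterD; congr (iter n h _).
    by elim: (k) => // m IH; rewrite iterSr iterS h'K.
  have [g [gc gx [j jP]]] := meetI.
  have nA := cont2 g (fun t => a < t < b) x gc (oo _ gx).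
  have gNc : continuous (iter N h \o g).
    by move=> z; apply: continuous_comp; [exact: gc|exact: iter_continuous].
  case: (NP _ gx) => side.
    have nS := cont2 (iter N h \o g) (fun t => t < r) x gNc (ltn_near _ _ (side N (leqnn N))).
    exists (fun z => a < rho (g z) < b /\ rho (iter N h (g z)) < r); split; first exact: filterI.
    left=> z [zA zr]; exists j => n /(jP z)[i Ni ->].
    have [|big] := NP _ zA; first exact.
    by have := big N (leqnn N); rewrite ltNge (le_trans (ltW zr))// (le_trans ra)// ltW.
  have nB := cont2 (iter N h \o g) (fun t => b < t) x gNc (gtn_near _ _ (side N (leqnn N))).
  exists (fun z => a < rho (g z) < b /\ b < rho (iter N h (g z))); split; first exact: filterI.
  right=> z [zA zb]; exists j => n /(jP z)[i Ni ->].
  have [sm|] := NP _ zA; last exact.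
  by have := sm N (leqnn N); rewrite ltNge (le_trans _ (ltW zb))// (le_trans ra)// ltW.
have excl x : tends_small r x -> tends_big x -> False.
  move=> [k kP] [j jP]; have := kP (maxn k j) (leq_maxl _ _); have := jP (maxn k j) (leq_maxr _ _).
  by move=> h1 /(lt_trans h1); rewrite ltNge (le_trans ra)// ltW.
have [[x0 Sx0]|noS] := pselect (exists x, tends_small r x); last first.
  right=> x; have [U [Ux [US|UB]]] := key x.
    by case: noS; exists x; exact: US (nbhs_singleton Ux).
  exact: UB (nbhs_singleton Ux).
left=> x; have E : [set y | tends_small r y] = setT; last by have : [set: T] x by []; rewrite -E.
apply: Tconn; first by exists x0.
- exists [set y | tends_small r y]; last by rewrite setTI.
  rewrite openE => y Sy; have [U [Uy [US|UB]]] := key y; first exact: filterS US Uy.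
  by case: (excl y) => //; exact: UB (nbhs_singleton Uy).
exists [set y | tends_small r y]; last by rewrite setTI.
rewrite -[X in closed X]setCK closedC openE => y nSy.
have [U [Uy [US|UB]]] := key y; first by case: nSy; exact: US (nbhs_singleton Uy).
by apply: filterS Uy => z /UB Bz Sz; exact: excl Sz Bz.
Qed.

End OneMap.

Lemma proper_iter_sym (h h' : T -> T) : cancel h h' -> cancel h' h -> proper_iter h -> proper_iter h'.
Proof.
move=> hK h'K ph x y; have [U [W [n0 [Uy Wx UW]]]] := ph y x.
exists W, U, n0; split => // n u nn Wu Uu; apply: (UW n _ nn Uu).
by rewrite (_ : iter n h _ = u)//; elim: n {nn Uu} => // n IH; rewrite iterSr iterS h'K.
Qed.

Section TwoMaps.
Variables (h h' : T -> T) (a b r0 : R).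
Hypotheses (hc : continuous h) (h'c : continuous h') (hK : cancel h h') (h'K : cancel h' h).
Hypotheses (ph : proper_iter h) (a0 : 0 < a) (ab : a < b) (r00 : 0 < r0) (r0a : r0 <= a).
Hypothesis meets : forall x, exists k, a < rho (iter k h x) < b \/ a < rho (iter k h' x) < b.
Hypothesis small_h : forall x, rho x < r0 -> rho (h x) <= b.
Hypothesis small_h' : forall x, rho x < r0 -> rho (h' x) <= b.

Let meets' x : exists k, a < rho (iter k h' x) < b \/ a < rho (iter k h x) < b.
Proof. by have [k []] := meets x; exists k; [right|left]. Qed.

Let ph' := proper_iter_sym hK h'K ph.

Lemma iterKn (g g' : T -> T) n : cancel g g' -> cancel (iter n g) (iter n g').
Proof. by move=> gK x; elim: n => // n IH; rewrite iterSr iterS gK. Qed.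

(** Consequently a point with very large or very small [rho] is at least [N] steps away from the
    annulus. *)
Lemma orbit_bounds N : exists d M : R, 0 < d /\ forall n y, (n < N)%N -> a < rho y < b ->
  d <= rho (iter n h y) <= M /\ d <= rho (iter n h' y) <= M.
Proof.
have cK := annulus_compact (b := b) a0.
have [d1 [M1 [d10 h1]]] := iter_bounds N hc cK; have [d2 [M2 [d20 h2]]] := iter_bounds N h'c cK.
exists (Num.min d1 d2), (Num.max M1 M2); split; first by rewrite lt_min d10.
move=> n y nN /andP[ya yb]; have Ky : [set x | a <= rho x <= b] y by rewrite /= !ltW.
have /andP[k1 k2] := h1 n y nN Ky; have /andP[k3 k4] := h2 n y nN Ky.
by rewrite !ge_min !le_max k1 k2 k3 k4 !orbT.
Qed.

Lemma meets_cases x : exists k y, a < rho y < b /\ (x = iter k h y \/ x = iter k h' y).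
Proof.
have [k [hx|hx]] := meets x.
  by exists k, (iter k h x); split => //; right; rewrite iterKn.
by exists k, (iter k h' x); split => //; left; rewrite iterKn.
Qed.

Lemma tends_excl (g : T -> T) (r : R) x : r <= b -> tends_small g r x -> tends_big g b x -> False.
Proof.
move=> rb [k kP] [j jP]; have := kP (maxn k j) (leq_maxl _ _); have := jP (maxn k j) (leq_maxr _ _).
by move=> h1 /(lt_trans h1); rewrite ltNge rb.
Qed.

Let r0b : r0 <= b. Proof. exact: le_trans r0a (ltW ab). Qed.

(** A point far outside is a late iterate, under [h] or [h'], of a point of the annulus; by [window]
    the tail of that orbit stays outside. *)
Lemma not_both_small : (forall x, tends_small h r0 x) -> (forall x, tends_small h' r0 x) -> False.
Proof.
move=> S S'; have [N NP] := window hK ph r00 r0a small_h small_h'.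
have [N' NP'] := window h'K ph' r00 r0a small_h' small_h.
have [d [M [_ dM]]] := orbit_bounds (maxn N N').
have [x] := rho_large (Num.max M b); rewrite gt_max => /andP[xM xb].
have [k [y [yA xy]]] := meets_cases x.
have [kN|kN] := ltnP k (maxn N N').
  have [/andP[_ h1] /andP[_ h2]] := dM k y kN yA.
  by case: xy => xE; move: xM; rewrite xE ltNge ?h1 ?h2.
move: kN; rewrite geq_max => /andP[kN kN'].
case: xy => xE.
  have [sm|bg] := NP y yA; first by have := sm k kN; rewrite -xE ltNge (le_trans r0b)// ltW.
  by apply: (tends_excl r0b (S y)); exists N.
have [sm|bg] := NP' y yA; first by have := sm k kN'; rewrite -xE ltNge (le_trans r0b)// ltW.
by apply: (tends_excl r0b (S' y)); exists N'.
Qed.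

Lemma not_both_big : (forall x, tends_big h b x) -> (forall x, tends_big h' b x) -> False.
Proof.
move=> B B'; have [N NP] := window hK ph r00 r0a small_h small_h'.
have [N' NP'] := window h'K ph' r00 r0a small_h' small_h.
have [d [M [d0 dM]]] := orbit_bounds (maxn N N').
have dr : 0 < Num.min d r0 by rewrite lt_min d0.
have [x] := rho_small dr; rewrite lt_min => /andP[xd xr].
have [k [y [yA xy]]] := meets_cases x.
have [kN|kN] := ltnP k (maxn N N').
  have [/andP[h1 _] /andP[h2 _]] := dM k y kN yA.
  by case: xy => xE; move: xd; rewrite xE ltNge ?h1 ?h2.
move: kN; rewrite geq_max => /andP[kN kN'].
case: xy => xE.
  have [sm|bg] := NP y yA; first by apply: (tends_excl r0b _ (B y)); exists N.
  by have := bg k kN; rewrite -xE ltNge (le_trans (ltW xr)).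
have [sm|bg] := NP' y yA; first by apply: (tends_excl r0b _ (B' y)); exists N'.
by have := bg k kN'; rewrite -xE ltNge (le_trans (ltW xr)).
Qed.

(** Lyapunov stability of the end where [rho] tends to 0, and visits of every orbit arbitrarily
    close to it. *)
Definition attracting (g : T -> T) := (forall e : R, 0 < e -> exists2 d : R, 0 < d &
  forall x n, rho x < d -> rho (iter n g x) < e) /\
  forall x (e : R), 0 < e -> exists n, rho (iter n g x) < e.

(** For stability: a point with small [rho] is a late iterate of a point of the annulus. It cannot
    be one under [h'], whose orbits go outwards, so it lies on a forward orbit that has already
    become small for good. *)
Lemma attracting_of_small : (forall x, tends_small h r0 x) -> (forall x, tends_big h' b x) -> attracting h.
Proof.
move=> S B'.
have shr (g : T -> T) e x : (forall x, rho x < r0 -> rho (g x) <= b) -> rho x < Num.min e r0 -> rho (g x) <= b.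
  by move=> sg; rewrite lt_min => /andP[_]; exact: sg.
split=> [e e0|x e e0]; last first.
  have er : 0 < Num.min e r0 by rewrite lt_min e0.
  have era : Num.min e r0 <= a by rewrite ge_min r0a orbT.
  have [Sm|Bg] := small_or_big hc h'c hK h'K ph ab meets er era (fun x => @shr h e x small_h) (fun x => @shr h' e x small_h').
    have [k kP] := Sm x; exists k; have := kP k (leqnn k).
    by rewrite lt_min => /andP[].
  by case: (tends_excl r0b (S x) (Bg x)).
pose r := Num.min e r0.
have rr : 0 < r by rewrite lt_min e0.
have ra : r <= a by rewrite ge_min r0a orbT.
have rb : r <= b by exact: le_trans ra (ltW ab).
have [N NP] := window hK ph rr ra (fun x => @shr h e x small_h) (fun x => @shr h' e x small_h').
have [N' NP'] := window h'K ph' rr ra (fun x => @shr h' e x small_h') (fun x => @shr h e x small_h).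
have [d [M [d0 dM]]] := orbit_bounds (maxn N N').
exists (Num.min d r); first by rewrite lt_min d0.
move=> x n; rewrite lt_min => /andP[xd xr].
have [k [y [yA xy]]] := meets_cases x.
have [kN|kN] := ltnP k (maxn N N').
  have [/andP[h1 _] /andP[h2 _]] := dM k y kN yA.
  by case: xy => xE; move: xd; rewrite xE ltNge ?h1 ?h2.
move: kN; rewrite geq_max => /andP[kN kN'].
case: xy => xE.
  have [sm|bg] := NP y yA; last first.
    by case: (@tends_excl h r0 y r0b (S y)); exists N.
  have := sm (n + k)%N (leq_trans kN (leq_addl _ _)); rewrite iterD -xE lt_min.
  by case/andP.
have [sm|bg] := NP' y yA; first by case: (@tends_excl h' r y rb _ (B' y)); exists N'.
by have := bg k kN'; rewrite -xE ltNge (le_trans (ltW xr)).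
Qed.

End TwoMaps.

Lemma attracting_or_repelling (h h' : T -> T) (a b r0 : R) : continuous h -> continuous h' ->
  cancel h h' -> cancel h' h -> proper_iter h -> 0 < a -> a < b -> 0 < r0 -> r0 <= a ->
  (forall x, exists k, a < rho (iter k h x) < b \/ a < rho (iter k h' x) < b) ->
  (forall x, rho x < r0 -> rho (h x) <= b) -> (forall x, rho x < r0 -> rho (h' x) <= b) ->
  attracting h \/ attracting h'.
Proof.
move=> hc h'c hK h'K ph a0 ab r00 r0a meets sh sh'.
have ph' := proper_iter_sym hK h'K ph.
have meets' x : exists k, a < rho (iter k h' x) < b \/ a < rho (iter k h x) < b.
  by have [k []] := meets x; exists k; [right|left].
have [S|B] := small_or_big hc h'c hK h'K ph ab meets r00 r0a sh sh';
have [S'|B'] := small_or_big h'c hc h'K hK ph' ab meets' r00 r0a sh' sh.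
- by case: (not_both_small hc h'c hK h'K ph a0 ab r00 r0a meets sh sh' S S').
- by left; exact: (attracting_of_small hc h'c hK h'K ph a0 ab r00 r0a meets sh sh' S B').
- by right; exact: (attracting_of_small h'c hc h'K hK ph' a0 ab r00 r0a meets' sh' sh S' B).
- by case: (not_both_big hc h'c hK h'K ph a0 ab r00 r0a meets sh sh' B B').
Qed.

End Dynamics.

(** * Coverings whose fibres are the orbits of one map *)

Section Coverings.
Variables (E B : topologicalType) (p : E -> B).
Hypothesis hp : covering_map p.

Lemma covering_local x : exists (U : set B) (V : set E) (s : B -> E),
  [/\ open U, U (p x), open V & V x] /\
  [/\ {within U, continuous s}, forall y, U y -> V (s y),
      forall y, U y -> p (s y) = y & forall z, V z -> s (p z) = z].
Proof.
have [_ _ loc] := hp; have [U [Vs [oU Ux _ pU sheets]]] := loc (p x).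
have : (p @^-1` U) x by [].
rewrite pU => -[V VsV Vx]; have [oV [s [sc sV ps sp]]] := sheets V VsV.
by exists U, V, s.
Qed.

Lemma covering_open A : open A -> open (p @` A).
Proof.
rewrite !openE => oA _ [x Ax <-]; have [U [V [s [[oU Ux oV Vx] [sc sV ps sp]]]]] := covering_local x.
have nA : nbhs (s (p x)) A by rewrite sp//; exact: oA.
have : nbhs (p x) [set y | U y -> A (s y)].
  by have /subspace_continuousP/(_ _ Ux _ nA) := sc.
have : nbhs (p x) U by exact: open_nbhs_nbhs.
apply: filterS2 => y Uy /(_ Uy) Asy.
by exists (s y) => //; exact: ps.
Qed.

Lemma covering_inj x : exists V, [/\ open V, V x & forall y z, V y -> V z -> p y = p z -> y = z].
Proof.
have [U [V [s [[oU Ux oV Vx] [sc sV ps sp]]]]] := covering_local x.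
by exists V; split => // y z Vy Vz yz; rewrite -(sp _ Vy) yz sp.
Qed.

End Coverings.

Section OrbitCovering.
Variables (R : realType) (T H : topologicalType) (rho : T -> R) (p : T -> H) (f f' : T -> T).
Hypotheses (rho_cont : continuous rho) (rho_gt0 : forall x, 0 < rho x).
Hypothesis annulus_compact : forall a b, 0 < a -> compact [set x | a <= rho x <= b].
Hypothesis rho_large : forall r, exists x, r < rho x.
Hypotheses (Tconn : connected [set: T]) (Thaus : hausdorff_space T) (Hhaus : hausdorff_space H).
Hypothesis Hcomp : compact [set: H].
Hypotheses (fc : continuous f) (f'c : continuous f') (fK : cancel f f') (f'K : cancel f' f).
Hypotheses (hp : covering_map p) (pP : forall x y, p x = p y <-> same_orbit f x y).

Let iterfK n : cancel (iter n f) (iter n f').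
Proof. exact: iterKn. Qed.

Let iterf'K n : cancel (iter n f') (iter n f).
Proof. exact: iterKn. Qed.

Lemma same_orbitE x y : same_orbit f x y -> exists k, iter k f x = y \/ iter k f' x = y.
Proof.
move=> [m [n e]]; have [mn|/ltnW nm] := leqP m n.
  exists (n - m)%N; right.
  have : iter m f x = iter m f (iter (n - m) f y) by rewrite e -iterD subnKC.
  by move/(can_inj (iterfK m)) => ->; rewrite iterfK.
exists (m - n)%N; left.
by apply: (can_inj (iterfK n)); rewrite -e -iterD subnKC.
Qed.

Lemma p_iter n x : p (iter n f x) = p x.
Proof. by apply/pP; exists 0%N, n. Qed.

(** The images under [p] of growing open annuli are open and exhaust the compact [H], so a single
    annulus maps onto [H]. *)
Lemma orbit_meets_annulus : exists a b : R, [/\ 0 < a, a < b &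
  forall x, exists k, a < rho (iter k f x) < b \/ a < rho (iter k f' x) < b].
Proof.
have [pc psurj _] := hp.
pose A (m : nat) := [set x : T | (m.+2%:R)^-1 < rho x < m.+2%:R].
have oA m : open (A m).
  have -> : A m = rho @^-1` [set t | (m.+2%:R)^-1 < t] `&` rho @^-1` [set t | t < m.+2%:R].
    by apply/seteqP; split => x /=; [case/andP|move=> [h1 h2]; apply/andP].
  by apply: openI; apply: open_comp; rewrite ?open_gt ?open_lt// => x _; exact: rho_cont.
have Amono m n : (m <= n)%N -> A m `<=` A n.
  move=> mn x /= /andP[h1 h2]; apply/andP; split.
    by apply: le_lt_trans h1; rewrite lef_pV2 ?posrE ?ltr0n// ler_nat !ltnS.
  by apply: lt_le_trans h2 _; rewrite ler_nat !ltnS.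
have Acov x : exists m, A m x.
  have [m hm] : exists m : nat, Num.max (rho x) (rho x)^-1 < m.+2%:R.
    have h0 : 0 <= Num.max (rho x) (rho x)^-1 by rewrite le_max (ltW (rho_gt0 x)).
    have hb := archi_boundP h0.
    exists (Num.bound (Num.max (rho x) (rho x)^-1)); by apply: (lt_trans hb); rewrite ltr_nat.
  exists m; move: hm; rewrite gt_max => /andP[h1 h2]; apply/andP; split => //.
  by rewrite -[ltRHS]invrK ltf_pV2 ?posrE ?ltr0n// invr_gt0.
have [m mP] : exists m, forall b, exists2 x, A m x & p x = b.
  apply: contrapT => nm.
  pose D m := [set b : H | ~ exists2 x, A m x & p x = b].
  have D0 m : D m !=set0.
    by apply: contrapT => h; apply: nm; exists m => b; apply: contrapT => hb; apply: h; exists b.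
  have Dmono m n : (m <= n)%N -> D n `<=` D m.
    by move=> mn b nb [x Ax xb]; apply: nb; exists x => //; exact: Amono Ax.
  have [b [_ cl]] := nested_cluster Hcomp D0 Dmono (fun m => @subsetT _ (D m)).
  have [x xb] := psurj b; have [m Ax] := Acov x.
  have nb : nbhs b (p @` A m).
    apply: open_nbhs_nbhs; split; first exact: covering_open.
    by exists x.
  have [b' [nD [z Az zb]]] := cl m _ nb.
  by apply: nD; exists z.
exists (m.+2%:R)^-1, m.+2%:R; split.
- by rewrite invr_gt0 ltr0n.
- by apply: (@lt_trans _ _ 1); rewrite ?ltr1n// invf_lt1 ?ltr0n// ltr1n.
move=> x; have [z Az zx] := mP (p x).
by have [k [kz|kz]] := same_orbitE ((pP _ _).1 (esym zx)); exists k; rewrite kz; [left|right].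
Qed.

(** The fixed points of an iterate form a closed set, which is open since [p] is locally injective.
    If it were nonempty it would be everything; all orbits would be finite of bounded length, and as
    they meet the annulus, [rho] would be bounded. *)
Lemma orbit_free n x : (0 < n)%N -> iter n f x <> x.
Proof.
move=> n0 fx; have fnc := @iter_continuous _ _ n fc.
have all_per : [set y | iter n f y = y] = setT.
  apply: Tconn; first by exists x.
  - exists [set y | iter n f y = y]; last by rewrite setTI.
    rewrite openE => y fy; have [V [oV Vy Vinj]] := covering_inj hp y.
    have nV : nbhs (iter n f y) V by rewrite fy; exact: open_nbhs_nbhs.
    have nVy : nbhs y V by exact: open_nbhs_nbhs.
    have nfV : nbhs y (iter n f @^-1` V) by exact: fnc.
    suff : nbhs y [set z | iter n f z = z] by [].
    apply: filterS2 nfV nVy => z Vfz Vz.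
    by apply: Vinj => //; exact: p_iter.
  exists [set y | iter n f y = y]; last by rewrite setTI.
  rewrite -[X in closed X]setCK closedC openE => y nfy.
  have /eqP yfy : iter n f y <> y by [].
  move: Thaus; rewrite open_hausdorff => /(_ _ _ yfy) [[V1 V2]] /=.
  rewrite !inE => -[V1fy V2y] [oV1 oV2 V12].
  have n1 : nbhs (iter n f y) V1 by exact: open_nbhs_nbhs.
  have n2 : nbhs y V2 by exact: open_nbhs_nbhs.
  have n3 : nbhs y (iter n f @^-1` V1) by exact: fnc.
  suff : nbhs y (~` [set z | iter n f z = z]) by [].
  apply: filterS2 n3 n2 => z h1 h2 fz.
  by have : (V1 `&` V2) z; [split => //; rewrite -fz|rewrite V12].
have per y : iter n f y = y by have : [set: T] y by []; rewrite -all_per.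
have permn k y : iter (k * n) f y = y by elim: k => // k IH; rewrite mulSn iterD IH per.
have [a [b [a0 ab meets]]] := orbit_meets_annulus.
have [d [M [_ dM]]] := iter_bounds rho_cont rho_gt0 n fc (annulus_compact (b := b) a0).
have [y] := rho_large M; rewrite ltNge => /negP; apply.
have red k z : a < rho z < b -> rho (iter k f z) <= M.
  move=> /andP[az zb]; rewrite (divn_eq k n) addnC iterD permn.
  by have /andP[] := dM (k %% n)%N z (ltn_pmod _ n0) (introT andP (conj (ltW az) (ltW zb))).
have [k [hk|hk]] := meets y; last by rewrite -(iterf'K k y); exact: red.
(* [y] returns after [k * n] steps, so it is reached from [iter k f y] by the remaining
   [k * n - k]. *)
rewrite -(permn k y) -(subnK (leq_pmulr k n0)) iterD; exact: red.
Qed.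

(** Distinct fibres are separated in [H]. Within a fibre, a neighbourhood on which [p] is injective
    can return to its own translate only through a periodic point, which [orbit_free] excludes. *)
Lemma covering_proper_iter : proper_iter f.
Proof.
move=> x y; have [pxy|pxy] := pselect (p x = p y); last first.
  have /eqP nxy := pxy; move: Hhaus; rewrite open_hausdorff => /(_ _ _ nxy) [[V1 V2]] /=.
  rewrite !inE => -[V1x V2y] [oV1 oV2 V12]; have [pc _ _] := hp.
  exists (p @^-1` V1), (p @^-1` V2), 0%N; split.
  - by apply: pc; exact: open_nbhs_nbhs.
  - by apply: pc; exact: open_nbhs_nbhs.
  by move=> n u _ h1; rewrite /= p_iter => h2; have : (V1 `&` V2) (p u) by []; rewrite V12.
have [V [oV Vx Vinj]] := covering_inj hp x.
have nV : nbhs x V by exact: open_nbhs_nbhs.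
have [k [kx|kx]] := same_orbitE ((pP _ _).1 pxy).
  (* The threshold [k.+1] leaves out the iterate [k], which takes [x] to [y]. *)
  exists V, (iter k f' @^-1` V), k.+1; split => //.
    by apply: (@iter_continuous _ _ k f'c y); rewrite -kx iterfK.
  move=> n u kn Vu /=; rewrite -(subnK (ltnW kn)) addnC iterD iterfK => Vfu.
  apply: (@orbit_free (n - k)%N u); first by rewrite subn_gt0.
  by apply: Vinj => //; exact: p_iter.
exists V, (iter k f @^-1` V), 1%N; split => //.
  by apply: (@iter_continuous _ _ k fc y); rewrite -kx iterf'K.
move=> n u n0 Vu /=; rewrite -iterD => Vfu.
apply: (@orbit_free (k + n)%N u); first by rewrite ltn_addl.
by apply: Vinj => //; exact: p_iter.
Qed.

End OrbitCovering.

Lemma path_connected_connected (R : realType) (X : topologicalType) : path_connected R X -> connected [set: X].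
Proof.
move=> pX; have [[x _]|X0] := pselect ([set: X] !=set0); last first.
  suff -> : setT = set0 :> set X by exact: connected0.
  by apply/seteqP; split=> // x _; apply: X0; exists x.
have [a aP] := choice (pX x).
rewrite (_ : setT = \bigcup_(y in [set: X]) (a y @` `[0, 1])).
  apply: bigcup_connected.
    exists x => y _; have [_ a0 _] := aP y; exists 0 => //; by rewrite /= in_itv /= lexx ler01.
  move=> y _; have [ac _ _] := aP y.
  by apply: connected_continuous_connected => //; exact: segment_connected.
apply/seteqP; split=> // y _; exists y => //; have [_ _ a1] := aP y; exists 1 => //.
by rewrite /= in_itv /= lexx ler01.
Qed.

(** * Lifts to the punctured plane *)

Section PuncturedPlaneMaps.
Variable R : realType.
Local Notation C := (Cplx R).
Local Notation V := (C2 R).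
Local Notation W := (W R).

Definition wval (x : W) : V := set_val x.

Lemma wval_neq0 x : wval x != 0.
Proof. by have := set_valP x. Qed.

Lemma wval_inj : injective wval.
Proof. exact: val_inj. Qed.

Lemma wval_continuous : continuous wval.
Proof. exact: initial_continuous. Qed.

(** The access to the atlas of [W]: one global chart, the inclusion into C^2. *)
Lemma W_chart : exists c : chart R W, [/\ @atlas R W = [set c], chart_dom c = setT, forall x, c x = wval x &
  forall z, z != 0 -> wval (chart_inv c z) = z].
Proof.
eexists; split; [reflexivity|reflexivity|by []|].
by move=> z z0; rewrite /= /wval set_valE insubdK// inE.
Qed.

Definition wchart : chart R W := projT1 (cid W_chart).
Definition winv (z : V) : W := chart_inv wchart z.

Lemma wchart_atlas : @atlas R W = [set wchart].
Proof. by rewrite /wchart; case: cid => c []. Qed.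

Lemma wchart_dom : chart_dom wchart = setT.
Proof. by rewrite /wchart; case: cid => c []. Qed.

Lemma wchartE x : wchart x = wval x.
Proof. by rewrite /wchart; case: cid => c []. Qed.

Lemma winvK z : z != 0 -> wval (winv z) = z.
Proof. by rewrite /winv /wchart; case: cid => c [_ _ _ h] /=; exact: h. Qed.

Lemma wvalK : cancel wval winv.
Proof. by move=> x; apply: wval_inj; rewrite winvK// wval_neq0. Qed.

Lemma near_neq0 (z : V) : z != 0 -> \forall y \near z, y != 0.
Proof. exact: near_neq. Qed.

Lemma winv_continuous z : z != 0 -> {for z, continuous winv}.
Proof.
move=> z0 A; rewrite nbhsE => -[U [[B oB BU] Uz] UA].
have Bz : nbhs z B.
  apply: open_nbhs_nbhs; split => //.
  have h : (set_val @^-1` B) (winv z) by rewrite BU.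
  by move: h; rewrite /preimage /= -[set_val _]/(wval (winv z)) winvK.
apply: filterS2 Bz (near_neq0 z0) => y By y0; apply: UA; rewrite -BU.
by rewrite /preimage /= -[set_val _]/(wval (winv y)) winvK.
Qed.

(** Filling in the origin as a fixed point gives self-maps of the normed space C^2, where
    differentials at 0 make sense. *)
Definition hat (g : W -> W) (z : V) : V := if z == 0 then 0 else wval (g (winv z)).

Lemma hat0 g : hat g 0 = 0.
Proof. by rewrite /hat eqxx. Qed.

Lemma hatE g x : hat g (wval x) = wval (g x).
Proof. by rewrite /hat (negPf (wval_neq0 x)) wvalK. Qed.

Lemma hatK g g' : cancel g g' -> cancel (hat g) (hat g').
Proof.
move=> gK z; have [->|z0] := eqVneq z 0; first by rewrite !hat0.
by rewrite -(winvK z0) !hatE gK.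
Qed.

Lemma hat_comp g g' : hat (g \o g') = hat g \o hat g'.
Proof.
apply/funext => z; have [->|z0] := eqVneq z 0; first by rewrite /= !hat0.
by rewrite -(winvK z0) /= !hatE.
Qed.

Lemma hat_iter g n : hat (iter n g) = iter n (hat g).
Proof.
elim: n => [|n IH].
  by apply/funext => z; rewrite /hat /=; case: eqVneq => // z0; rewrite winvK.
by apply/funext => z; rewrite iterS -IH; have /(congr1 (@^~ z)) := hat_comp g (iter n g).
Qed.

Lemma hat_neq0 g z : z != 0 -> hat g z != 0.
Proof. by move=> z0; rewrite /hat (negPf z0) wval_neq0. Qed.

Lemma hol_hat (f : W -> W) : holomorphic f -> forall z, z != 0 -> differentiable (hat f) z.
Proof.
move=> [_ fd] z z0.
have := fd wchart wchart; rewrite !wchart_atlas => /(_ erefl erefl (winv z)).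
rewrite wchart_dom => /(_ I I I); rewrite wchartE winvK//.
apply: near_diff; apply: filterS (near_neq0 z0) => y y0.
by rewrite /= wchartE /hat (negPf y0).
Qed.

(** Locally [g] is an inverse branch of [p] after [sigma \o p]; inserting two conjugations at the
    chart of [H] around [p y] makes all factors complex differentiable. *)
Lemma lift_antihol (H : complexSurface R) (p : W -> H) (sigma : H -> H) (g : W -> W) :
  continuous p -> locally_biholomorphic p -> antiholomorphic sigma -> continuous g ->
  p \o g = sigma \o p ->
  forall z, z != 0 -> differentiable (@conjC2 R \o hat g) z.
Proof.
move=> pc ploc [sc sd] gc pg z z0.
have pgE x : p (g x) = sigma (p x) by have := congr1 (@^~ x) pg.
pose x := winv z; pose y := g x.
have [U [oU Uy opU _ [q [_ qd] qp]]] := ploc y.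
have [U' [oU' Ux _ [_ pd] _]] := ploc x.
have [c cA cx] := atlas_cover (p x).
have [d dA dy] := atlas_cover (p y).
have wA : @atlas R W wchart by rewrite wchart_atlas.
have dA1 : differentiable (wchart \o q \o chart_inv d) (d (p y)).
  apply: qd; [exact: dA|exact: wA|by exists y|exact: dy|by rewrite wchart_dom].
have dS : differentiable (@conjC2 R \o d \o sigma \o chart_inv c) (c (p x)).
  by apply: sd => //; rewrite -pgE.
have dP : differentiable (c \o p \o chart_inv wchart) z.
  have e : wchart x = z by rewrite wchartE; exact: winvK.
  rewrite -[X in differentiable _ X]e.
  by apply: pd; [exact: wA|exact: cA|exact: Ux|rewrite wchart_dom|exact: cx].
set A := wchart \o q \o chart_inv d in dA1.
set S := _ \o _ \o sigma \o _ in dS.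
set P := c \o p \o _ in dP.
have Pz : P z = c (p x) by [].
have Sz : conjC2 (S (P z)) = d (p y).
  by rewrite /S /= Pz conjC2K chart_funK// -pgE.
have dall : differentiable ((@conjC2 R \o A \o @conjC2 R) \o (S \o P)) z.
  have dSP : differentiable (S \o P) z.
    by apply: differentiable_comp; [exact: dP|rewrite Pz; exact: dS].
  apply: differentiable_comp; first exact: dSP.
  by apply: conj_diff_conj; rewrite -[(S \o P) z]/(S (P z)) Sz; exact: dA1.
apply: near_diff dall.
have wc := winv_continuous z0.
have pwc : {for z, continuous (p \o winv)} by apply: continuous_comp; [exact: wc|exact: pc].
have gwc : {for z, continuous (g \o winv)} by apply: continuous_comp; [exact: wc|exact: gc].
have pgwc : {for z, continuous (p \o (g \o winv))} by apply: continuous_comp; [exact: gwc|exact: pc].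
have n1 : nbhs z ((p \o winv) @^-1` chart_dom c).
  by apply: pwc; apply: open_nbhs_nbhs; split => //; exact: chart_dom_open.
have n2 : nbhs z ((p \o (g \o winv)) @^-1` chart_dom d).
  by apply: pgwc; apply: open_nbhs_nbhs; split => //; exact: chart_dom_open.
have n3 : nbhs z ((g \o winv) @^-1` U) by apply: gwc; exact: open_nbhs_nbhs.
have n4 := near_neq0 z0.
have n12 := filterI n1 n2; have n34 := filterI n3 n4.
suff n5 : nbhs z [set t | (@conjC2 R \o A \o @conjC2 R) ((S \o P) t) = (@conjC2 R \o hat g) t] by exact: n5.
apply: filterS2 (n12 _) (n34 _) => t [t1 t2] [t3 t4].
rewrite /= in t1 t2 t3; rewrite /A /S /P /= -/(winv t) chart_funK// conjC2K -pgE.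
by rewrite chart_funK// qp// wchartE /hat (negPf t4).
Qed.

Definition wnorm (x : W) : R := nr (wval x).

Lemma wnorm_continuous : continuous wnorm.
Proof.
move=> x; apply: (@continuous_comp _ _ _ wval (@nr R V)); first exact: wval_continuous.
exact: nr_continuous.
Qed.

Lemma wnorm_gt0 x : 0 < wnorm x.
Proof. by rewrite nr_gt0 wval_neq0. Qed.

Lemma wnorm_onto (r : R) : 0 < r -> exists x, wnorm x = r.
Proof.
move=> r0; have z0 : c2 (r%:C)%C 0 != 0 :> V.
  by rewrite c2_eq0 negb_and -nr_gt0 nr_real normr_gt0 gt_eqF.
exists (winv (c2 (r%:C)%C 0)); rewrite /wnorm winvK//.
have nz : nr ((r%:C)%C : C) = r by rewrite nr_real gtr0_norm.
apply/eqP; rewrite eq_le; apply/andP; split.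
  by apply: nr2_le; rewrite ?fst2K ?snd2K ?nr0 ?nz// ltW.
by have := nr_fst2 (c2 (r%:C)%C 0); rewrite fst2K nz.
Qed.

Lemma wnorm_annulus_compact (a b : R) : 0 < a -> compact [set x | a <= wnorm x <= b].
Proof.
move=> a0; pose K := [set z : V | a <= nr z <= b].
have cK : compact K.
  apply: (@subclosed_compact _ _ [set z : V | nr z <= b]); last by move=> z /andP[].
    have -> : K = @nr R V @^-1` [set t | a <= t] `&` @nr R V @^-1` [set t | t <= b].
      by apply/seteqP; split=> z /=; [case/andP|move=> [h1 h2]; apply/andP].
    by apply: closedI; apply: closed_comp; rewrite ?closed_ge ?closed_le// => z _; exact: nr_continuous.
  exact: compact_ball2.
have -> : [set x | a <= wnorm x <= b] = winv @` K.
  apply/seteqP; split=> [x h|_ [z /andP[az zb] <-]].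
    by exists (wval x) => //; rewrite wvalK.
  have z0 : z != 0 by rewrite -nr_gt0 (lt_le_trans a0).
  by rewrite /= /wnorm winvK// az zb.
apply: continuous_compact => //; apply: continuous_in_subspaceT => z /set_mem /= /andP[az _].
by apply: winv_continuous; rewrite -nr_gt0 (lt_le_trans a0).
Qed.

Lemma hat_homeo0 g g' : cancel g g' -> cancel g' g -> continuous (hat g) -> continuous (hat g') ->
  homeo0 (hat g) (hat g').
Proof.
move=> gK g'K gc g'c; split; [exact: hatK|exact: hatK|exact: hat0|].
by move=> x _; split; [exact: gc|exact: g'c].
Qed.

(** Points of the ball that are large after arbitrarily many steps would cluster at some [x]; but
    near [x] some iterate enters the stability radius and stays below [e]. *)
Lemma uniform_attraction (F : V -> V) : continuous F -> F 0 = 0 ->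
  (forall e : R, 0 < e -> exists2 d : R, 0 < d & forall x n, nr x < d -> nr (iter n F x) < e) ->
  (forall x (e : R), 0 < e -> exists n, nr (iter n F x) < e) ->
  forall e : R, 0 < e -> exists N, forall x, nr x <= 1 -> nr (iter N F x) <= e.
Proof.
move=> Fc F0 stab attr e e0; apply: contrapT => nN.
pose B m := [set x : V | nr x <= 1 /\ exists2 n, (m <= n)%N & e < nr (iter n F x)].
have B0 m : B m !=set0.
  apply: contrapT => Bm; apply: nN; exists m => x x1; rewrite leNgt; apply/negP => ex.
  by apply: Bm; exists x; split => //; exists m.
have Bmono m n : (m <= n)%N -> B n `<=` B m.
  by move=> mn x [x1 [i ni h]]; split => //; exists i => //; exact: leq_trans ni.
have BK m : B m `<=` [set x | nr x <= 1] by move=> x [].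
have [x [_ cl]] := nested_cluster (@compact_ball2 R 1) B0 Bmono BK.
have [d d0 dP] := stab e e0; have [n hn] := attr x d d0.
have nx : nbhs x [set y | nr (iter n F y) < d].
  have c : {for x, continuous (fun y => nr (iter n F y))}.
    apply: (@continuous_comp _ _ _ (iter n F) (@nr R V)); last exact: nr_continuous.
    exact: (@iter_continuous _ _ n Fc).
  apply: (c [set t | t < d]); apply: open_nbhs_nbhs; split => //; exact: open_lt.
have [y [[_ [m nm em]] yd]] := cl n _ nx.
have := dP _ (m - n)%N yd; rewrite -iterD subnK// => h.
by move: em; rewrite ltNge (ltW h).
Qed.

(** The Schwarz bound needs a holomorphic map and is applied to [g \o g]; the conclusion concerns
    the linear part of [g] itself. *)
Lemma attracting_hat_conj (g g' : W -> W) : cancel g g' -> cancel g' g ->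
  continuous (hat g) -> continuous (hat g') ->
  (forall z, z != 0 -> differentiable (@conjC2 R \o hat g) z) ->
  (forall z, z != 0 -> differentiable (@conjC2 R \o hat g') z) ->
  (forall z, z != 0 -> differentiable (hat (g \o g)) z) ->
  attracting wnorm (g \o g) ->
  exists2 c : R, 0 < c < 1 & conj0 (hat g) (rscale c).
Proof.
move=> gK g'K gc g'c gd g'd ffd [stab attr].
have hh := hat_homeo0 gK g'K gc g'c.
have [M MP] := antilin_strict_diff0 gc gd; have [M' M'P] := antilin_strict_diff0 g'c g'd.
have Mu := antilin_unitmx (hatK gK) (hat0 g) gc MP M'P.
have fE : hat (g \o g) = hat g \o hat g by exact: hat_comp.
have Fc : continuous (hat g \o hat g) by move=> x; apply: continuous_comp; exact: gc.
have F0 : (hat g \o hat g) 0 = 0 by rewrite /= !hat0.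
have iterE n x : nr (iter n (hat g \o hat g) (wval x)) = wnorm (iter n (g \o g) x).
  by rewrite -fE -hat_iter hatE.
have stab' (e : R) : 0 < e -> exists2 d : R, 0 < d & forall x n, nr x < d -> nr (iter n (hat g \o hat g) x) < e.
  move=> e0; have [d d0 dP] := stab e e0; exists d => // z n zd.
  have [->|z0] := eqVneq z 0.
    by rewrite (_ : iter n _ 0 = 0) ?nr0//; elim: n => // n IH; rewrite iterS IH.
  by rewrite -(winvK z0) iterE; apply: dP; rewrite /wnorm winvK.
have attr' z (e : R) : 0 < e -> exists n, nr (iter n (hat g \o hat g) z) < e.
  move=> e0; have [->|z0] := eqVneq z 0; first by exists 0%N; rewrite nr0.
  by have [n h] := attr (winv z) e e0; exists n; rewrite -(winvK z0) iterE.
have unif := uniform_attraction Fc F0 stab' attr'.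
have fd x : x != 0 -> differentiable (hat g \o hat g) x by rewrite -fE; exact: ffd.
have [n hn] := antilin_iter_contracts ltr01 (hat0 g) gc MP (@hat_neq0 g) fd unif.
apply: (antihol_contraction_conj hh Mu MP hn) => x e e0.
have [k hk] := attr' x e e0; exists (k + k)%N.
rewrite (_ : iter (k + k) (hat g) x = iter k (hat g \o hat g) x)//.
by elim: (k) => // j IH; rewrite addnS addSn !iterS IH.
Qed.

End PuncturedPlaneMaps.

(** * The lift of an odd Real structure *)

Section OddLift.
Variable R : realType.
Local Notation C := (Cplx R).
Local Notation V := (C2 R).
Local Notation W := (W R).

(** Connectedness is transported from the universal cover of [H], which is path-connected and
    biholomorphic to W. *)
Lemma W_connected (H : complexSurface R) : primary_Hopf_surface H -> connected [set: W].
Proof.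
move=> [_ _ [E [p [[_ [pcE _]] [F [[Fc _] [G [_ _ GK]]]]]]] _].
have := connected_continuous_connected (path_connected_connected pcE) Fc.
rewrite (_ : F @` setT = setT)//.
by apply/seteqP; split=> // x _; exists (G x).
Qed.

Lemma holomorphic_continuous (X Y : complexSurface R) (F : X -> Y) : holomorphic F -> continuous F.
Proof. by move=> [Fc _]; apply/continuous_subspace_setT. Qed.

Lemma wnorm_large (r : R) : exists x : W, r < wnorm x.
Proof.
have h : 0 < `|r| + 1 by rewrite ltr_wpDl.
by have [x xr] := wnorm_onto h; exists x; rewrite xr (le_lt_trans (ler_norm r))// ltrDl.
Qed.

Lemma wnorm_small (r : R) : 0 < r -> exists x : W, wnorm x < r.
Proof.
move=> r0; have h : 0 < r / 2 by rewrite divr_gt0.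
by have [x xr] := wnorm_onto h; exists x; rewrite xr ltr_pdivrMr// ltr_pMr// ltr1n.
Qed.

Lemma hat_small (g : W -> W) (b : R) : continuous (hat g) -> 0 < b ->
  exists2 d : R, 0 < d & forall x, wnorm x < d -> wnorm (g x) <= b.
Proof.
move=> gc b0; have /cont_nrP/(_ b b0) := gc 0.
move=> [d d0 dP]; exists d => // x xd.
by rewrite /wnorm -hatE; have := dP (wval x); rewrite hat0 !sub0r !nrN => /(_ xd) /ltW.
Qed.

Lemma rscale_homeo0 (c : R) : 0 < c -> homeo0 (@rscale R c) (rscale c^-1).
Proof.
move=> c0; have c0' : c != 0 by rewrite gt_eqF.
have rc (d : R) : continuous (@rscale R d) by move=> x; exact: scaler_continuous.
split=> [x|x||x _]; last by split; exact: rc.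
- by rewrite /rscale scalerA -rmorphM mulVf// rmorph1 scale1r.
- by rewrite /rscale scalerA -rmorphM divff// rmorph1 scale1r.
- by rewrite /rscale scaler0.
Qed.

Variables (H : complexSurface R) (sigma : H -> H) (f g : W -> W) (p : W -> H).
Hypotheses (hH : primary_Hopf_surface H) (hs : real_structure sigma).
Hypotheses (hfp : Hopf_presentation f p) (gc : continuous g).
Hypotheses (pg : p \o g = sigma \o p) (ggf : g \o g = f).

Let hcov : covering_map p.
Proof. by have [_ []] := hfp. Qed.

Let pP x y : p x = p y <-> same_orbit f x y.
Proof. by have [_ _] := hfp. Qed.

(** [g] commutes with its square [f], so [g \o f'] is a two-sided inverse, and its own square is
    [f']. *)
Lemma odd_lift_inverse : exists g' : W -> W, [/\ cancel g g', cancel g' g, continuous g',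
  p \o g' = sigma \o p & holomorphic (g' \o g')].
Proof.
have [[_ [f' [f'h fK f'K]]] _ _] := hfp.
have gf x : g (f x) = f (g x) by rewrite -ggf.
have gf' x : g (f' x) = f' (g x) by apply: (can_inj fK); rewrite -gf !f'K.
have fE x : f x = g (g x) by rewrite -ggf.
have gK : cancel g (g \o f') by move=> x; rewrite /= gf' -gf' gf' -fE fK.
exists (g \o f'); split.
- exact: gK.
- by move=> x; rewrite /= -fE f'K.
- by move=> x; apply: continuous_comp; [exact: (holomorphic_continuous f'h)|exact: gc].
- apply/funext => x /=.
  have /(congr1 (@^~ (f' x))) /= -> := pg; congr sigma.
  by apply/pP; exists 1%N, 0%N => /=; rewrite f'K.
- rewrite (_ : _ \o _ = f')//; apply/funext => x /=.
  by rewrite gf' -fE f'K.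
Qed.

Lemma odd_orbit_free n x : (0 < n)%N -> iter n f x <> x.
Proof.
have [[fh [f' [f'h fK f'K]]] _ _] := hfp.
have [Hc _ _ _] := hH.
exact: (orbit_free (@wnorm_continuous R) (@wnorm_gt0 R) (@wnorm_annulus_compact R) wnorm_large
  (W_connected hH) (@csurf_hausdorff _ W) Hc (holomorphic_continuous fh) fK f'K hcov pP).
Qed.

(** Both [f] and [f'] are squares of antiholomorphic lifts, so one argument serves attraction and
    repulsion. In the second case it conjugates [g'], and inverting yields a factor [c^-1 > 1]. *)
Lemma odd_lift_conj : exists2 c : R, 0 < c /\ c != 1 & conj0 (hat g) (rscale c).
Proof.
have [fb [_ plb] _] := hfp; have [fh [f' [f'h fK f'K]]] := fb.
have [g' [gK g'K g'c pg' g'g'h]] := odd_lift_inverse.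
have [Hc _ _ _] := hH.
have ac := wnorm_annulus_compact.
have [a [b [a0 ab meets]]] := orbit_meets_annulus (@wnorm_continuous R) (@wnorm_gt0 R) Hc fK hcov pP.
have pr := covering_proper_iter (@wnorm_continuous R) (@wnorm_gt0 R) (@wnorm_annulus_compact R)
  wnorm_large (W_connected hH) (@csurf_hausdorff _ W) (@csurf_hausdorff _ H) Hc
  (holomorphic_continuous fh) (holomorphic_continuous f'h) fK f'K hcov pP.
have pc : continuous p by have [] := hcov.
have [sah _] := hs.
have gd := lift_antihol pc plb sah gc pg.
have g'd := lift_antihol pc plb sah g'c pg'.
have hgc := antihol_continuous (hatK gK) (hatK g'K) (hat0 g) gd g'd.
have hg'c := antihol_continuous (hatK g'K) (hatK gK) (hat0 g') g'd gd.
have f'E : f' = g' \o g'.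
  by apply/funext => x; apply: (can_inj fK); rewrite f'K -ggf /= !g'K.
have comp_c (k : W -> W) : continuous (hat k) -> continuous (hat (k \o k)).
  by move=> kc; rewrite hat_comp => x; apply: continuous_comp; exact: kc.
have b0 : 0 < b by apply: lt_trans ab.
have [d1 d10 dP1] := hat_small (comp_c g hgc) b0.
have [d2 d20 dP2] := hat_small (comp_c g' hg'c) b0.
rewrite ggf in dP1; rewrite -f'E in dP2.
(* The extensions of [f] and [f'] are continuous at 0, so points this close to 0 are not thrown
   across the annulus. *)
pose r0 := Num.min a (Num.min d1 d2).
have r00 : 0 < r0 by rewrite /r0 !lt_min a0 d10 d20.
have r0a : r0 <= a by rewrite /r0 ge_min lexx.
have sf x : wnorm x < r0 -> wnorm (f x) <= b.
  by rewrite /r0 !lt_min => /andP[_ /andP[h _]]; exact: dP1.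
have sf' x : wnorm x < r0 -> wnorm (f' x) <= b.
  by rewrite /r0 !lt_min => /andP[_ /andP[_ h]]; exact: dP2.
have [af|af] := attracting_or_repelling (@wnorm_continuous R) (@wnorm_gt0 R)
  (@wnorm_annulus_compact R) wnorm_large wnorm_small (W_connected hH)
  (holomorphic_continuous fh) (holomorphic_continuous f'h) fK f'K pr a0 ab r00 r0a meets sf sf'.
- rewrite -ggf in af fh; have [c /andP[c0 c1] gc'] := attracting_hat_conj gK g'K hgc hg'c gd g'd (hol_hat fh) af.
  by exists c => //; rewrite c0 lt_eqF.
- rewrite f'E in af; have [c /andP[c0 c1] gc'] := attracting_hat_conj g'K gK hg'c hgc g'd gd (hol_hat g'g'h) af.
  exists c^-1; first by rewrite invr_gt0 c0 invr_eq1 lt_eqF.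
  apply: (conj0_inv (hat_homeo0 gK g'K hgc hg'c) _ gc').
  by apply: homeo0_sym; apply: rscale_homeo0.
Qed.

End OddLift.

(** * Spherical coordinates *)

Section SphericalCoordinates.
Variable R : realType.
Local Notation C := (Cplx R).
Local Notation V := (C2 R).
Local Notation W := (W R).

(** By duplication cos s = 1 - 2 sin (s / 2) ^ 2, and for s > 0 the half-angle lies strictly between
    0 and pi. *)
Lemma cos_eq1 (s : R) : 0 <= s < pi *+ 2 -> cos s = 1 -> s = 0.
Proof.
move=> /andP[s0 s2] cs; apply/eqP; rewrite eq_le s0 andbT leNgt; apply/negP => sp.
have h : 0 < sin (s / 2).
  by rewrite sin_gt0_pi// divr_gt0//= ltr_pdivrMr// mulr_natr.
have : cos (s / 2 *+ 2) = 1 by rewrite -[_ *+ 2]mulr_natr divfK.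
by rewrite cos_mulr2n cos2sin2 => e; have := exprn_gt0 2 h; lra.
Qed.

Lemma cos_sin_eq (a b : R) : cos a = cos b -> sin a = sin b ->
  exists n : nat, a = b + pi *+ 2 *+ n \/ b = a + pi *+ 2 *+ n.
Proof.
wlog ba : a b / b <= a => [wl ec es|ec es].
  have [ba|/ltW ab] := leP b a; first exact: wl.
  by have [n []] := wl _ _ ab (esym ec) (esym es); exists n; [right|left].
have p2 : 0 < pi *+ 2 :> R by rewrite pmulrn_lgt0// pi_gt0.
have t0 : 0 <= (a - b) / (pi *+ 2) by rewrite divr_ge0 ?(ltW p2)// subr_ge0.
have /andP[n1 n2] := Num.Theory.truncn_itv t0; set n := Num.truncn _ in n1 n2.
exists n; left; apply/eqP; rewrite addrC -subr_eq -subr_eq0; apply/eqP.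
apply: cos_eq1.
  move: n1 n2; rewrite ler_pdivlMr// ltr_pdivrMr// !mulr_natl => n1 n2.
  by rewrite subr_ge0 n1/= ltrBlDr -mulrS.
rewrite -(periodicn (@cosD2pi R) n) subrK cosB ec es -!expr2 -[RHS](cos2Dsin2 b) //.
Qed.

Lemma circle_param (x y : R) : x ^+ 2 + y ^+ 2 = 1 -> exists t, cos t = x /\ sin t = y.
Proof.
move=> xy; have x1 : -1 <= x <= 1.
  by rewrite -ler_norml -(@ler_sqr _ `|x|) ?nnegrE// real_normK ?num_real// expr1n -xy lerDl sqr_ge0.
have cx : cos (acos x) = x by rewrite acosK// in_itv.
have sx : sin (acos x) = `|y| by rewrite sin_acos// -xy addrAC subrr add0r sqrtr_sqr.
have [y0|y0] := leP 0 y; first by exists (acos x); rewrite sx ger0_norm.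
by exists (- acos x); rewrite cosN sinN sx ltr0_norm// opprK.
Qed.

Definition rv (z : V) : 'rV[R]_4 := \row_i
  nth 0 [:: complex.Re (fst2 z); complex.Im (fst2 z); complex.Re (snd2 z); complex.Im (snd2 z)] i.

Definition vr (v : 'rV[R]_4) : V := c2 (v ord0 (inord 0) +i* v ord0 (inord 1))%C
  (v ord0 (inord 2) +i* v ord0 (inord 3))%C.

Lemma rvK : cancel rv vr.
Proof.
by move=> z; rewrite /vr /rv !mxE !inordK//=; apply: c2P; rewrite ?fst2K ?snd2K;
  [case: (fst2 z)|case: (snd2 z)].
Qed.

Lemma vrK : cancel vr rv.
Proof.
move=> v; apply/rowP => i; rewrite !mxE fst2K snd2K.
rewrite -[in RHS](inord_val i); case: i => [[|[|[|[|]]]] ?] //=.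
Qed.

Lemma rvZ (c : R) z : rv (rscale c z) = c *: rv z.
Proof.
apply/rowP => i; rewrite !mxE /rscale fst2Z snd2Z.
have Z (w : C) : complex.Re ((c%:C)%C * w) = c * complex.Re w /\
  complex.Im ((c%:C)%C * w) = c * complex.Im w.
  by case: w => x y /=; rewrite !mul0r subr0 addr0.
have [-> ->] := Z (fst2 z); have [-> ->] := Z (snd2 z).
by case: i => [[|[|[|[|]]]] ?].
Qed.

Lemma rv_continuous (i : 'I_4) : continuous (fun z => rv z ord0 i).
Proof.
have cR (h : V -> C) : continuous h -> continuous (@complex.Re R \o h).
  by move=> hc z; apply: continuous_comp; [exact: hc|exact: Re_continuous].
have cI (h : V -> C) : continuous h -> continuous (@complex.Im R \o h).
  by move=> hc z; apply: continuous_comp; [exact: hc|exact: Im_continuous].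
case: i => [[|[|[|[|//]]]] i4]; under eq_fun do rewrite mxE /=.
- exact: (cR _ (@fst2_continuous R)).
- exact: (cI _ (@fst2_continuous R)).
- exact: (cR _ (@snd2_continuous R)).
- exact: (cI _ (@snd2_continuous R)).
Qed.

Lemma row_continuous_at (T : topologicalType) n (F : T -> 'rV[R]_n) x :
  (forall i, {for x, continuous (fun y => F y ord0 i)}) -> {for x, continuous F}.
Proof.
move=> Fi A /nbhs_ballP[e /= e0 eA].
have : nbhs x (fun y => forall i : 'I_n, ball (F x ord0 i) e (F y ord0 i)).
  apply: filter_forall => i; apply: (Fi i); exact: nbhsx_ballx.
by apply: filterS => y h; apply: eA; split => // i j; rewrite ord1; exact: h.
Qed.

Lemma continuous_at_ext (T U : topologicalType) (f h : T -> U) x : f =1 h ->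
  {for x, continuous f} -> {for x, continuous h}.
Proof. by move=> /funext <-. Qed.

Lemma pair_continuous_at (T U1 U2 : topologicalType) (f1 : T -> U1) (f2 : T -> U2) x :
  {for x, continuous f1} -> {for x, continuous f2} -> {for x, continuous (fun y => (f1 y, f2 y))}.
Proof. by move=> h1 h2; exact: (cvg_pair h1 h2). Qed.

(** [nr] on C^2 is a sup norm, whereas the spheres are Euclidean. *)
Definition eucl (z : V) : R := Num.sqrt (\sum_i rv z ord0 i ^+ 2).

Lemma eucl_sqr z : eucl z ^+ 2 = \sum_i rv z ord0 i ^+ 2.
Proof. by rewrite sqr_sqrtr// sumr_ge0// => i _; rewrite sqr_ge0. Qed.

Lemma eucl_gt0 z : z != 0 -> 0 < eucl z.
Proof.
move=> z0; rewrite sqrtr_gt0 lt_neqAle sumr_ge0 ?andbT; last by move=> i _; rewrite sqr_ge0.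
apply: contra z0 => /eqP/esym/psumr_eq0P h.
have h0 i : rv z ord0 i = 0 by apply/eqP; rewrite -sqrf_eq0 h// => j _; rewrite sqr_ge0.
rewrite -(rvK z) /vr !h0; apply/eqP/c2P; rewrite ?fst2K ?snd2K /fst2 /snd2 mxE //.
Qed.

Lemma euclZ (c : R) z : 0 <= c -> eucl (rscale c z) = c * eucl z.
Proof.
move=> c0; rewrite /eucl rvZ; under eq_bigr do rewrite mxE exprMn.
by rewrite -mulr_sumr sqrtrM ?sqr_ge0// sqrtr_sqr ger0_norm.
Qed.

Lemma eucl_continuous : continuous eucl.
Proof.
move=> z; apply: (@continuous_comp _ _ _ _ (@Num.sqrt R)); last exact: sqrt_continuous.
have sc i : {for z, continuous (fun z => rv z ord0 i ^+ 2)}.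
  apply: (@continuous_comp _ _ _ (fun z => rv z ord0 i) (fun t : R => t ^+ 2)); first exact: rv_continuous.
  exact: exprn_continuous.
pose s i z := rv z ord0 i ^+ 2.
apply: (@continuous_at_ext _ _ (fun z => s ord0 z + (s (lift ord0 ord0) z +
  (s (lift ord0 (lift ord0 ord0)) z + s (lift ord0 (lift ord0 (lift ord0 ord0))) z)))).
  by move=> y; rewrite !big_ord_recl big_ord0 addr0.
by do 3 (apply: continuousD; first exact: sc); exact: sc.
Qed.

Definition circ (t : R) : 'rV[R]_2 := \row_i nth 0 [:: cos t; sin t] i.

Lemma circ_sphere t : sphere R 1 (circ t).
Proof. by rewrite /sphere /= !big_ord_recl big_ord0 !mxE /= addr0 cos2Dsin2. Qed.

Definition dir (z : V) : 'rV[R]_4 := (eucl z)^-1 *: rv z.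

Lemma dir_sphere z : z != 0 -> sphere R 3 (dir z).
Proof.
move=> z0; rewrite /sphere /dir /=; under eq_bigr do rewrite mxE exprMn.
by rewrite -mulr_sumr -eucl_sqr -exprMn mulVf ?expr1n// gt_eqF ?eucl_gt0.
Qed.

Definition to1 (t : R) : sphere R 1 := exist _ (circ t) (mem_set (circ_sphere t)).
Definition to3 (x : W) : sphere R 3 := exist _ (dir (wval x)) (mem_set (dir_sphere (wval_neq0 x))).

Lemma sphere_continuous n (T : topologicalType) (F : T -> sphere R n) :
  continuous (fun x => set_val (F x) : 'rV[R]_n.+1) -> continuous F.
Proof. by move=> Fc; apply: continuous_comp_initial. Qed.

Variable c : R.
Hypotheses (c0 : 0 < c) (c1 : c != 1).

Let lnc : ln c != 0. Proof. by rewrite ln_eq0. Qed.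

(** Dividing by [ln c] makes multiplication by [c] a full turn, whether [c] is below or above 1. *)
Definition angle (z : V) : R := pi *+ 2 * (ln (eucl z) / ln c).
Definition spherical (x : W) : (sphere R 1 * sphere R 3)%type := (to1 (angle (wval x)), to3 x).
Definition wscale (x : W) : W := winv (rscale c (wval x)).

Lemma wval_wscale x : wval (wscale x) = rscale c (wval x).
Proof. by rewrite winvK// -nr_gt0 nr_rscale mulr_gt0 ?normr_gt0 ?gt_eqF// nr_gt0 wval_neq0. Qed.

Lemma spherical_continuous : continuous spherical.
Proof.
move=> x; have ewc : {for x, continuous (eucl \o @wval R)}.
  by apply: continuous_comp; [exact: wval_continuous|exact: eucl_continuous].
have e0 : 0 < eucl (wval x) by rewrite eucl_gt0// wval_neq0.
apply: (@pair_continuous_at _ _ _ (to1 \o (angle \o @wval R)) to3).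
  have h1 : continuous to1.
    apply: sphere_continuous => t; apply: row_continuous_at => i.
    case: i => [[|[|//]] i2].
      by apply: (@continuous_at_ext _ _ (@cos R)) => [y|]; [rewrite mxE|exact: continuous_cos].
    by apply: (@continuous_at_ext _ _ (@sin R)) => [y|]; [rewrite mxE|exact: continuous_sin].
  apply: (@continuous_comp _ _ _ (angle \o @wval R) to1); last exact: h1.
  apply: (@continuous_comp _ _ _ (eucl \o @wval R) (fun t : R => pi *+ 2 * (ln t / ln c))) => //.
  by apply: cvgMr; apply: cvgMl; apply: continuous_ln.
have : continuous to3; last exact.
apply: sphere_continuous => y; apply: row_continuous_at => i.
apply: (@continuous_at_ext _ _ (fun y : W => (eucl (wval y))^-1 * rv (wval y) ord0 i)).
  by move=> t; rewrite -[set_val (to3 t)]/(dir (wval t)) [RHS]mxE.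
apply: continuousM.
  apply: continuousV; first by rewrite gt_eqF// eucl_gt0// wval_neq0.
  by apply: continuous_comp; [exact: wval_continuous|exact: eucl_continuous].
by apply: (@continuous_comp _ _ _ (@wval R) (fun z => rv z ord0 i)); [exact: wval_continuous|exact: rv_continuous].
Qed.

Lemma spherical_surj u : exists x, spherical x = u.
Proof.
case: u => -[u uP] [v vP].
have /set_mem := uP; rewrite /sphere /= !big_ord_recl big_ord0 addr0 => /circle_param[t [ct st]].
have vS := set_mem vP.
(* The radius whose angle is [t], from [ln r / ln c = t / (2 pi)]. *)
pose r := expR (t / (pi *+ 2) * ln c).
have r0 : 0 < r by rewrite expR_gt0.
have ev : eucl (vr v) = 1.
  by rewrite /eucl vrK; move: vS; rewrite /sphere /= => ->; rewrite sqrtr1.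
have er : eucl (rscale r (vr v)) = r by rewrite euclZ ?(ltW r0)// ev mulr1.
have z0 : rscale r (vr v) != 0.
  apply: contraTneq r0 => h; rewrite -er h.
  by rewrite (_ : 0 = rscale 0 0) ?euclZ ?mul0r ?ltxx// /rscale scaler0.
exists (winv (rscale r (vr v))).
congr pair; apply: val_inj => /=.
  have -> : angle (wval (winv (rscale r (vr v)))) = t.
    by rewrite winvK// /angle er expRK mulfK// mulrCA divff ?mulr1// gt_eqF// pmulrn_lgt0// pi_gt0.
  apply/rowP => i; rewrite mxE; case: i => [[|[|//]] i2] /=; rewrite ?ct ?st; congr (u _ _); exact: val_inj.
by rewrite winvK// /dir er rvZ vrK scalerA mulVf ?scale1r// gt_eqF.
Qed.

Lemma spherical_wscale x : spherical (wscale x) = spherical x.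
Proof.
have e0 : 0 < eucl (wval x) by rewrite eucl_gt0// wval_neq0.
congr pair; apply: val_inj => /=; rewrite wval_wscale.
  rewrite /circ /angle euclZ ?(ltW c0)// lnM ?posrE// [(ln c + _) / _]mulrDl divff// [_ * (1 + _)]mulrDr mulr1 addrC.
  by rewrite sinD2pi cosD2pi.
by rewrite /dir euclZ ?(ltW c0)// rvZ scalerA invfM mulrAC mulVf ?gt_eqF// mul1r.
Qed.

(** The angle determines the Euclidean norm up to a power of [c], and the direction determines the
    rest. *)
Lemma spherical_eq_le x y n :
  angle (wval x) = angle (wval y) + pi *+ 2 *+ n -> to3 x = to3 y -> x = iter n wscale y.
Proof.
move=> ea e3; apply: wval_inj.
have p2 : (pi *+ 2 : R) != 0 by rewrite gt_eqF// pmulrn_lgt0// pi_gt0.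
have ex : 0 < eucl (wval x) by rewrite eucl_gt0// wval_neq0.
have ey : 0 < eucl (wval y) by rewrite eucl_gt0// wval_neq0.
have itE : wval (iter n wscale y) = rscale (c ^+ n) (wval y).
  elim: n {ea} => [|n IH]; first by rewrite expr0 /rscale rmorph1 scale1r.
  by rewrite iterS wval_wscale IH /rscale scalerA -rmorphM exprS.
have eE : eucl (wval x) = c ^+ n * eucl (wval y).
  apply: ln_inj; rewrite ?posrE ?mulr_gt0 ?exprn_gt0// lnM ?posrE ?exprn_gt0// lnXn//.
  have e : ln (eucl (wval x)) / ln c = ln (eucl (wval y)) / ln c + n%:R.
    by apply: (mulfI p2); move: ea; rewrite /angle => ->; rewrite [RHS]mulrDr mulr_natr.
  by apply: (mulIf (invr_neq0 lnc)); rewrite e [RHS]mulrDl -[ln c *+ n]mulr_natl mulfK// addrC.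
rewrite itE; apply: (can_inj rvK); rewrite rvZ.
have := congr1 (fun u => sval u) e3; rewrite /= /dir => /(congr1 (fun v => eucl (wval x) *: v)).
rewrite !scalerA divff ?gt_eqF// scale1r => ->.
by rewrite eE mulfK// gt_eqF.
Qed.

Lemma spherical_eq x y : spherical x = spherical y <-> same_orbit wscale x y.
Proof.
split=> [[e1 e3]|[m [n e]]].
  have ec : cos (angle (wval x)) = cos (angle (wval y)).
    by have /rowP/(_ ord0) := e1; rewrite !mxE.
  have es : sin (angle (wval x)) = sin (angle (wval y)).
    by have /rowP/(_ (lift ord0 ord0)) := e1; rewrite !mxE.
  have e3' : to3 x = to3 y by exact: val_inj.
  have [n [h|h]] := cos_sin_eq ec es.
    by exists 0%N, n; rewrite /= (spherical_eq_le h e3').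
  by exists n, 0%N; rewrite /= -(spherical_eq_le h (esym e3')).
have it k z : spherical (iter k wscale z) = spherical z.
  by elim: k => // k IH; rewrite iterS spherical_wscale.
by rewrite -(it m) e it.
Qed.

(** The fibres of [spherical] are the orbits of [wscale]; composition with the conjugacy turns them
    into orbits of [g]. *)
Lemma odd_lift_spheres (g : W -> W) : conj0 (hat g) (rscale c) ->
  exists Th : W -> (sphere R 1 * sphere R 3)%type, [/\ continuous Th,
    forall u, exists x, Th x = u & forall x y, Th x = Th y <-> same_orbit g x y].
Proof.
move=> [F [F' [FP Fg]]]; have [FK F'K _ Fc] := FP.
pose Ph x := winv (F (wval x)).
have Fn0 x : F (wval x) != 0 by apply: (homeo0_neq0 FP); exact: wval_neq0.
have Phv x : wval (Ph x) = F (wval x) by rewrite winvK.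
have Phg x : Ph (g x) = wscale (Ph x).
  by apply: wval_inj; rewrite wval_wscale !Phv -hatE Fg.
have Phi : injective Ph.
  by move=> x y /(congr1 (@wval R)); rewrite !Phv => /(can_inj FK) /wval_inj.
have Phit n x : Ph (iter n g x) = iter n wscale (Ph x).
  by elim: n => // n IH; rewrite !iterS Phg IH.
exists (spherical \o Ph); split.
- move=> x; apply: continuous_comp; last exact: spherical_continuous.
  apply: (@continuous_comp _ _ _ (F \o @wval R) (@winv R)); last by apply: winv_continuous; exact: Fn0.
  apply: continuous_comp; first exact: wval_continuous.
  exact: (proj1 (Fc _ (wval_neq0 x))).
- move=> u; have [y <-] := spherical_surj u.
  have F'n0 : F' (wval y) != 0 by apply: (homeo0_neq0 (homeo0_sym FP)); exact: wval_neq0.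
  exists (winv (F' (wval y))); rewrite /=; congr spherical; apply: wval_inj.
  by rewrite Phv winvK// F'K.
- move=> x y /=; rewrite spherical_eq; split=> -[m [n e]]; exists m, n.
    by apply: Phi; rewrite !Phit.
  by rewrite -!Phit e.
Qed.

End SphericalCoordinates.

(** * Orbit spaces of free involutions *)

Lemma hausdorff_sep (T : topologicalType) (x y : T) : hausdorff_space T -> x <> y ->
  exists A B : set T, [/\ open A, open B, A x, B y & forall z, A z -> ~ B z].
Proof.
rewrite open_hausdorff => hT /eqP/hT[[A B] /= [/set_mem Ax /set_mem By] [oA oB /eqP AB]].
by exists A, B; split => // z Az Bz; have : (A `&` B) z by []; rewrite AB.
Qed.

Lemma injective_hausdorff (X Y : topologicalType) (f : X -> Y) : hausdorff_space Y ->
  continuous f -> injective f -> hausdorff_space X.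
Proof.
move=> hY fc fi x y xy; apply: fi; apply: hY => A B Ax By.
by have [z [Az Bz]] := xy _ _ (fc x A Ax) (fc y B By); exists (f z).
Qed.

Lemma compact_hausdorff_homeo (X Y : topologicalType) (f : X -> Y) : compact [set: X] ->
  hausdorff_space Y -> continuous f -> injective f -> (forall y, exists x, f x = y) -> homeomorphism f.
Proof.
move=> cX hY fc fi fs; split => //.
pose g y := projT1 (cid (fs y)); have gK y : f (g y) = y by rewrite /g; case: cid.
exists g; split => [|x|]; [|by apply: fi; rewrite gK|exact: gK].
apply/continuous_closedP => A cA.
have -> : g @^-1` A = f @` A.
  apply/seteqP; split=> [y Ay|_ [x Ax <-]]; first by exists (g y).
  by rewrite /preimage /= (_ : g (f x) = x)//; apply: fi; rewrite gK.
apply: compact_closed => //; apply: continuous_compact; first exact: continuous_subspaceT.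
exact: (subclosed_compact cA cX).
Qed.

Lemma closed_equalizer (X Y : topologicalType) (f h : X -> Y) : hausdorff_space Y ->
  continuous f -> continuous h -> closed [set x | f x = h x].
Proof.
move=> hY fc hc; rewrite -[X in closed X]setCK; apply: open_closedC.
rewrite openE => x /= fhx; have [A [B [oA oB Ax Bx AB]]] := hausdorff_sep hY fhx.
have nA : nbhs x (f @^-1` A) by apply: fc; exact: open_nbhs_nbhs.
have nB : nbhs x (h @^-1` B) by apply: hc; exact: open_nbhs_nbhs.
have : nbhs x (f @^-1` A `&` h @^-1` B) by exact: filterI.
by apply: filterS => y [/= Ay By] e; apply: (AB _ Ay); rewrite e.
Qed.

Lemma orbit_projP (T : topologicalType) (f : T -> T) (x y : T) :
  orbit_proj f x = orbit_proj f y <-> same_orbit f x y.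
Proof. by split=> [/eqmodP/asboolP //|h]; apply/eqmodP/asboolP. Qed.

Lemma orbit_proj_onto (T : topologicalType) (f : T -> T) (q : orbit_space f) :
  exists x, orbit_proj f x = q.
Proof. by exists (repr q); exact: reprK. Qed.

Lemma orbit_space_continuous (T Z : topologicalType) (f : T -> T) (h : orbit_space f -> Z) :
  continuous (h \o orbit_proj f) -> continuous h.
Proof. by move=> hc; apply/quotient_continuous. Qed.

Lemma orbit_space_open (T : topologicalType) (f : T -> T) (A : set (orbit_space f)) :
  open (orbit_proj f @^-1` A) -> open A.
Proof. by []. Qed.

Lemma orbit_proj_continuous (T : topologicalType) (f : T -> T) : continuous (orbit_proj f).
Proof. exact: pi_continuous. Qed.

Section Involution.
Variables (X : topologicalType) (s : X -> X).
Hypotheses (sc : continuous s) (sK : involutive s).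

Lemma involution_orbit x y : orbit_proj s x = orbit_proj s y <-> y = x \/ y = s x.
Proof.
have it n z : iter n s z = if odd n then s z else z.
  by elim: n => //= n ->; case: odd => //=; rewrite sK.
rewrite orbit_projP; split=> [[m [n]]|[->|->]]; last 2 first.
- by exists 0%N, 0%N.
- by exists 1%N, 0%N.
rewrite !it; case: odd; case: odd => e.
- by left; rewrite -(sK y) -e sK.
- by right.
- by right; rewrite e sK.
- by left.
Qed.

Lemma preimage_orbit_image A : orbit_proj s @^-1` (orbit_proj s @` A) = A `|` s @^-1` A.
Proof.
apply/seteqP; split=> [x [y Ay /involution_orbit[->|->]]|x [Ax|Ax]].
- by left.
- by right; rewrite /preimage /= sK.
- by exists x.
- by exists (s x) => //; apply/involution_orbit; right; rewrite sK.
Qed.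

Lemma orbit_proj_open A : open A -> open (orbit_proj s @` A).
Proof.
move=> oA; apply: orbit_space_open; rewrite preimage_orbit_image.
by apply: openU => //; apply: open_comp => // x _; exact: sc.
Qed.

Hypotheses (hX : hausdorff_space X) (s_free : forall x, s x <> x).

(** [V] contains at most one point of each orbit; choosing it is continuous because [orbit_proj s]
    is open. *)
Lemma orbit_section (V : set X) : open V -> (forall x, V x -> ~ V (s x)) ->
  exists t : orbit_space s -> X, [/\ {within orbit_proj s @` V, continuous t},
    forall y, (orbit_proj s @` V) y -> V (t y),
    forall y, (orbit_proj s @` V) y -> orbit_proj s (t y) = y &
    forall x, V x -> t (orbit_proj s x) = x].
Proof.
move=> oV Vs.
(* Outside the image of [V] any preimage serves as default. *)
pose t (q : orbit_space s) : X := if pselect (exists2 x, V x & orbit_proj s x = q) is left h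
  then projT1 (cid2 h) else projT1 (cid (orbit_proj_onto q)).
have tP q : (orbit_proj s @` V) q -> V (t q) /\ orbit_proj s (t q) = q.
  by rewrite /t; case: pselect => [h _|nh h]; [case: cid2|case: nh].
have tK x : V x -> t (orbit_proj s x) = x.
  move=> Vx; have Vq : (orbit_proj s @` V) (orbit_proj s x) by exists x.
  have [Vt /involution_orbit h] := tP _ Vq.
  by case: h => [//|xE]; case: (Vs _ Vt); rewrite -xE.
exists t; split => [|y /tP[]|y /tP[]|] //.
apply: continuous_in_subspaceT => q /set_mem [x Vx <-] O.
rewrite tK// nbhsE => -[B [oB Bx] BO].
have n : nbhs (orbit_proj s x) (orbit_proj s @` (B `&` V)).
  by apply: open_nbhs_nbhs; split; [apply: orbit_proj_open; exact: openI|exists x].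
apply: filterS n => _ [y [By Vy] <-].
by rewrite /preimage /= tK//; exact: BO.
Qed.

Lemma free_involution_double_cover : double_cover (orbit_proj s).
Proof.
split; last first.
  move=> b; have [x <-] := orbit_proj_onto b; exists x, (s x); split.
    by move=> e; exact: (s_free (esym e)).
  apply/seteqP; split=> y /=; first by move/esym/involution_orbit.
  by move=> h; apply/esym/involution_orbit.
split=> [|b|b]; [exact: orbit_proj_continuous|exact: orbit_proj_onto|].
have [x <-] := orbit_proj_onto b.
have xsx : x <> s x by move=> e; exact: (s_free (esym e)).
have [A [B [oA oB Ax Bx AB]]] := hausdorff_sep hX xsx.
(* Shrinking [A] in this way makes [V] disjoint from its translate [V']; these are the two
   sheets. *)
pose V := A `&` s @^-1` B; pose V' := s @^-1` V.
have oV : open V by apply: openI => //; apply: open_comp => // z _; exact: sc.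
have oV' : open V' by apply: open_comp => // z _; exact: sc.
have VV' z : V z -> ~ V' z by move=> [Az Bz] [/AB].
have Vs z : V z -> ~ V (s z) by exact: VV'.
have V's z : V' z -> ~ V' (s z) by rewrite /V' /preimage /= sK => h /VV'; apply; rewrite /V' /preimage.
have imV' : orbit_proj s @` V' = orbit_proj s @` V.
  apply/seteqP; split=> _ [z Vz <-]; exists (s z) => //.
  - by apply/involution_orbit; right; rewrite sK.
  - by rewrite /V' /preimage /= sK.
  - by apply/involution_orbit; right; rewrite sK.
exists (orbit_proj s @` V), [set V; V']; split.
- exact: orbit_proj_open.
- by exists x.
- move=> D E /= [->|->] [->|->] [z [h1 h2]] //; [by case: (VV' _ h1)|by case: (VV' _ h2)].
- rewrite preimage_orbit_image; apply/seteqP; split=> z.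
    by move=> [h|h]; [exists V => //; left|exists V' => //; right].
  by move=> [D /= [->|->] h]; [left|right].
move=> D /= [->|->]; split => //; first exact: orbit_section.
by have := orbit_section oV' V's; rewrite imV'.
Qed.

Lemma free_involution_deck : deck_transformation (orbit_proj s) s.
Proof.
split; first by split => //; exists s.
by apply/funext => x /=; apply/esym/involution_orbit; right.
Qed.

(** At each point a deck transformation is the identity or [s]. Both alternatives hold on closed
    sets, disjoint by freeness, so connectedness leaves only one. *)
Lemma free_involution_deck_unique (t : X -> X) : connected [set: X] ->
  deck_transformation (orbit_proj s) t -> t <> id -> t = s.
Proof.
move=> cX [[tc _] pt] tid.
have tE x : t x = x \/ t x = s x.
  by apply/involution_orbit; have /(congr1 (@^~ x)) := pt.
have [[x0 x0E]|nx] := pselect (exists x, t x = x); last first.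
  apply/funext => x; have [e|//] := tE x.
  by case: nx; exists x.
exfalso; apply: tid; apply/funext => x.
have idc : continuous (@id X) by move=> ?; exact: cvg_id.
have c1 : closed [set x | t x = x] by exact: (closed_equalizer hX tc idc).
have o1 : open [set x | t x = x].
  rewrite (_ : [set _ | _] = ~` [set x | t x = s x]).
    by apply: closed_openC; exact: closed_equalizer.
  apply/seteqP; split=> y /=; first by move=> -> /esym; exact: s_free.
  by have [] := tE y.
have h : [set x | t x = x] = setT.
  apply: cX; first by exists x0.
    by exists [set x | t x = x]; rewrite ?setTI.
  by exists [set x | t x = x]; rewrite ?setTI.
by have : [set: X] x by []; rewrite -h.
Qed.

End Involution.

Lemma sphere_prod_hausdorff (R : realType) m n : hausdorff_space (sphere R m * sphere R n)%type.
Proof.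
pose F (u : (sphere R m * sphere R n)%type) : 'rV[R]_m.+1 * 'rV[R]_n.+1 := (set_val u.1, set_val u.2).
apply: (@injective_hausdorff _ _ F); first exact: norm_hausdorff.
  move=> u; apply: (@pair_continuous_at _ _ _ (set_val \o fst) (set_val \o snd)).
    by apply: continuous_comp; [exact: cvg_fst|exact: initial_continuous].
  by apply: continuous_comp; [exact: cvg_snd|exact: initial_continuous].
by move=> [u v] [u' v'] [/val_inj -> /val_inj ->].
Qed.

(** [Th] descends to a bijection, continuous because [p] is open, from a compact space to a
    Hausdorff one. *)
Lemma quotient_through_cover (W X S : topologicalType) (p : W -> X) (s : X -> X) (Th : W -> S) :
  covering_map p -> compact [set: X] -> hausdorff_space S -> continuous Th ->
  (forall u, exists x, Th x = u) ->
  (forall x y, Th x = Th y <-> orbit_proj s (p x) = orbit_proj s (p y)) ->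
  homeomorphic (orbit_space s) S.
Proof.
move=> hp cX hS Tc Ts TP; have [pc po _] := hp.
have onto q : exists x, orbit_proj s (p x) = q.
  by have [y <-] := orbit_proj_onto q; have [x <-] := po y; exists x.
pose h q := Th (projT1 (cid (onto q))).
have hE x : h (orbit_proj s (p x)) = Th x.
  by rewrite /h; case: cid => y /= yE; apply/TP.
exists h; apply: compact_hausdorff_homeo => //.
- have -> : [set: orbit_space s] = orbit_proj s @` [set: X].
    by apply/seteqP; split=> // q _; have [y <-] := orbit_proj_onto q; exists y.
  apply: continuous_compact cX; apply: continuous_subspaceT; exact: orbit_proj_continuous.
- apply: orbit_space_continuous; apply/continuousP => A oA.
  have -> : (h \o orbit_proj s) @^-1` A = p @` (Th @^-1` A).
    apply/seteqP; split=> [y|_ [x Ax <-]].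
      have [x <-] := po y; rewrite /preimage /= => Ax; exists x => //.
      by rewrite /preimage /= -hE.
    by move: Ax; rewrite /preimage /= -hE.
  apply: covering_open => //; apply: open_comp => // x _; exact: Tc.
- move=> q q'; have [x <-] := onto q; have [y <-] := onto q'.
  by rewrite !hE => /TP.
- by move=> u; have [x <-] := Ts u; exists (orbit_proj s (p x)).
Qed.

(** * The quotient by an odd Real structure *)

Section OddQuotient.
Variables (R : realType) (H : complexSurface R) (sigma : H -> H) (f g : W R -> W R) (p : W R -> H).
Hypotheses (hH : primary_Hopf_surface H) (hs : real_structure sigma).
Hypotheses (hfp : Hopf_presentation f p) (gc : continuous g).
Hypotheses (pg : p \o g = sigma \o p) (ggf : g \o g = f).

Let pgE x : p (g x) = sigma (p x). Proof. by have /(congr1 (@^~ x)) := pg. Qed.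

Let iter_f n x : iter n f x = iter (n + n) g x.
Proof. by elim: n => // n IH; rewrite addnS addSn !iterS IH -ggf. Qed.

(** Orbits of [f] consist of even iterates of [g]; passing to the orbits of [sigma] adds the odd
    ones. *)
Lemma odd_orbit x y : orbit_proj sigma (p x) = orbit_proj sigma (p y) <-> same_orbit g x y.
Proof.
have [_ _ pP] := hfp; have [_ sK] := hs; split.
  move=> /(involution_orbit sK) [/esym/pP|]; first by move=> [m [n]]; rewrite !iter_f; exists (m + m)%N, (n + n)%N.
  rewrite -pgE => /esym/pP[m [n]]; rewrite !iter_f -iterSr.
  by exists (m + m).+1, (n + n)%N.
move=> [m [n e]]; apply/orbit_projP; exists m, n.
have it k z : iter k sigma (p z) = p (iter k g z).
  by elim: k => // k IH; rewrite !iterS IH pgE.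
by rewrite !it e.
Qed.

(** A fixed point would equate an odd and an even iterate of [g] at some [x]. The exponents differ
    by parity, so cancelling leaves a point fixed by a positive iterate of [g], hence by one of
    [f]. *)
Lemma odd_sigma_free y : sigma y <> y.
Proof.
have [_ [[_ po _] _] pP] := hfp; have [x <-] := po y.
rewrite -pgE => /pP[m [n]]; rewrite !iter_f -iterSr => e.
have gi : injective g.
  by have [[_ [f' [_ fK _]]] _ _] := hfp; move=> a b /(congr1 g) h; apply: (can_inj fK); rewrite -ggf.
have gni k : injective (iter k g) by elim: k => // k IH a b; rewrite !iterS => /gi/IH.
have fp k z : (0 < k)%N -> iter k g z <> z.
  move=> k0 h; apply: (odd_orbit_free hH hfp k0 (x := z)).
  by rewrite iter_f iterD !h.
have [lt|gt|/esym eq] := ltngtP (m + m).+1 (n + n)%N.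
- apply: (fp (n + n - (m + m).+1)%N x); first by rewrite subn_gt0.
  by apply: (gni (m + m).+1); rewrite -iterD subnKC ?(ltnW lt).
- apply: (fp ((m + m).+1 - (n + n))%N x); first by rewrite subn_gt0.
  by apply: (gni (n + n)%N); rewrite -iterD subnKC ?(ltnW gt).
- by have := congr1 odd eq; rewrite /= !addnn !odd_double.
Qed.

Lemma odd_quotient_spheres : homeomorphic (orbit_space sigma) (sphere R 1 * sphere R 3)%type.
Proof.
have [_ [hcov _] _] := hfp; have [Hc _ _ _] := hH.
have [c [c0 c1] gC] := odd_lift_conj hH hs hfp gc pg ggf.
have [Th [Tc Ts TP]] := odd_lift_spheres c0 c1 gC.
apply: (quotient_through_cover hcov Hc (@sphere_prod_hausdorff R 1 3) Tc Ts) => x y.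
by split=> [/TP/odd_orbit|/odd_orbit/TP].
Qed.

End OddQuotient.

Theorem proposition5p17 (R : realType) (H : complexSurface R) (sigma : H -> H)
  (hH : primary_Hopf_surface H) (hsigma : real_structure sigma)
  (hodd : odd_real_structure sigma) :
  [/\ homeomorphic (orbit_space sigma) (sphere R 1 * sphere R 3)%type,
      double_cover (orbit_proj sigma) &
      exists tau : H -> H,
        [/\ deck_transformation (orbit_proj sigma) tau,
            tau <> id,
            forall t : H -> H, deck_transformation (orbit_proj sigma) t ->
              t <> id -> t = tau
          & real_structure tau]].
Proof.
have [f [p [g [hfp gc pg ggf]]]] := hodd.
have [[sc _] sK] := hsigma; have [_ Hconn _ [x0 _]] := hH.
have sf := odd_sigma_free hH hfp pg ggf.
have hX := @csurf_hausdorff _ H.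
split; first exact: odd_quotient_spheres hH hsigma hfp gc pg ggf.
  exact: free_involution_double_cover.
exists sigma; split => //; first exact: free_involution_deck.
  (* The base point of the fundamental group shows that [H] is nonempty, which [sigma <> id]
     requires. *)
  by move=> e; apply: (sf x0); rewrite e.
by move=> t; exact: free_involution_deck_unique.
Qed.
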